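(* Let $x:M^n\rightarrow\mathbb{R}^{n+1}$ $(n\ge3)$ be a locally strongly convex affine hypersphere with affine metric $h$. Suppose that $(M^n,h)$ is locally isometric to a Riemannian product $I\times\tilde M^{n-1}(c)$, with $I\subset\mathbb{R}$ an interval and $\tilde M^{n-1}(c)$ an $(n-1)$-dimensional Riemannian manifold with constant sectional curvature $c\neq0$. Then $c<0$, and $x:M^n\rightarrow\mathbb{R}^{n+1}$ is locally affinely equivalent to the Calabi composition $$x_1^2\,(x_{n+1}^2-x_{2}^2-\cdots-x_{n}^2)^{n}=1,$$ where $(x_1,\ldots,x_{n+1})$ are the standard coordinates of $\mathbb{R}^{n+1}$.
   Context: $\mathbb{R}^{n+1}$ is the real unimodular affine space with its standard flat connection $D$ and the parallel volume form given by the determinant. Let $x:M^n\to\mathbb{R}^{n+1}$ be an immersed nondegenerate hypersurface. Its affine normal $\xi$ is the canonical transversal vector field, determined up to sign by: writing $D_Xx_*(Y)=x_*(\nabla_XY)+h(X,Y)\xi$, the derivative $D_X\xi$ is tangential, $D_X\xi=-x_*(SX)$, and the volume form $\det(x_*X_1,\ldots,x_*X_n,\xi)$ agrees up to sign with the (pseudo-)Riemannian volume form of $h$. The symmetric bilinear form $h$ is called the affine metric and $S$ the affine shape operator. $M^n$ is locally strongly convex if (for a suitable choice of sign of $\xi$, which is then fixed) $h$ is positive definite, so that $(M^n,h)$ is a Riemannian manifold. $M^n$ is an affine hypersphere if all affine normal lines pass through a fixed point (proper) or all affine normals are parallel (improper); equivalently $S=H\,\mathrm{id}$ with $H$ constant.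 ''Locally affinely equivalent'' to a hypersurface means that locally the image of $x$ is carried onto an open part of that hypersurface by an affine transformation of $\mathbb{R}^{n+1}$. *)

(* Defs.v *)
From HB Require Import structures.
From mathcomp Require Import all_boot all_order all_algebra.
From mathcomp Require Import all_classical all_reals all_analysis.
Set Implicit Arguments.
Unset Strict Implicit.
Unset Printing Implicit Defensive.
Import Order.TTheory GRing.Theory Num.Theory.
Import numFieldNormedType.Exports.
Local Open Scope classical_set_scope.
Local Open Scope ring_scope.

(* Vectors are rows: 'J f u is the matrix whose i-th row is the i-th partial
   derivative of f, so that v *m 'J f u is the differential of f at u
   applied to v. *)

Section Smooth.
Variables (R : realType) (V W : normedModType R).

Fixpoint Ck (k : nat) (U : set V) (f : V -> W) : Prop :=
  match k with
  | 0%N => forall u, U u -> {for u, continuous f}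
  | k'.+1 => (forall u, U u -> differentiable f u) /\
             (forall v : V, Ck k' U (fun u => 'D_v f u))
  end.

(* Meaningful for open U only, since the derivatives at u see a full
   neighbourhood of u. *)
Definition smooth_on (U : set V) (f : V -> W) : Prop := forall k, Ck k U f.

End Smooth.

(* Data only: the axioms are in [smooth_manifold]. The inverse [cinv i] of a
   chart is a total function, relevant only on the image [cimg i]. *)
Record charted_space (R : realType) (n : nat) := ChartedSpace {
  carrier :> topologicalType;
  cidx : Type;
  cdom : cidx -> set carrier;
  cmap : cidx -> carrier -> 'rV[R]_n;
  cinv : cidx -> 'rV[R]_n -> carrier }.

Arguments cidx {R n} _.
Arguments cdom {R n c} _.
Arguments cmap {R n c} _.
Arguments cinv {R n c} _.

Definition cimg (R : realType) (n : nat) (M : charted_space R n)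
  (i : cidx M) : set 'rV[R]_n := cmap i @` cdom i.

Definition smooth_manifold (R : realType) (n : nat) (M : charted_space R n) :
    Prop :=
  [/\ hausdorff_space M, @second_countable M,
      forall p : M, exists i : cidx M, cdom i p,
      forall i : cidx M,
        [/\ open (cdom i), open (cimg i),
            forall p, cdom i p -> cinv i (cmap i p) = p,
            forall p, cdom i p -> {for p, continuous (cmap i)}
          & forall u, cimg i u -> {for u, continuous (cinv i)}]
    & forall i j : cidx M,
        smooth_on (cmap i @` (cdom i `&` cdom j)) (cmap j \o cinv i)].

Section Maps.
Variables (R : realType) (m n : nat).
Variables (M : charted_space R m) (N : charted_space R n).

(* The map F read in the chart i of M and the chart j of N. *)
Definition in_charts (i : cidx M) (j : cidx N) (F : M -> N) :
  'rV[R]_m -> 'rV[R]_n := cmap j \o F \o cinv i.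

Definition smooth_map_on (U : set M) (F : M -> N) : Prop :=
  (forall p, U p -> {for p, continuous F}) /\
  (forall (i : cidx M) (j : cidx N),
     smooth_on (cmap i @` (cdom i `&` U `&` F @^-1` cdom j)) (in_charts i j F)).

End Maps.

Definition diffeomorphism (R : realType) (m n : nat) (M : charted_space R m)
    (N : charted_space R n) (U : set M) (V : set N) (F : M -> N) (G : N -> M) :
    Prop :=
  [/\ (forall p, U p -> V (F p) /\ G (F p) = p),
      (forall q, V q -> U (G q) /\ F (G q) = q),
      smooth_map_on U F & smooth_map_on V G].

Section Metrics.
Variable R : realType.

(* Gram matrices of a field of bilinear forms with respect to the coordinate
   frame of each chart, as functions of the coordinates. *)
Definition metric (n : nat) (M : charted_space R n) :=
  cidx M -> 'rV[R]_n -> 'M[R]_n.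

Definition bform (n : nat) (G : 'M[R]_n) (v w : 'rV[R]_n) : R :=
  (v *m G *m w^T) 0 0.

Definition posdef (n : nat) (G : 'M[R]_n) : Prop :=
  G^T = G /\ forall v : 'rV[R]_n, v != 0 -> 0 < bform G v v.

Definition positive_definite (n : nat) (M : charted_space R n) (g : metric M) :
    Prop :=
  forall (i : cidx M) (u : 'rV[R]_n), cimg i u -> posdef (g i u).

Definition pullback_metric (m n : nat) (M : charted_space R m)
    (N : charted_space R n) (U : set M) (F : M -> N) (g : metric N)
    (h : metric M) : Prop :=
  forall (i : cidx M) (j : cidx N) (p : M),
    U p -> cdom i p -> cdom j (F p) ->
    let J : 'M[R]_(m, n) := 'J (in_charts i j F) (cmap i p) in
    h i (cmap i p) = J *m g j (cmap j (F p)) *m J^T.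

(* The last condition is the change-of-charts rule. *)
Definition riemannian_metric (n : nat) (M : charted_space R n) (g : metric M) :
    Prop :=
  [/\ forall i : cidx M, smooth_on (cimg i) (g i),
      positive_definite g
    & pullback_metric [set: M] idfun g g].

(* Every point of M has an open neighbourhood isometric to an open subset of N
   contained in D. *)
Definition locally_isometric_into (m n : nat) (M : charted_space R m)
    (h : metric M) (N : charted_space R n) (g : metric N) (D : set N) : Prop :=
  forall p : M, exists (U : set M) (V : set N) (F : M -> N) (G : N -> M),
    [/\ open U /\ U p, open V /\ V `<=` D, diffeomorphism U V F G
      & pullback_metric U F g h].

Section Curvature.
Variables (n : nat) (g : 'rV[R]_n -> 'M[R]_n).

Definition pd (i : 'I_n) (f : 'rV[R]_n -> R^o) : 'rV[R]_n -> R^o :=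
  fun u => 'D_(delta_mx 0 i) f u.

Definition christoffel (k i j : 'I_n) : 'rV[R]_n -> R^o := fun u =>
  2^-1 * \sum_l invmx (g u) k l *
    (pd i (fun v => g v j l) u + pd j (fun v => g v i l) u
     - pd l (fun v => g v i j) u).

(* The l-th component of R(e_i, e_j) e_k, where
   R(X, Y) = [nabla_X, nabla_Y] - nabla_[X, Y]. *)
Definition riemann (l i j k : 'I_n) (u : 'rV[R]_n) : R :=
  pd i (christoffel l j k) u - pd j (christoffel l i k) u
  + \sum_(s < n) (christoffel l i s u * christoffel s j k u
                  - christoffel l j s u * christoffel s i k u).

Definition curvature (u v w z : 'rV[R]_n) : 'rV[R]_n :=
  \row_l \sum_i \sum_j \sum_k v 0 i * w 0 j * z 0 k * riemann l i j k u.

Definition sectional_curvature (u v w : 'rV[R]_n) : R :=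
  bform (g u) (curvature u v w w) v /
  (bform (g u) v v * bform (g u) w w - bform (g u) v w ^+ 2).

End Curvature.

Definition constant_sectional_curvature (n : nat) (M : charted_space R n)
    (g : metric M) (c : R) : Prop :=
  forall (i : cidx M) (u v w : 'rV[R]_n),
    cimg i u -> row_free (col_mx v w) -> sectional_curvature (g i) u v w = c.

Definition real_line : charted_space R 1 :=
  @ChartedSpace R 1 R unit (fun=> setT) (fun _ t => const_mx t)
    (fun _ u => u 0 0).

Definition euclidean_metric : metric real_line := fun _ _ => 1%:M.

Definition product_space (m n : nat) (M : charted_space R m)
    (N : charted_space R n) : charted_space R (m + n) :=
  @ChartedSpace R (m + n) (M * N)%type (cidx M * cidx N)%type
    (fun i => cdom i.1 `*` cdom i.2)
    (fun i p => row_mx (cmap i.1 p.1) (cmap i.2 p.2))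
    (fun i u => (cinv i.1 (lsubmx u), cinv i.2 (rsubmx u))).

Definition product_metric (m n : nat) (M : charted_space R m)
    (N : charted_space R n) (g : metric M) (g' : metric N) :
    metric (product_space M N) :=
  fun i u => block_mx (g i.1 (lsubmx u)) 0 0 (g' i.2 (rsubmx u)).

(* (M, h) is locally isometric to the Riemannian product I x N, the latter
   being viewed inside the product of the real line with N. *)
Definition locally_isometric_to_interval_product (m n : nat)
    (M : charted_space R m) (h : metric M) (I : set R)
    (N : charted_space R n) (g : metric N) : Prop :=
  @locally_isometric_into m (1 + n) M h (product_space real_line N)
    (product_metric euclidean_metric g) (I `*` [set: N]).

End Metrics.

Section Hypersurfaces.
Variables (R : realType) (n : nat) (M : charted_space R n).

Definition smooth_vector_map (k : nat) (x : M -> 'rV[R]_k) : Prop :=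
  forall i : cidx M, smooth_on (cimg i) (x \o cinv i).

Definition immersed_hypersurface (x : M -> 'rV[R]_n.+1) : Prop :=
  smooth_vector_map x /\
  forall (i : cidx M) (u : 'rV[R]_n), cimg i u ->
    row_free ('J (x \o cinv i) u).

(* xi is an affine normal field of x, and h the induced affine metric.
   In a chart, X is the local parametrization and the row space of 'J X u is
   the tangent space. For coordinate (constant) fields v and w one has
   D_v x_*(w) = 'D_v ('D_w X), and the tangential part is x_*(nabla_v w).
   In the volume condition xi comes first rather than last, which only
   affects the sign of the determinant. *)
Definition affine_normal (x xi : M -> 'rV[R]_n.+1) (h : metric M) : Prop :=
  smooth_vector_map xi /\
  forall (i : cidx M) (u : 'rV[R]_n), cimg i u ->
    let X := x \o cinv i in
    let Xi := xi \o cinv i in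
    [/\ ~~ (Xi u <= 'J X u)%MS,
        h i u \in unitmx,
        forall v w : 'rV[R]_n,
          ('D_v (fun y => 'D_w X y) u - bform (h i u) v w *: Xi u
             <= 'J X u)%MS,
        forall v : 'rV[R]_n, ('D_v Xi u <= 'J X u)%MS
      & `|\det (col_mx (Xi u) ('J X u) : 'M[R]_n.+1)|
          = Num.sqrt `|\det (h i u)|].

Definition affine_hypersphere (x xi : M -> 'rV[R]_n.+1) : Prop :=
  (exists o : 'rV[R]_n.+1, forall p, exists t : R, x p + t *: xi p = o) \/
  (forall p q, exists t : R, xi p = t *: xi q).

Definition locally_affinely_equivalent (x : M -> 'rV[R]_n.+1)
    (S : set 'rV[R]_n.+1) : Prop :=
  forall p : M, exists (U : set M) (A : 'M[R]_n.+1) (b : 'rV[R]_n.+1)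
      (O : set 'rV[R]_n.+1),
    [/\ open U /\ U p, A \in unitmx, open O
      & (fun q => x q *m A + b) @` U = S `&` O].

End Hypersurfaces.

(* The coordinates x_1, ..., x_{n+1} are the entries of index 0, ..., n. *)
Definition calabi_composition (R : realType) (n : nat) : set 'rV[R]_n.+1 :=
  [set y : 'rV[R]_n.+1 | y 0 ord0 ^+ 2 *
     (y 0 ord_max ^+ 2 - \sum_(i < n.+1 | (0 < i < n)%N) y 0 i ^+ 2) ^+ n = 1].

Arguments calabi_composition : clear implicits.

(* Main.v *)
Require Import Defs.
From HB Require Import structures.
From mathcomp Require Import all_boot all_order all_fingroup all_algebra.
From mathcomp Require Import all_classical all_reals all_analysis.
From mathcomp Require Import ring lra.
Import Order.TTheory GRing.Theory Num.Theory.
Import numFieldNormedType.Exports.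
Local Open Scope classical_set_scope.
Local Open Scope ring_scope.

Set Implicit Arguments.
Unset Strict Implicit.
Unset Printing Implicit Defensive.

(* Write n = m + 1 and take product coordinates (t, u), so that h = dt^2 + G(u).
   Let K be the difference between the induced connection and the Levi-Civita
   connection of h. By the Codazzi equation the covariant derivative of K is
   totally symmetric; since d/dt is parallel, K_t commutes with the curvature of
   the second factor, hence K_t = diag(- m lam, lam, ..., lam). The Gauss equation
   makes the mean curvature equal to - n lam^2, so lam is constant, and for the
   part L of K along the second factor it reads [L_j, L_i] = kap R_ij with kap
   constant and R the curvature of unit sectional curvature. A computation with
   traces in an orthonormal frame then gives L = 0 and kap = 0, that is
   c = - (n + 1) lam^2 < 0.
   The frame equations can now be integrated: for Y measured from the centre,
   exp(n lam t) (Y_t - lam Y) is a constant vector, exp(- lam t) (Y_t + n lam Y)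
   describes a hyperboloid of a constant quadratic form, and Y is a combination
   of the two; in adapted affine coordinates this is the Calabi composition.
   Openness of the image is checked after forgetting the coordinate x_1, which is
   determined by the others up to sign. *)

(** * Cubic forms subject to the Gauss equation *)

(** All tensor calculus takes place over a commutative ring with commuting derivations, later the
    ring of smooth functions on a convex domain. Tensors are matrices over that ring, so that
    structure equations become ring identities. Positivity enters only after evaluation at a point,
    and convexity turns vanishing partial derivatives into constancy. The vanishing of [L] is a case
    split on the constant [kap]. If [kap = 0], a contraction of the Gauss equation says that the sum
    of squares of [L] is zero. If not, the differentiated Gauss equation is linear in the covariant
    derivative of [L] and forces it to vanish; the Ricci identity then makes [L] invariant under all
    infinitesimal rotations, and a trace-free symmetric cubic form with this property is zero. Only
    afterwards does [kap = 0] follow, which determines [c]. The exponents [lam] and [- n lam] are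
    the roots of [s^2 + (n - 1) lam s - n lam^2], the characteristic polynomial of the equation
    satisfied by [Y] along the line factor. The constant vector found in this way spans the [x_1]
    axis. It is never tangent to the hypersurface, which is why [x_1] can be forgotten. *)

Section CubicFormsOrthonormal.
Variables (F : realFieldType) (m : nat) (L : 'I_m -> 'M[F]_m) (k : F).
Hypothesis Lsym : forall a i j, L a i j = L a j i.
Hypothesis Lswap : forall a i j, L a i j = L i a j.
Hypothesis Ltr : forall a, \tr (L a) = 0.
Hypothesis Lgauss : forall a b,
  L b *m L a - L a *m L b = k *: (delta_mx b a - delta_mx a b).

Let LgaussE a b i j : (L b *m L a) i j =
  (L a *m L b) i j + k * ((i == b)%:R * (j == a)%:R - (i == a)%:R * (j == b)%:R).
Proof.
move: (Lgauss a b) => /(congr1 (+%R (L a *m L b))); rewrite addrC subrK => ->.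
by rewrite !mxE -!mulnb !natrM.
Qed.

Let Ltr1 i : \sum_a L a i a = 0.
Proof. by rewrite -[RHS](Ltr i) /mxtrace; apply: eq_bigr => a _; rewrite Lswap. Qed.

(** Sum over [j] the [(a, j)] entries of the Gauss equation for [L b] and [L j]: the product
    [L b *m L j] drops out because [L] is trace-free, and by total symmetry the other product gives
    [\tr (L a *m L b)]. *)
Lemma trace_mulL a b : \tr (L a *m L b) = k * (1 - m%:R) * (a == b)%:R.
Proof.
have -> : \tr (L a *m L b) = - \sum_j (L b *m L j - L j *m L b) a j.
  rewrite (eq_bigr (fun j => (L b *m L j) a j - (L j *m L b) a j)); last first.
    by move=> j _; rewrite !mxE.
  rewrite sumrB (eq_bigr (fun j => \sum_s L b a s * L j s j)); last first.
    by move=> j _; rewrite !mxE.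
  rewrite exchange_big /= big1 ?sub0r; last first.
    by move=> s _; rewrite -mulr_sumr Ltr1 mulr0.
  rewrite opprK /mxtrace; apply: eq_bigr => j _; rewrite !mxE.
  by apply: eq_bigr => s _; rewrite (Lswap j).
rewrite (eq_bigr (fun j => k * ((a == b)%:R - (a == j)%:R * (a == b)%:R))); last first.
  move=> j _; rewrite Lgauss !mxE eqxx andbT [j == b]eq_sym.
  by case: (a =P j) => [<-|_] /=; rewrite ?mul1r ?mul0r // eq_sym.
rewrite -mulr_sumr sumrB sumr_const card_ord -mulr_suml (bigD1 a) //= eqxx.
rewrite big1 ?addr0 => [|j]; last by rewrite eq_sym => /negbTE->.
by case: (a == b); rewrite /= ?mulr1 ?mulr0 ?mul0rn ?subr0 ?mulr0 ?oppr0 //; ring.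
Qed.

(** For [k = 0] the previous trace vanishes, and [\tr (L a *m L a)] is the sum of the squares of the
    entries of the symmetric matrix [L a]. *)
Lemma flat_cubic_form_eq0 : k = 0 -> forall a, L a = 0.
Proof.
move=> k0 a; apply/matrixP => i j; rewrite mxE.
have := trace_mulL a a; rewrite k0 !mul0r => H.
have : \sum_x \sum_y L a x y ^+ 2 = 0.
  rewrite -[RHS]H /mxtrace; apply: eq_bigr => x _; rewrite mxE.
  by apply: eq_bigr => y _; rewrite expr2 (Lsym a y x).
move/eqP; rewrite psumr_eq0 => [/allP/(_ i)|x _]; last first.
  by apply: sumr_ge0 => y _; exact: sqr_ge0.
rewrite mem_index_enum => /(_ isT)/=; rewrite psumr_eq0 => [/allP/(_ j)|y _]; last first.
  exact: sqr_ge0.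
by rewrite mem_index_enum => /(_ isT)/=; rewrite sqrf_eq0 => /eqP.
Qed.

(** [A d b] stands for the covariant derivative of [L b] in direction [d]; [AL] is then the
    derivative of the Gauss equation with [k] constant. *)
Variable A : 'I_m -> 'I_m -> 'M[F]_m.
Hypothesis Asym : forall a b i j, A a b i j = A a b j i.
Hypothesis Aswap : forall a b i j, A a b i j = A b a i j.
Hypothesis Aswap2 : forall a b i j, A a b i j = A a i b j.
Hypothesis Atr : forall a b, \tr (A a b) = 0.
Hypothesis AL : forall d a b,
  A d b *m L a - L a *m A d b + (L b *m A d a - A d a *m L b) = 0.

Let Atr1 d i : \sum_a A d a i a = 0.
Proof. by rewrite -[RHS](Atr d i) /mxtrace; apply: eq_bigr => a _; rewrite Aswap2. Qed.

(** The trace is symmetric in [w], [q], and contracting [AL] makes it skew in [q], [y]. A tensor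
    with both symmetries vanishes, as in the uniqueness of the Levi-Civita connection. *)
Lemma trace_mulAL w q y : \tr (A w q *m L y) = 0.
Proof.
have anti v a b : \tr (A v a *m L b) + \tr (A v b *m L a) = 0.
  have : \sum_j (A v b *m L j - L j *m A v b + (L b *m A v j - A v j *m L b)) a j = 0.
    by rewrite big1 // => j _; rewrite AL mxE.
  rewrite (eq_bigr (fun j => (\sum_s A v b a s * L j s j - \sum_s L j a s * A v b s j)
      + (\sum_s L b a s * A v j s j - \sum_s A v j a s * L b s j))); last first.
    by move=> j _; rewrite !mxE.
  rewrite big_split /= !sumrB exchange_big /= big1 ?sub0r; last first.
    by move=> s _; rewrite -mulr_sumr Ltr1 mulr0.
  rewrite [\sum_i \sum_s L b a s * _]exchange_big /= [X in _ + (X - _)]big1 ?sub0r; last first.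
    by move=> s _; rewrite -mulr_sumr Atr1 mulr0.
  rewrite -opprD => /eqP; rewrite oppr_eq0 => /eqP <-; rewrite addrC; congr (_ + _).
    rewrite mxtrace_mulC; apply: eq_bigr => i _; rewrite mxE.
    by apply: eq_bigr => s _; rewrite (Lswap i).
  by apply: eq_bigr => i _; rewrite mxE; apply: eq_bigr => s _; rewrite (Aswap2 v i).
have sw v a : A v a = A a v by apply/matrixP => i j; rewrite Aswap.
set t := fun w q y => \tr (A w q *m L y).
have e1 v a b : t v a b = t a v b by rewrite /t sw.
have e2 v a b : t v a b = - t v b a by apply/eqP; rewrite -addr_eq0; apply/eqP/anti.
have e3 : t w q y = - t w q y.
  rewrite {1}e2 e1 e2 opprK e1 e2; congr (- _).
  by rewrite e1 e1.
apply/eqP; have /eqP := e3; rewrite -subr_eq0 opprK -mulr2n mulrn_eq0 /=.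
by [].
Qed.

Let trALsum w q y : \sum_k0 \sum_l A w q k0 l * L y k0 l = 0.
Proof.
rewrite -[RHS](trace_mulAL w q y) /mxtrace; apply: eq_bigr => i _; rewrite mxE.
by apply: eq_bigr => j _; rewrite (Lsym y i).
Qed.

(* Contract [AL] with [L] in the last index: by [trace_mulAL] and the Gauss
   equation every quadratic term in [L] becomes a multiple of [k A]. *)
Lemma derivative_cubic_form_eq0 : k != 0 -> forall w x, A w x = 0.
Proof.
move=> k0 w x; apply/matrixP => p q; rewrite [RHS]mxE.
have AyLy i j : \sum_y (A w y *m L y) i j = 0.
  rewrite -[RHS](trALsum w i j); apply: eq_bigr => y _; rewrite mxE.
  by apply: eq_bigr => l _; rewrite (Aswap2 w y) (Lswap y) (Lsym l) (Lswap l) Lsym.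
have : \sum_y ((A w x *m L y - L y *m A w x + (L x *m A w y - A w y *m L x))
    *m L y) p q = 0.
  by rewrite big1 // => y _; rewrite AL mul0mx mxE.
rewrite (eq_bigr (fun y => (A w x *m (L y *m L y)) p q - (L y *m A w x *m L y) p q
   + ((L x *m (A w y *m L y)) p q - (A w y *m (L x *m L y)) p q))); last first.
  move=> y _; rewrite mulmxDl !mulmxBl !mulmxA.
  by move: (A w x *m _ *m _) (L y *m _ *m _) (L x *m _ *m _) (_ *m L x *m L y) => a b c d; rewrite !mxE.
rewrite big_split /= !sumrB.
(* By total symmetry the sum of the squares [L y *m L y] is the matrix of the traces
   [\tr (L s *m L q)], a multiple of the identity. *)
have -> : \sum_y (A w x *m (L y *m L y)) p q = k * (1 - m%:R) * A w x p q.
  rewrite (eq_bigr (fun y => \sum_s A w x p s * (L y *m L y) s q)); last first.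
    by move=> y _; rewrite mxE.
  rewrite exchange_big /= (bigD1 q) //= [X in _ + X]big1 => [|s sq].
    rewrite -mulr_sumr addr0 mulrC; congr (_ * _).
    have := trace_mulL q q; rewrite eqxx mulr1 => <-.
    apply: eq_bigr => y _; rewrite !mxE; apply: eq_bigr => l _.
    by rewrite (Lsym y l q) (Lswap y q) (Lsym q l y).
  rewrite -mulr_sumr.
  have := trace_mulL s q; rewrite (negbTE sq) mulr0 => H.
  suff -> : \sum_(i < m) (L i *m L i) s q = \tr (L s *m L q) by rewrite H mulr0.
  apply: eq_bigr => y _; rewrite !mxE; apply: eq_bigr => l _.
  by rewrite (Lswap y s) (Lsym y l q) (Lswap y q) (Lsym q l y).
have -> : \sum_y (L x *m (A w y *m L y)) p q = 0.
  rewrite (eq_bigr (fun y => \sum_s L x p s * (A w y *m L y) s q)); last first.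
    by move=> y _; rewrite mxE.
  rewrite exchange_big /= big1 // => s _; rewrite -mulr_sumr.
  by rewrite AyLy mulr0.
(* The Gauss equation moves [L x] to the right of [L y]; the reordered product vanishes by [AyLy]
   and only the term in [k] survives. *)
have -> : \sum_y (A w y *m (L x *m L y)) p q = k * A w x p q.
  rewrite (eq_bigr (fun y => \sum_s ((A w y *m L y) p s * L x s q)
     + k * (A w y p x * (q == y)%:R - A w y p y * (q == x)%:R))); last first.
    move=> y _; rewrite mxE.
    rewrite (eq_bigr (fun s => A w y p s * (L y *m L x) s q + k * (A w y p s *
        ((s == x)%:R * (q == y)%:R - (s == y)%:R * (q == x)%:R)))); last first.
      by move=> s _; rewrite LgaussE; ring.
    rewrite big_split /=; congr (_ + _).
      transitivity ((A w y *m (L y *m L x)) p q); first by rewrite mxE.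
      by rewrite mulmxA mxE.
    rewrite -mulr_sumr; congr (_ * _).
    rewrite (eq_bigr (fun s => (s == x)%:R * (A w y p s * (q == y)%:R)
       - (s == y)%:R * (A w y p s * (q == x)%:R))); last by move=> s _; ring.
    rewrite sumrB (bigD1 x) //= eqxx mul1r big1 => [|s /negbTE->]; last by rewrite mul0r.
    rewrite (bigD1 y) //= eqxx mul1r [X in _ - (_ + X)]big1 => [|s /negbTE->]; last by rewrite mul0r.
    by rewrite !addr0.
  rewrite big_split /= exchange_big /= big1 ?add0r; last first.
    by move=> s _; rewrite -mulr_suml AyLy mul0r.
  rewrite -mulr_sumr sumrB -[X in _ - X]mulr_suml Atr1 mul0r subr0; congr (_ * _).
  rewrite (bigD1 q) //= eqxx mulr1 big1 ?addr0 => [|s]; last first.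
    by rewrite eq_sym => /negbTE->; rewrite mulr0.
  by rewrite Aswap2 Asym (Aswap2 w p) Asym.
(* Summing over [y] first produces a product of two [L]; exchanging its factors leaves a contraction
   of [A] with [L], which is zero, and the term in [k]. *)
have -> : \sum_y (L y *m A w x *m L y) p q = k * A w x p q.
  transitivity (\sum_i \sum_j A w x i j * (L p *m L j) i q).
    rewrite (eq_bigr (fun y => \sum_j \sum_i L y p i * A w x i j * L y j q)); last first.
      move=> y _; rewrite mxE; apply: eq_bigr => j _; rewrite mxE mulr_suml.
      by [].
    rewrite (eq_bigr (fun y => \sum_i \sum_j L y p i * A w x i j * L y j q)); last first.
      by move=> y _; exact: exchange_big.
    rewrite exchange_big; apply: eq_bigr => i _.
    rewrite exchange_big; apply: eq_bigr => j _; rewrite mxE mulr_sumr.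
    apply: eq_bigr => y _; rewrite (Lswap y p) (Lsym p) (Lswap y j); ring.
  transitivity (\sum_s (\sum_i \sum_j A w x i j * L s i j) * L p s q
    + k * \sum_i \sum_j A w x i j * ((i == p)%:R * (j == q)%:R)
    - k * \sum_i \sum_j A w x i j * ((i == j)%:R * (q == p)%:R)).
    rewrite [X in _ = X + _ - _](eq_bigr (fun s =>
        \sum_i \sum_j A w x i j * L s i j * L p s q)); last first.
      by move=> s _; rewrite mulr_suml; apply: eq_bigr => i _; rewrite mulr_suml.
    rewrite [X in _ = X + _ - _]exchange_big /= !mulr_sumr -big_split -sumrB; apply: eq_bigr => i _ /=.
    rewrite [X in _ = X + _ - _]exchange_big /= !mulr_sumr -big_split -sumrB; apply: eq_bigr => j _ /=.
    have -> : \sum_(s < m) A w x i j * L s i j * L p s q =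
        A w x i j * (L j *m L p) i q.
      rewrite mxE mulr_sumr; apply: eq_bigr => s _.
      by rewrite -mulrA (Lswap s) [L i s j]Lsym (Lswap i).
    by rewrite (LgaussE j p) [q == j]eq_sym; ring.
  rewrite big1 ?add0r => [|s _]; last by rewrite trALsum mul0r.
  rewrite [X in _ - k * X](_ : _ = 0) ?mulr0 ?subr0; last first.
    rewrite (eq_bigr (fun i => A w x i i * (q == p)%:R)) => [|i _].
      by rewrite -mulr_suml -/(\tr (A w x)) Atr mul0r.
    rewrite (bigD1 i) //= eqxx mul1r big1 ?addr0 // => j.
    by rewrite eq_sym => /negbTE->; rewrite mul0r mulr0.
  congr (_ * _).
  rewrite (bigD1 p) //= [X in _ + X]big1 ?addr0 => [|i /negbTE ip]; last first.
    by rewrite big1 // => j _; rewrite ip mul0r mulr0.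
  rewrite (bigD1 q) //= big1 ?addr0 ?eqxx ?mulr1 // => j /negbTE ->.
  by rewrite !mulr0.
(* The four sums contribute [k (1 - m) - k + 0 - k = - k (m + 1)]. *)
move=> H; have {H} /eqP : - (k * m.+1%:R) * A w x p q = 0.
  by rewrite -[RHS]H -[in m.+1%:R]addn1 natrD; ring.
by rewrite mulf_eq0 oppr_eq0 mulf_eq0 (negbTE k0) pnatr_eq0 /= => /eqP.
Qed.

End CubicFormsOrthonormal.

(** * Orthonormal bases *)

Lemma schur_congruence (F : fieldType) (n : nat) (a : 'M[F]_1) (b : 'rV[F]_n)
    (d : 'M[F]_n) (P := block_mx 1 0 (- (a 0 0)^-1 *: b^T) 1 : 'M[_]_(1 + n)) :
  a 0 0 != 0 ->
  P *m block_mx a b b^T d *m P^T = block_mx a 0 0 (d - (a 0 0)^-1 *: (b^T *m b)).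
Proof.
move=> a0; have aE : a = (a 0 0)%:M.
  by apply/matrixP => i j; rewrite !ord1 !mxE eqxx mulr1n.
rewrite /P tr_block_mx !trmx1 !trmx0 mulmx_block !(mul1mx, mulmx1, mul0mx, mulmx0, addr0).
rewrite mulmx_block !(mul1mx, mulmx1, mul0mx, mulmx0, addr0, add0r).
have e : a *m (- (a 0 0)^-1 *: b^T)^T + b = 0.
  rewrite [in X in X *m _]aE mul_scalar_mx linearZ /= trmxK scalerA mulrN mulfV //.
  by rewrite scaleN1r addNr.
have -> : - (a 0 0)^-1 *: b^T *m a + b^T = 0.
  rewrite [in X in _ *m X]aE mul_mx_scalar scalerA mulrN mulfV //.
  by rewrite scaleN1r addNr.
by rewrite e mul0mx add0r -scalemxAl scaleNr addrC.
Qed.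

(** Induction on the size: a congruence splits off the first coordinate, and the Schur complement
    inherits positivity from the vectors [row_mx 0 v *m P0]. Normalising the pivot takes a square
    root, hence the real closed field. *)
Lemma orthonormal_basis (F : rcfType) (n : nat) (G : 'M[F]_n) :
  G^T = G -> (forall v : 'rV_n, v != 0 -> 0 < (v *m G *m v^T) 0 0) ->
  exists P : 'M[F]_n, P *m G *m P^T = 1%:M.
Proof.
elim: n G => [|n IH] G Gs Gp; first by exists 0; apply/matrixP => -[].
rewrite -[n.+1]/(1 + n)%N in G Gs Gp *.
pose a := ulsubmx G; pose b := ursubmx G; pose d := drsubmx G.
have GE : G = block_mx a b b^T d.
  by rewrite -[G in LHS]submxK; congr block_mx; rewrite /b trmx_ursub Gs.
have a0 : 0 < a 0 0.
  have /Gp : row_mx 1 0 != 0 :> 'rV[F]_(1 + n).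
    apply/eqP => /(congr1 lsubmx); rewrite row_mxKl linear0 => /matrixP/(_ 0 0).
    by rewrite !mxE eqxx => /eqP; rewrite oner_eq0.
  rewrite GE mul_row_block tr_row_mx mul_row_col !(mul0mx, mul1mx, trmx0, trmx1).
  by rewrite !addr0 mulmx1 mulmx0 addr0.
have aN0 : a 0 0 != 0 by rewrite gt_eqF.
pose P0 : 'M[F]_(1 + n) := block_mx 1 0 (- (a 0 0)^-1 *: b^T) 1.
have PGP : P0 *m G *m P0^T = block_mx a 0 0 (d - (a 0 0)^-1 *: (b^T *m b)).
  by rewrite GE; exact: schur_congruence.
have P0u : P0 \in unitmx.
  by rewrite unitmxE /P0 det_lblock !det1 mulr1 unitr1.
have [||P1 HP1] := IH (d - (a 0 0)^-1 *: (b^T *m b)).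
- by rewrite linearB /= linearZ /= trmx_mul trmxK /d trmx_drsub Gs.
- move=> v v0; have /Gp : row_mx 0 v *m P0 != 0.
    apply: contra v0 => /eqP H; have : row_mx 0 v = 0 :> 'rV[F]_(1 + n).
      by rewrite -[LHS](mulmxK P0u) H mul0mx.
    by move=> /(congr1 rsubmx); rewrite row_mxKr linear0 => ->.
  rewrite trmx_mul !mulmxA -[X in X *m _]mulmxA -[X in X *m _]mulmxA [P0 *m _]mulmxA PGP.
  rewrite mul_row_block tr_row_mx mul_row_col !(mul0mx, trmx0, mulmx0).
  by rewrite !add0r.
exists (block_mx (Num.sqrt (a 0 0))^-1%:M 0 0 P1 *m P0).
rewrite trmx_mul !mulmxA -[X in X *m _]mulmxA -[X in X *m _]mulmxA [P0 *m _]mulmxA PGP.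
rewrite tr_block_mx mulmx_block !(mul0mx, mulmx0, addr0, add0r, trmx0).
rewrite mulmx_block !(mul0mx, mulmx0, addr0, add0r) HP1 [RHS]scalar_mx_block.
congr block_mx; rewrite tr_scalar_mx mul_scalar_mx mul_mx_scalar scalerA.
rewrite -invfM -expr2 sqr_sqrtr ?(ltW a0) //.
by apply/matrixP => i j; rewrite !ord1 mxE mulVf // !mxE.
Qed.

(** Acting on rows, this is [Z |-> g(e_b, Z) e_a - g(e_a, Z) e_b], the curvature operator
    [R(e_a, e_b)] of a metric of sectional curvature 1. *)
Definition wedge (F : comPzRingType) (n : nat) (G : 'M[F]_n) (a b : 'I_n) : 'M[F]_n :=
  G *m (delta_mx b a - delta_mx a b).

(** * Cubic forms in an arbitrary frame *)

Section CubicForms.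
Variables (F : rcfType) (m : nat) (G P Z : 'M[F]_m) (L : 'I_m -> 'M[F]_m) (k : F).
Hypothesis ZE : Z = G *m P^T.
Hypothesis PG : P *m G *m P^T = 1%:M.
Hypothesis Gsym : G^T = G.
Hypothesis Lsym : forall a, (L a *m G)^T = L a *m G.
Hypothesis Lswap : forall a i j, L a i j = L i a j.
Hypothesis Ltr : forall a, \tr (L a) = 0.
Hypothesis Lgauss : forall a b, L b *m L a - L a *m L b = k *: wedge G a b.

Let PZ : P *m Z = 1%:M. Proof. by rewrite ZE mulmxA. Qed.
Let ZP : Z *m P = 1%:M. Proof. exact: mulmx1C. Qed.
Let comb (X : 'I_m -> 'M[F]_m) a := \sum_b P a b *: X b.
(** Passage to the orthonormal frame formed by the rows of [P]: [comb] changes the outer index, and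
    conjugation by [P], whose inverse is [Z], changes the two matrix indices. *)
Let frame (X : 'I_m -> 'M[F]_m) a := P *m comb X a *m Z.

Let combE X a i j : comb X a i j = \sum_b P a b * X b i j.
Proof. by rewrite summxE; apply: eq_bigr => b _; rewrite mxE. Qed.

Let comb_eq0 X : (forall a, comb X a = 0) -> forall a, X a = 0.
Proof.
move=> H a; transitivity (\sum_b Z a b *: comb X b); last first.
  by rewrite big1 // => b _; rewrite H scaler0.
rewrite (eq_bigr (fun b => \sum_c (Z a b * P b c) *: X c)); last first.
  by move=> b _; rewrite scaler_sumr; apply: eq_bigr => c _; rewrite scalerA.
rewrite exchange_big /= (bigD1 a) //= -scaler_suml [X in _ + X]big1 => [|c ca].
  have /matrixP/(_ a a) := ZP; rewrite !mxE eqxx => ->.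
  by rewrite scale1r addr0.
rewrite -scaler_suml; have /matrixP/(_ a c) := ZP; rewrite !mxE => ->.
by rewrite eq_sym (negbTE ca) scale0r.
Qed.

Let frame_eq0 (X : 'I_m -> 'M[F]_m) a : P *m X a *m Z = 0 -> X a = 0.
Proof.
move=> /(congr1 (fun Y => Z *m Y *m P)); rewrite mulmx0 mul0mx => <-.
by rewrite !mulmxA ZP mul1mx -mulmxA ZP mulmx1.
Qed.

Let frame_sym X : (X *m G)^T = X *m G -> forall i j,
  (P *m X *m Z) i j = (P *m X *m Z) j i.
Proof.
move=> XG i j; rewrite -[in LHS](trmxK (P *m X *m Z)) mxE; congr (_ _ _).
rewrite ZE mulmxA -[P *m X *m G]mulmxA trmx_mul [(_ *m (X *m G))^T]trmx_mul trmxK XG.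
by rewrite !mulmxA.
Qed.

Let frame_tr X : \tr (P *m X *m Z) = \tr X.
Proof. by rewrite mxtrace_mulC mulmxA ZP mul1mx. Qed.

Let frame_mul X Y : P *m X *m Z *m (P *m Y *m Z) = P *m (X *m Y) *m Z.
Proof. by rewrite !mulmxA -[_ *m Z *m P]mulmxA ZP mulmx1. Qed.

Let frame_swap (X : 'I_m -> 'M[F]_m) : (forall a i j, X a i j = X i a j) -> forall a i j,
  frame X a i j = frame X i a j.
Proof.
have H Y a i j : frame Y a i j = \sum_k0 \sum_l P i k0 * P a l * (Y l *m Z) k0 j.
  rewrite /frame -mulmxA mxE; apply: eq_bigr => s _.
  rewrite mulmx_suml summxE mulr_sumr; apply: eq_bigr => l _.
  by rewrite -scalemxAl mxE mulrA.
move=> Xs a i j; rewrite !H exchange_big; apply: eq_bigr => s _; apply: eq_bigr => l _.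
rewrite [P i _ * _]mulrC; congr (_ * _); rewrite !mxE; apply: eq_bigr => q _.
by rewrite Xs.
Qed.

Let comb_sym X : (forall a, (X a *m G)^T = X a *m G) ->
  forall a, (comb X a *m G)^T = comb X a *m G.
Proof.
move=> XG a; rewrite mulmx_suml linear_sum; apply: eq_bigr => b _.
by rewrite -scalemxAl linearZ /= XG.
Qed.

Let comb_tr X : (forall a, \tr (X a) = 0) -> forall a, \tr (comb X a) = 0.
Proof.
by move=> H a; rewrite linear_sum /= big1 // => b _; rewrite mxtraceZ H mulr0.
Qed.

Let combM X Y a b : comb X a *m comb Y b = \sum_c \sum_d (P a c * P b d) *: (X c *m Y d).
Proof.
rewrite mulmx_suml; apply: eq_bigr => c _; rewrite mulmx_sumr; apply: eq_bigr => d _.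
by rewrite -scalemxAl -scalemxAr scalerA.
Qed.

Let Lgauss' a b : frame L b *m frame L a - frame L a *m frame L b =
  k *: (delta_mx b a - delta_mx a b).
Proof.
rewrite /frame !frame_mul -mulmxBl -mulmxBr !combM.
rewrite [X in _ - X]exchange_big /= -sumrB.
rewrite (eq_bigr (fun c => \sum_d ((P b c * P a d) *: (k *: wedge G d c)))); last first.
  move=> c _; rewrite -sumrB; apply: eq_bigr => d _; rewrite -Lgauss scalerBr.
  by rewrite [P a d * _]mulrC.
have E x y : \sum_c \sum_d (P x c * P y d) *: delta_mx c d = (row x P)^T *m row y P.
  rewrite [RHS]matrix_sum_delta; apply: eq_bigr => c _; apply: eq_bigr => d _.
  by rewrite mxE big_ord1 !mxE.
transitivity (P *m (k *: (G *m ((row b P)^T *m row a P - (row a P)^T *m row b P))) *m Z).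
  congr (_ *m _ *m _); rewrite -!E [X in _ - X]exchange_big /= -sumrB mulmx_sumr scaler_sumr.
  apply: eq_bigr => c _; rewrite -sumrB mulmx_sumr scaler_sumr; apply: eq_bigr => d _.
  by rewrite [P a d * _]mulrC -scalerBr -scalemxAr !scalerA mulrC.
rewrite -scalemxAr -scalemxAl; congr (_ *: _).
have R1 x : row x P *m Z = delta_mx 0 x by rewrite -row_mul PZ row1.
have R2 x : P *m (G *m (row x P)^T) = delta_mx x 0.
  apply: trmx_inj; rewrite trmx_mul trmx_mul trmxK Gsym trmx_delta -R1 ZE.
  by rewrite !mulmxA.
by rewrite !mulmxBr mulmxBl !mulmxA -[_ *m G *m _]mulmxA -[P *m G *m _ ]mulmxA
  -[_ *m row a P *m Z]mulmxA -[_ *m row b P *m Z]mulmxA !R2 !R1 !mul_delta_mx.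
Qed.

Lemma cubic_form_eq0 : k = 0 -> forall a, L a = 0.
Proof.
move=> k0; apply: comb_eq0 => a; apply: (@frame_eq0 (comb L)).
apply: (@flat_cubic_form_eq0 _ _ (frame L) k) => //.
- by move=> b i j; apply: frame_sym; exact: comb_sym.
- exact: frame_swap.
- by move=> b; rewrite frame_tr comb_tr.
Qed.

Variable A : 'I_m -> 'I_m -> 'M[F]_m.
Hypothesis Asym : forall a b, (A a b *m G)^T = A a b *m G.
Hypothesis Aswap : forall a b, A a b = A b a.
Hypothesis Aswap2 : forall a b i j, A a b i j = A a i b j.
Hypothesis Atr : forall a b, \tr (A a b) = 0.
Hypothesis AL : forall d a b,
  A d b *m L a - L a *m A d b + (L b *m A d a - A d a *m L b) = 0.

Let B a b := comb (fun c => comb (A c) b) a.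

Let BE a b : B a b = \sum_c \sum_d (P a c * P b d) *: A c d.
Proof.
apply: eq_bigr => c _; rewrite scaler_sumr; apply: eq_bigr => d _.
by rewrite scalerA.
Qed.

Let Bswap a b : B a b = B b a.
Proof.
rewrite !BE exchange_big; apply: eq_bigr => c _; apply: eq_bigr => d _.
by rewrite Aswap mulrC.
Qed.

Lemma nabla_cubic_form_eq0 : k != 0 -> forall w x, A w x = 0.
Proof.
move=> k0 w; apply: comb_eq0 => x; move: w; apply: comb_eq0 => w.
apply: (@frame_eq0 (B w)).
apply: (@derivative_cubic_form_eq0 _ _ (frame L) k _ _ _ _ (fun a b => P *m B a b *m Z)) => //.
- by move=> b i j; apply: frame_sym; exact: comb_sym.
- exact: frame_swap.
- by move=> b; rewrite frame_tr comb_tr.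
- move=> a b i j; apply: frame_sym; apply: comb_sym => c; exact: comb_sym.
- by move=> a b i j; rewrite Bswap.
- move=> a b i j.
  have E y : P *m B a y *m Z = frame (fun d => comb (A^~ d) a) y.
    rewrite /frame; congr (_ *m _ *m _).
    rewrite BE exchange_big; apply: eq_bigr => d _; rewrite scaler_sumr.
    by apply: eq_bigr => c _; rewrite scalerA mulrC.
  by rewrite !E; apply: frame_swap => c p q; rewrite !combE; apply: eq_bigr => d _; rewrite Aswap2.
- by move=> a b; rewrite frame_tr comb_tr // => c; rewrite comb_tr.
- move=> d a b; rewrite !frame_mul -!(mulmxBl, mulmxBr) -mulmxDl -mulmxDr.
  suff -> : B d b *m comb L a - comb L a *m B d b + (comb L b *m B d a - B d a *m comb L b) = 0.
    by rewrite mulmx0 mul0mx.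
  pose S f : 'M[F]_m := \sum_c \sum_e \sum_g (P d c * P b e * P a g) *: f c e g.
  have E1 : B d b *m comb L a = S (fun c e g => A c e *m L g).
    rewrite BE mulmx_suml; apply: eq_bigr => c _; rewrite mulmx_suml; apply: eq_bigr => e _.
    rewrite mulmx_sumr; apply: eq_bigr => g _.
    by rewrite -scalemxAl -scalemxAr scalerA.
  have E2 : comb L a *m B d b = S (fun c e g => L g *m A c e).
    rewrite BE mulmx_sumr; apply: eq_bigr => c _; rewrite mulmx_sumr; apply: eq_bigr => e _.
    rewrite mulmx_suml; apply: eq_bigr => g _.
    by rewrite -scalemxAl -scalemxAr scalerA mulrC.
  have E3 : comb L b *m B d a = S (fun c e g => L e *m A c g).
    rewrite BE mulmx_sumr; apply: eq_bigr => c _; rewrite mulmx_sumr /S exchange_big.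
    apply: eq_bigr => e _; rewrite mulmx_suml; apply: eq_bigr => g _.
    by rewrite -scalemxAl -scalemxAr scalerA; congr (_ *: _); ring.
  have E4 : B d a *m comb L b = S (fun c e g => A c g *m L e).
    rewrite BE mulmx_suml; apply: eq_bigr => c _; rewrite mulmx_suml exchange_big.
    apply: eq_bigr => e _; rewrite mulmx_sumr; apply: eq_bigr => g _.
    by rewrite -scalemxAl -scalemxAr scalerA; congr (_ *: _); ring.
  rewrite E1 E2 E3 E4 /S -!sumrB -big_split big1 // => c _ /=.
  rewrite -!sumrB -big_split big1 // => e _ /=.
  rewrite -!sumrB -big_split big1 // => g _ /=.
  by rewrite -!scalerBr -scalerDr AL scaler0.
Qed.

End CubicForms.

(** * Curvature tensors of constant sectional curvature *)

Section CurvatureTensors.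
Variables (F : realFieldType) (m : nat) (T : 'I_m -> 'I_m -> 'I_m -> 'I_m -> F).
Hypothesis T12 : forall i j k l, T i j k l = - T j i k l.
Hypothesis T34 : forall i j k l, T i j k l = - T i j l k.
Hypothesis Tbianchi : forall i j k l, T i j k l + T j k i l + T k i j l = 0.

Let Q (v w z x : 'rV[F]_m) := \sum_i \sum_j \sum_k \sum_l
  v 0 i * w 0 j * z 0 k * x 0 l * T i j k l.

Hypothesis Tsec : forall v w, Q v w w v = 0.

Let QD1 v v' w z x : Q (v + v') w z x = Q v w z x + Q v' w z x.
Proof.
rewrite /Q -big_split; apply: eq_bigr => i _; rewrite -big_split; apply: eq_bigr => j _.
rewrite -big_split; apply: eq_bigr => k _; rewrite -big_split; apply: eq_bigr => l _.
by rewrite /= mxE; ring.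
Qed.

Let QD2 v w w' z x : Q v (w + w') z x = Q v w z x + Q v w' z x.
Proof.
rewrite /Q -big_split; apply: eq_bigr => i _; rewrite -big_split; apply: eq_bigr => j _.
rewrite -big_split; apply: eq_bigr => k _; rewrite -big_split; apply: eq_bigr => l _.
by rewrite /= mxE; ring.
Qed.

Let QD3 v w z z' x : Q v w (z + z') x = Q v w z x + Q v w z' x.
Proof.
rewrite /Q -big_split; apply: eq_bigr => i _; rewrite -big_split; apply: eq_bigr => j _.
rewrite -big_split; apply: eq_bigr => k _; rewrite -big_split; apply: eq_bigr => l _.
by rewrite /= mxE; ring.
Qed.

Let QD4 v w z x x' : Q v w z (x + x') = Q v w z x + Q v w z x'.
Proof.
rewrite /Q -big_split; apply: eq_bigr => i _; rewrite -big_split; apply: eq_bigr => j _.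
rewrite -big_split; apply: eq_bigr => k _; rewrite -big_split; apply: eq_bigr => l _.
by rewrite /= mxE; ring.
Qed.

Let QE i j k l : Q (delta_mx 0 i) (delta_mx 0 j) (delta_mx 0 k) (delta_mx 0 l) = T i j k l.
Proof.
have S (a : 'I_m) (f : 'I_m -> F) : (forall b, b != a -> f b = 0) -> \sum_b f b = f a.
  by move=> H; rewrite (bigD1 a) //= big1 ?addr0.
rewrite /Q (S i) => [|b /negbTE bi]; last first.
  by do 3!(rewrite big1 // => ? _); rewrite mxE bi andbF !mul0r.
rewrite (S j) => [|b /negbTE bj]; last first.
  by do 2!(rewrite big1 // => ? _); rewrite !mxE bj !andbF mulr0 !mul0r.
rewrite (S k) => [|b /negbTE bk]; last first.
  by rewrite big1 // => ? _; rewrite !mxE bk !andbF mulr0 !mul0r.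
rewrite (S l) => [|b /negbTE bl]; last by rewrite !mxE bl !andbF mulr0 !mul0r.
by rewrite !mxE !eqxx !mul1r.
Qed.

(** Polarising the sectional curvature in both arguments, with the pair symmetry that follows from
    Bianchi, makes [T] skew in its second and third indices. The Bianchi sum is then [3 T]. *)
Lemma curvature_tensor_eq0 i j k l : T i j k l = 0.
Proof.
pose e (a : 'I_m) : 'rV[F]_m := delta_mx 0 a.
have H1 a b : T a b b a = 0 by rewrite -QE Tsec.
have H2 a b c : T a b c a + T a c b a = 0.
  have := Tsec (e a) (e b + e c); rewrite !(QD2, QD3) !QE !H1 addr0 add0r.
  by [].
have H3 a b c : T a b b c + T c b b a = 0.
  have := Tsec (e a + e c) (e b); rewrite !(QD1, QD4) !QE !H1 addr0 add0r addrC.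
  by [].
have H4 a b c d : T a b c d + T a c b d + T d b c a + T d c b a = 0.
  have := Tsec (e a + e d) (e b + e c); rewrite !(QD1, QD2, QD3, QD4) !QE !H1.
  have := H2 a b c; have := H2 d b c; have := H3 a b d; have := H3 a c d.
  lra.
have pair a b c d : T a b c d = T c d a b.
  have := Tbianchi a b c d; have := Tbianchi b c d a; have := Tbianchi c d a b.
  have := Tbianchi d a b c.
  have := (T34 a b c d, T34 c d a b, T34 d a b c, T34 b c a d).
  have := (T12 b d a c, T34 d b a c, T34 a c b d, T12 c a b d).
  by move=> [[[? ?] ?] ?] [[[? ?] ?] ?]; lra.
have H5 a b c d : T a b c d = - T a c b d.
  have := H4 a b c d; have := pair a b c d; have := pair a c b d.
  have := (T12 d b c a, T34 d b c a, T12 d c b a, T34 d c b a).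
  have := (T34 b d c a, T34 c d b a, T12 c d a b).
  have := (pair b d a c, pair c d a b, pair d b c a, pair d c b a).
  have := (T12 c a d b, T34 a c d b, T12 b a d c, T34 a b d c, T34 b d a c, T34 c a b d).
  have := (T34 c a d b, T34 b a d c, T12 b a c d, T12 c a b d).
  move=> [[[? ?] ?] ?] [[[[[? ?] ?] ?] ?] ?] [[[? ?] ?] ?] [[? ?] ?] [[[? ?] ?] ?]; lra.
have := Tbianchi i j k l; have := H5 i j k l; have := H5 j k i l; have := H5 k i j l.
have := (T12 i j k l, T12 j i k l, T12 i k j l, T12 j k i l).
by move=> [[[? ?] ?] ?]; lra.
Qed.

End CurvatureTensors.

(** The difference of [r] and [c] times the model curvature, with an index lowered by [G], has the
    symmetries of a curvature tensor and zero sectional curvature, so the previous lemma applies to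
    it. *)
Lemma constant_curvature (F : realFieldType) (m : nat) (G : 'M[F]_m)
    (r : 'I_m -> 'I_m -> 'M[F]_m) (c : F) :
  c != 0 -> G \in unitmx -> G^T = G ->
  (forall i j, r i j = - r j i) ->
  (forall i j, (r i j *m G)^T = - (r i j *m G)) ->
  (forall i j k l, r i j k l + r j k i l + r k i j l = 0) ->
  (forall v w : 'rV_m, row_free (col_mx v w) ->
     (w *m (\sum_i \sum_j (v 0 i * w 0 j) *: r i j) *m G *m v^T) 0 0 /
     ((v *m G *m v^T) 0 0 * (w *m G *m w^T) 0 0 - (v *m G *m w^T) 0 0 ^+ 2) = c) ->
  forall i j, r i j = c *: wedge G i j.
Proof.
move=> c0 Gu Gs r12 r34 rb rsec.
have Gc p q : G p q = G q p by rewrite -[in LHS]Gs mxE.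
have WE a b k l : (wedge G a b *m G) k l = G k b * G a l - G k a * G b l.
  have S x y : (G *m delta_mx x y *m G) k l = G k x * G y l.
    rewrite -(mul_delta_mx (ord0 : 'I_1)) !mulmxA -colE -mulmxA -rowE mxE big_ord1 !mxE.
    by [].
  by rewrite /wedge mulmxBr mulmxBl mxE [X in _ + X]mxE !S.
pose T i j k l := ((r i j - c *: wedge G i j) *m G) k l.
have TE i j k l : T i j k l = (r i j *m G) k l - c * (G k j * G i l - G k i * G j l).
  by rewrite /T mulmxBl -scalemxAl -WE !mxE.
have rG34 i j k l : (r i j *m G) k l = - (r i j *m G) l k.
  by have /matrixP/(_ l k) := r34 i j; rewrite mxE => ->; rewrite mxE.
have sumE (X : 'I_m -> 'I_m -> 'M[F]_m) (v w : 'rV[F]_m) :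
   \sum_i \sum_j \sum_k \sum_l v 0 i * w 0 j * w 0 k * v 0 l * X i j k l =
   (w *m (\sum_i \sum_j (v 0 i * w 0 j) *: X i j) *m v^T) 0 0.
  rewrite mulmx_sumr mulmx_suml summxE; apply: eq_bigr => i _.
  rewrite mulmx_sumr mulmx_suml summxE; apply: eq_bigr => j _.
  rewrite -scalemxAr -scalemxAl mxE mxE exchange_big mulr_sumr; apply: eq_bigr => l _ /=.
  rewrite !mxE mulr_suml mulr_sumr; apply: eq_bigr => k _; ring.
have T0 i j k l : T i j k l = 0.
  apply: (@curvature_tensor_eq0 _ _ T) => {i j k l}.
  - by move=> i j k l; rewrite !TE r12 mulNmx mxE; ring.
  - move=> i j k l; rewrite !TE rG34 (Gc k j) (Gc i l) (Gc k i) (Gc j l); ring.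
  - move=> i j k l; rewrite !TE.
    have : (r i j *m G) k l + (r j k *m G) i l + (r k i *m G) j l = 0.
      rewrite !mxE -!big_split big1 // => s _ /=.
      by rewrite -!mulrDl rb mul0r.
    rewrite (Gc k j) (Gc i j) (Gc k i); lra.
  move=> v w; rewrite sumE.
  (* On dependent vectors nothing is assumed, but there the form vanishes by skew-symmetry in [i]
     and [j]. *)
  case: (boolP (row_free (col_mx v w))) => vw; last first.
    case: (eqVneq v 0) => [->|v0]; first by rewrite trmx0 mulmx0 mxE.
    have /sub_rVP[b ->] : (w <= v)%MS.
      have : (v <= col_mx v w)%MS by rewrite -[X in (X <= _)%MS]mul1mx -(mul1mx v) -[X in (X <= _)%MS]addr0 -(mul0mx _ w) -mul_row_col submxMl.
      move=> /mxrank_leqif_sup/geq_leqif; rewrite col_mx_sub submx_refl /= => <-.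
      rewrite rank_rV v0; move: vw; rewrite /row_free.
      by case: (\rank _) (rank_leq_row (col_mx v w)) => [|[|[|?]]].
    suff -> : \sum_i \sum_j (v 0 i * (b *: v) 0 j) *: ((r i j - c *: wedge G i j) *m G) = 0.
      by rewrite mulmx0 mul0mx mxE.
    set S := LHS; have : S = - S.
      rewrite {1}/S exchange_big -sumrN; apply: eq_bigr => i _; rewrite -sumrN.
      apply: eq_bigr => j _ /=.
      have -> : r j i - c *: wedge G j i = - (r i j - c *: wedge G i j).
        by rewrite r12 /wedge -[delta_mx i j - _]opprB mulmxN scalerN opprK opprD opprK.
      rewrite mulNmx scalerN; congr (- (_ *: _)).
      by rewrite !mxE; ring.
    move=> SN; apply/matrixP => i j; have /matrixP/(_ i j) := SN.
    by rewrite [(- S) i j]mxE [(0 : 'M[_]_m) i j]mxE; lra.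
  have -> : \sum_i \sum_j (v 0 i * w 0 j) *: ((r i j - c *: wedge G i j) *m G) =
     (\sum_i \sum_j (v 0 i * w 0 j) *: r i j) *m G -
     c *: ((G *m (w^T *m v - v^T *m w)) *m G).
    rewrite mulmx_suml -[X in _ - X]scale1r.
    have -> : w^T *m v - v^T *m w = \sum_i \sum_j (v 0 i * w 0 j) *: (delta_mx j i - delta_mx i j) :> 'M[_]_m.
      transitivity (\sum_i \sum_j (v 0 i * w 0 j) *: delta_mx j i - \sum_i \sum_j (v 0 i * w 0 j) *: delta_mx i j :> 'M[F]_m).
        congr (_ - _).
          rewrite [LHS]matrix_sum_delta exchange_big; apply: eq_bigr => i _; apply: eq_bigr => j _.
          by rewrite mxE big_ord1 !mxE mulrC.
        rewrite [LHS]matrix_sum_delta; apply: eq_bigr => i _; apply: eq_bigr => j _.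
        by rewrite mxE big_ord1 !mxE.
      rewrite -sumrB; apply: eq_bigr => i _; rewrite -sumrB; apply: eq_bigr => j _.
      by rewrite scalerBr.
    rewrite scale1r mulmx_sumr mulmx_suml scaler_sumr -sumrB; apply: eq_bigr => i _.
    rewrite mulmx_suml mulmx_sumr mulmx_suml scaler_sumr -sumrB; apply: eq_bigr => j _.
    by rewrite /wedge mulmxBl scalerBr -!scalemxAl -!scalemxAr -!scalemxAl !scalerA [c * _]mulrC.
  have gE (x y : 'rV[F]_m) : (x *m G *m y^T) 0 0 = (y *m G *m x^T) 0 0.
    have -> : x *m G *m y^T = (y *m G *m x^T)^T by rewrite !trmx_mul trmxK Gs mulmxA.
    by rewrite mxE.
  rewrite mulmxBr mulmxBl -scalemxAr -scalemxAl mxE [X in _ + X]mxE [X in _ - X]mxE.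
  have -> : (w *m (G *m (w^T *m v - v^T *m w) *m G) *m v^T) 0 0 =
     (v *m G *m v^T) 0 0 * (w *m G *m w^T) 0 0 - (v *m G *m w^T) 0 0 ^+ 2.
    rewrite mulmxBr mulmxBl mulmxBr mulmxBl mxE [X in _ + X]mxE.
    rewrite !mulmxA.
    have S (a b : 'rV[F]_m) : (w *m G *m a^T *m b *m G *m v^T) 0 0 =
        (w *m G *m a^T) 0 0 * (b *m G *m v^T) 0 0.
      rewrite -!mulmxA [w *m _]mulmxA [(w *m _) *m _]mulmxA.
      by rewrite [LHS]mxE big_ord1 !mulmxA.
    by rewrite !S (gE w v) mulrC expr2.
  (* If the denominator were [0], the quotient would be [0] by the convention on division, against
     [c != 0]. *)
  rewrite !mulmxA; case: (eqVneq ((v *m G *m v^T) 0 0 * (w *m G *m w^T) 0 0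
    - (v *m G *m w^T) 0 0 ^+ 2) 0) => X0; last by rewrite -(rsec _ _ vw) mulfVK ?subrr.
  by move: (rsec _ _ vw) c0; rewrite X0 invr0 mulr0 => <-; rewrite eqxx.
move=> i j; apply/eqP; rewrite -subr_eq0 -[_ - _](mulmxK Gu); apply/eqP.
have -> : (r i j - c *: wedge G i j) *m G = 0.
  by apply/matrixP => k l; rewrite [RHS]mxE; exact: T0.
by rewrite mul0mx.
Qed.

(** * Structure equations of a hypersphere *)

Lemma mx_addE (V : zmodType) (p q : nat) (A B : 'M[V]_(p, q)) i j :
  (A + B) i j = A i j + B i j.
Proof. by rewrite mxE. Qed.

Lemma mx_oppE (V : zmodType) (p q : nat) (A : 'M[V]_(p, q)) i j : (- A) i j = - A i j.
Proof. by rewrite mxE. Qed.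

Lemma mx_scaleE (R : pzRingType) (p q : nat) a (A : 'M[R]_(p, q)) i j :
  (a *: A) i j = a * A i j.
Proof. by rewrite mxE. Qed.

Lemma mx_zeroE (V : nmodType) (p q : nat) i j : (0 : 'M[V]_(p, q)) i j = 0.
Proof. by rewrite mxE. Qed.

Lemma tr_addmx (V : zmodType) (p q : nat) (A B : 'M[V]_(p, q)) :
  (A + B)^T = A^T + B^T.
Proof. by apply/matrixP => i j; rewrite !mxE. Qed.

Lemma tr_oppmx (V : zmodType) (p q : nat) (A : 'M[V]_(p, q)) : (- A)^T = - A^T.
Proof. by apply/matrixP => i j; rewrite !mxE. Qed.

(* Decides an identity between linear combinations of matrices by comparing
   entries, treating every other matrix expression as an atom. *)
Ltac mxring :=
  let i := fresh in let j := fresh in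
  apply/matrixP => i j; rewrite ?(mx_addE, mx_oppE, mx_scaleE, mx_zeroE); ring.

Lemma row_delta_mul (R : pzRingType) (p q : nat) (M : 'M[R]_(p, q)) (i : 'I_p) :
  delta_mx (0 : 'I_1) i *m M = row i M.
Proof. by rewrite rowE. Qed.

Lemma scale_unit_eq0 (R : comUnitRingType) (p q : nat) a (M : 'M[R]_(p, q)) :
  a \is a GRing.unit -> a *: M = 0 -> M = 0.
Proof. by move=> au aM; rewrite -[M]scale1r -(mulVr au) -scalerA aM scaler0. Qed.

Lemma wedgeE (R : comPzRingType) (p : nat) (G : 'M[R]_p) (a b : 'I_p) :
  wedge G a b = col b G *m delta_mx (0 : 'I_1) a - col a G *m delta_mx (0 : 'I_1) b.
Proof. by rewrite /wedge mulmxBr !colE -!mulmxA !mul_delta_mx. Qed.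

Section Derivations.
Variables (A : comUnitRingType) (N : nat) (D : 'I_N -> {additive A -> A}).
Hypothesis DM : forall d a b, D d (a * b) = D d a * b + a * D d b.
Hypothesis DC : forall d e a, D d (D e a) = D e (D d a).

Definition dmx (d : 'I_N) (p q : nat) (M : 'M[A]_(p, q)) : 'M[A]_(p, q) := map_mx (D d) M.

Lemma dmxE d p q (M : 'M[A]_(p, q)) i j : dmx d M i j = D d (M i j).
Proof. by rewrite mxE. Qed.

Lemma D1 d : D d 1 = 0.
Proof.
have : D d (1 * 1) - D d (1 * 1) = D d 1 by rewrite {1}DM !mulr1 mul1r addrK.
by rewrite subrr.
Qed.

Lemma Dnat d n : D d n%:R = 0.
Proof. by rewrite raddfMn /= D1 mul0rn. Qed.

Lemma dmx0 d p q : dmx d (0 : 'M[_]_(p, q)) = 0.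
Proof. by apply/matrixP => i j; rewrite !mxE raddf0. Qed.

Lemma dmxD d p q (M M' : 'M[_]_(p, q)) : dmx d (M + M') = dmx d M + dmx d M'.
Proof. by apply/matrixP => i j; rewrite !mxE raddfD. Qed.

Lemma dmxN d p q (M : 'M[_]_(p, q)) : dmx d (- M) = - dmx d M.
Proof. by apply/matrixP => i j; rewrite !mxE raddfN. Qed.

Lemma dmxB d p q (M M' : 'M[_]_(p, q)) : dmx d (M - M') = dmx d M - dmx d M'.
Proof. by rewrite dmxD dmxN. Qed.

Lemma dmx_sum d p q (I : Type) (r : seq I) (P : pred I) (F : I -> 'M[_]_(p, q)) :
  dmx d (\sum_(i <- r | P i) F i) = \sum_(i <- r | P i) dmx d (F i).
Proof. by elim/big_rec2: _ => [|i x y _ <-]; rewrite ?dmx0 ?dmxD. Qed.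

Lemma dmxM d p q s (M : 'M[_]_(p, q)) (M' : 'M[_]_(q, s)) :
  dmx d (M *m M') = dmx d M *m M' + M *m dmx d M'.
Proof.
apply/matrixP => i j; rewrite !mxE raddf_sum -big_split /=.
by apply: eq_bigr => k _; rewrite DM !mxE.
Qed.

Lemma dmxZ d p q a (M : 'M[_]_(p, q)) : dmx d (a *: M) = D d a *: M + a *: dmx d M.
Proof. by apply/matrixP => i j; rewrite !mxE DM. Qed.

Lemma dmxC d e p q (M : 'M[_]_(p, q)) : dmx d (dmx e M) = dmx e (dmx d M).
Proof. by apply/matrixP => i j; rewrite !mxE DC. Qed.

Lemma dmx_tr d p q (M : 'M[_]_(p, q)) : dmx d M^T = (dmx d M)^T.
Proof. by apply/matrixP => i j; rewrite !mxE. Qed.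

Lemma dmx_scalar d p a : dmx d (a%:M : 'M[_]_p) = (D d a)%:M.
Proof. by apply/matrixP => i j; rewrite !mxE raddfMn. Qed.

Lemma mxtrace_dmx d p (M : 'M[_]_p) : \tr (dmx d M) = D d (\tr M).
Proof. by rewrite /mxtrace raddf_sum; apply: eq_bigr => i _; rewrite mxE. Qed.

Lemma D_prod d (I : finType) (F : I -> A) :
  D d (\prod_i F i) = \sum_k D d (F k) * \prod_(i | i != k) F i.
Proof.
suff H (r : seq I) : uniq r -> D d (\prod_(i <- r) F i) =
    \sum_(k <- r) D d (F k) * \prod_(i <- r | i != k) F i.
  by rewrite H ?index_enum_uniq.
elim: r => [|x r IH] /=; first by rewrite !big_nil D1.
move=> /andP[xr ur]; rewrite !big_cons DM IH // eqxx; congr (_ * _ + _).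
  rewrite big_seq [RHS]big_seq_cond; apply: eq_bigl => i.
  by case: eqVneq => [->|]; rewrite ?(negbTE xr) ?andbT.
rewrite mulr_sumr !big_seq; apply: eq_bigr => k kr; rewrite big_cons.
by case: eqVneq => [e|_] /=; [move: xr; rewrite e kr | ring].
Qed.

(** Jacobi's formula: the product rule in the permutation sum differentiates one row at a time, and
    expanding [\det (Mk k)] along row [k] produces the cofactors. *)
Lemma D_det d p (M : 'M[_]_p) : D d (\det M) = \tr (\adj M *m dmx d M).
Proof.
pose Mk k := \matrix_(i, j) if i == k then D d (M k j) else M i j.
transitivity (\sum_k \det (Mk k)).
  rewrite raddf_sum exchange_big; apply: eq_bigr => s _ /=.
  have S (b : bool) x : D d ((-1) ^+ b * x) = (-1) ^+ b * D d x.
    by case: b; rewrite ?expr0 ?expr1 ?mul1r // !mulN1r raddfN.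
  rewrite S D_prod mulr_sumr; apply: eq_bigr => k _; congr (_ * _).
  rewrite [RHS](bigD1 k) //= mxE eqxx; congr (_ * _); apply: eq_bigr => i /negbTE ik.
  by rewrite mxE ik.
rewrite mxtrace_mulC; apply: eq_bigr => k _.
rewrite (expand_det_row _ k) mxE; apply: eq_bigr => j _.
rewrite !mxE eqxx; congr (_ * (_ * _)); congr (\det _).
by apply/matrixP => a b; rewrite !mxE eq_sym (negbTE (neq_lift _ _)).
Qed.

(* The rows of [E] are the affine normal and the partial derivatives of the
   position vector; [h] is the affine metric, [H] the mean curvature. *)
Section StructureEquations.
Variables (E : 'M[A]_(1 + N)) (h : 'M[A]_N) (H : A) (Gam K : 'I_N -> 'M[A]_N).
Let Om d : 'M[A]_(1 + N) := block_mx 0 (- H *: delta_mx 0 d) (col d h) (Gam d + K d).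
Hypothesis Eunit : E \in unitmx.
Hypothesis dE : forall d, dmx d E = Om d *m E.
Hypothesis DH : forall d, D d H = 0.
Hypothesis hsym : h^T = h.
Hypothesis hunit : h \in unitmx.
Hypothesis two_unit : (2 : A) \is a GRing.unit.
Hypothesis Ksw : forall a b c, K a b c = K b a c.
Hypothesis Gsw : forall a b c, Gam a b c = Gam b a c.
Hypothesis Gmet : forall d, dmx d h = Gam d *m h + (Gam d *m h)^T.
Hypothesis vol : \det E ^+ 2 = \det h.

(** Row [k] of [curv a b] is [R(e_a, e_b) e_k]. Operators act on rows from the right, hence the
    reversed order in the products. *)
Definition curv a b := dmx a (Gam b) - dmx b (Gam a) + (Gam b *m Gam a - Gam a *m Gam b).

(** Covariant derivative of an endomorphism field. For [X = K b] the index [b] is left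
    undifferentiated; the missing term is symmetric in [d] and [b], so it does not affect the
    Codazzi equation. *)
Definition nabla d (X : 'M[A]_N) := dmx d X + (X *m Gam d - Gam d *m X).

(** Integrability of the frame equations: second derivatives of [E] commute and [E] can be
    cancelled. *)
Lemma flatness d b : dmx d (Om b) + Om b *m Om d = dmx b (Om d) + Om d *m Om b.
Proof.
have := dmxC d b E; rewrite !dE !dmxM !dE !mulmxA -!mulmxDl.
by move=> /(congr1 (mulmx^~ (invmx E))); rewrite !mulmxK.
Qed.

Lemma flatness_blocks d b :
  dmx d (col b h) + (Gam b + K b) *m col d h = dmx b (col d h) + (Gam d + K d) *m col b h /\
  dmx d (Gam b + K b) - H *: (col b h *m delta_mx 0 d) + (Gam b + K b) *m (Gam d + K d) =
  dmx b (Gam d + K d) - H *: (col d h *m delta_mx 0 b) + (Gam d + K d) *m (Gam b + K b).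
Proof.
have := flatness d b; rewrite /dmx !map_block_mx !mulmx_block !add_block_mx.
move/eq_block_mx => [_ _]; rewrite -!/(dmx _ _) !mulmx0 !add0r => -> e; split=> //.
by move: e; rewrite -!scalemxAr !scaleNr !addrA.
Qed.

(** In the normal component of [flatness], metric compatibility and absence of torsion cancel all
    Christoffel terms. What remains is a second symmetry of the cubic form [K d *m h], which
    together with [Ksw] makes it totally symmetric. *)
Lemma diff_tensor_sym d : (K d *m h)^T = K d *m h.
Proof.
have GhE a b c : (Gam a *m h) b c = (Gam b *m h) a c.
  by rewrite !mxE; apply: eq_bigr => s _; rewrite Gsw.
have KhE a b c : (K a *m h) b c = (K b *m h) a c.
  by rewrite !mxE; apply: eq_bigr => s _; rewrite Ksw.
have dcol a b c : dmx a (col b h) c 0 = (Gam a *m h) c b + (Gam a *m h) b c.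
  by have /matrixP/(_ c b) := Gmet a; rewrite !mxE.
have CE a b c : ((Gam a + K a) *m col b h) c 0 = (Gam a *m h) c b + (K a *m h) c b.
  rewrite mulmxDl mx_addE; congr (_ + _); rewrite !mxE; apply: eq_bigr => s _;
    by rewrite [col _ _ _ _]mxE.
have cod a b c : (K b *m h) c a = (K a *m h) c b.
  have [/matrixP/(_ c 0)] := flatness_blocks a b.
  rewrite !mx_addE !dcol !CE => e _.
  apply/eqP; rewrite -subr_eq0 -[X in _ == X](subrr ((Gam a *m h) c b + (Gam a *m h) b c +
    ((Gam b *m h) c a + (K b *m h) c a))) {2}e (GhE a b c); apply/eqP; ring.
by apply/matrixP => a b; rewrite mxE KhE cod KhE.
Qed.

(** Apolarity: the logarithmic derivative of [\det E ^+ 2] is [2 \tr (Gam d + K d)], that of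
    [\det h] is [2 \tr (Gam d)], and the volume condition equates them. *)
Lemma tr_diff_tensor d : \tr (K d) = 0.
Proof.
have : D d (\det E ^+ 2) = D d (\det h) by rewrite vol.
rewrite expr2 DM !D_det dE Gmet mulmxA mxtrace_mulC mulmxA mul_mx_adj mul_scalar_mx mxtraceZ.
rewrite mulmxDr linearD /= mulmxA mxtrace_mulC mulmxA mul_mx_adj mul_scalar_mx mxtraceZ.
have -> : \tr (\adj h *m (Gam d *m h)^T) = \det h * \tr (Gam d).
  rewrite trmx_mul hsym mulmxA mul_adj_mx mul_scalar_mx mxtraceZ mxtrace_tr.
  by [].
rewrite /Om mxtrace_block mxtrace0 add0r [_ * \det E]mulrC mulrA -expr2 vol => e.
have {e} : (2 * \det h) * \tr (K d) = 0.
  rewrite -[RHS](subrr (\det h * \tr (Gam d + K d) + \det h * \tr (Gam d + K d))) {2}e.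
  by rewrite linearD /=; ring.
have u : 2 * \det h \is a GRing.unit by rewrite unitrM two_unit -unitmxE.
by move=> /(congr1 ( *%R (2 * \det h)^-1)); rewrite mulKr // mulr0.
Qed.

(** Metric compatibility, inserted in the equality of the mixed second derivatives of [h]. *)
Lemma curv_anti a b : (curv a b *m h)^T = - (curv a b *m h).
Proof.
have := dmxC a b h; rewrite (Gmet a) (Gmet b) !dmxD !dmx_tr !dmxM (Gmet a) (Gmet b).
set X := Gam a; set Y := Gam b; set dX := dmx b X; set dY := dmx a Y => e.
suff : (curv a b *m h)^T + curv a b *m h = 0 by move/eqP; rewrite addr_eq0 => /eqP.
rewrite /curv -/X -/Y -/dX -/dY; move: e.
rewrite !(mulmxDl, mulmxDr, tr_addmx, tr_oppmx, trmx_mul, mulNmx, mulmxN, trmxK, hsym) !mulmxA => e.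
rewrite -[RHS](subrr (dY *m h + (Y *m X *m h + Y *m h *m X^T) + (h *m dY^T + (h *m X^T *m Y^T + X *m h *m Y^T)))) {2}e.
mxring.
Qed.

Lemma curv_bianchi i j k l : curv i j k l + curv j k i l + curv k i j l = 0.
Proof.
have E1 a b c : (Gam a *m Gam b) c l = (Gam c *m Gam b) a l.
  by rewrite !mxE; apply: eq_bigr => s _; rewrite Gsw.
have E2 a b c : dmx a (Gam b) c l = dmx a (Gam c) b l by rewrite !mxE Gsw.
rewrite /curv !(mx_addE, mx_oppE) (E1 j i k) (E1 i j k) (E1 j k i) (E2 i j k) (E2 j i k) (E2 k j i).
by ring.
Qed.

Lemma curvN a b : curv a b = - curv b a.
Proof. by rewrite /curv; mxring. Qed.

Lemma nabla_sym d X : (X *m h)^T = X *m h -> (nabla d X *m h)^T = nabla d X *m h.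
Proof.
move=> Xh; have -> : nabla d X *m h =
    dmx d (X *m h) - (Gam d *m (X *m h) + (Gam d *m (X *m h))^T).
  rewrite dmxM Gmet /nabla [(Gam d *m h)^T]trmx_mul hsym [(Gam d *m (_ *m _))^T]trmx_mul.
  by rewrite Xh !(mulmxDl, mulmxDr, mulNmx, mulmxN) !mulmxA; mxring.
by rewrite linearB /= -dmx_tr Xh linearD /= trmxK [X in _ - X]addrC.
Qed.

Lemma nablaM d X Y : nabla d (X *m Y) = nabla d X *m Y + X *m nabla d Y.
Proof.
by rewrite /nabla dmxM !(mulmxDl, mulmxDr, mulNmx, mulmxN) !mulmxA; mxring.
Qed.

Lemma nablaB d X Y : nabla d (X - Y) = nabla d X - nabla d Y.
Proof.
by rewrite /nabla dmxB !(mulmxDl, mulmxDr, mulNmx, mulmxN); mxring.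
Qed.

Lemma nablaZ d a X : nabla d (a *: X) = D d a *: X + a *: nabla d X.
Proof. by rewrite /nabla dmxZ -scalemxAl -scalemxAr; mxring. Qed.

Lemma nabla_sum d (I : finType) (X : I -> 'M[A]_N) :
  nabla d (\sum_i X i) = \sum_i nabla d (X i).
Proof.
by rewrite /nabla dmx_sum mulmx_suml mulmx_sumr -sumrB -big_split.
Qed.

(** The tangential part of [flatness] is a single equation [N1 + N2 = 0]. Here [N1], the Codazzi
    defect, is self-adjoint for [h] and [N2], the Gauss defect, is skew, so both vanish since [2] is
    invertible. *)
Lemma nabla_gauss d b :
  nabla d (K b) = nabla b (K d) /\
  curv d b = K d *m K b - K b *m K d + H *: wedge h d b.
Proof.
have [_] := flatness_blocks d b.
rewrite !dmxD => e.
pose N1 := nabla d (K b) - nabla b (K d).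
pose N2 := curv d b - (K d *m K b - K b *m K d) - H *: wedge h d b.
have N0 : N1 + N2 = 0.
  rewrite -[RHS](subrr (dmx d (Gam b) + dmx d (K b) - H *: (col b h *m delta_mx 0 d) + (Gam b + K b) *m (Gam d + K d))) {2}e.
  rewrite /N1 /N2 /nabla /curv wedgeE.
  by rewrite !(mulmxDl, mulmxDr); mxring.
have Wanti : (wedge h d b *m h)^T = - (wedge h d b *m h).
  rewrite /wedge trmx_mul [(h *m _)^T]trmx_mul hsym tr_addmx tr_oppmx !trmx_delta.
  by rewrite -[delta_mx d b - _]opprB mulNmx mulmxN mulmxA.
have Kanti : ((K d *m K b - K b *m K d) *m h)^T = - ((K d *m K b - K b *m K d) *m h).
  have E1 a c : (K a *m K c *m h)^T = K c *m K a *m h.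
    have Kh : h *m (K a)^T = K a *m h by rewrite -diff_tensor_sym trmx_mul hsym.
    by rewrite -[RHS]mulmxA -Kh mulmxA -[K c *m h]diff_tensor_sym -trmx_mul mulmxA.
  by rewrite mulmxBl linearB /= !E1 opprB.
have N1s a c : (nabla a (K c) *m h)^T = nabla a (K c) *m h.
  by apply: nabla_sym; exact: diff_tensor_sym.
have N10 : N1 *m h = 0.
  have s1 : (N1 *m h)^T = N1 *m h by rewrite /N1 mulmxBl linearB /= !N1s.
  have s2 : (N2 *m h)^T = - (N2 *m h).
    rewrite /N2; move: (K d *m K b - K b *m K d) Kanti (curv d b) (curv_anti d b) => Z Za S Sa.
    rewrite !(mulmxDl, mulNmx) -scalemxAl !(tr_addmx, tr_oppmx) [(_ *: _)^T]linearZ /=.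
    by rewrite Wanti Za Sa; mxring.
  have : N1 *m h + N2 *m h = 0 by rewrite -mulmxDl N0 mul0mx.
  have : N1 *m h - N2 *m h = 0 by rewrite -s1 -s2 -linearD /= -mulmxDl N0 mul0mx linear0.
  move=> e1 e2; have e3 : 2 *: (N1 *m h) = 0.
    rewrite -[RHS]addr0 -{1}e1 -e2; mxring.
  exact: scale_unit_eq0 two_unit e3.
have N1E : N1 = 0 by rewrite -[N1](mulmxK hunit) N10 mul0mx.
split; first by apply/eqP; rewrite -subr_eq0 -/N1 N1E.
apply/eqP; rewrite -subr_eq0 opprD addrA -/N2.
by move: N0; rewrite N1E add0r => ->.
Qed.

Lemma nabla_comm a b X : nabla a (nabla b X) - nabla b (nabla a X) = X *m curv a b - curv a b *m X.
Proof.
rewrite /nabla /curv !(dmxD, dmxB, dmxN, dmxM) (dmxC a b).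
rewrite !(mulmxDl, mulmxDr, mulmxN, mulNmx) !mulmxA; by mxring.
Qed.

(* [z] is the direction of the flat factor: differentiating the Codazzi
   equation along it turns the Ricci identity into a commutation relation. *)
Lemma diff_tensor_flat_comm z : Gam z = 0 -> (forall d, dmx z (Gam d) = 0) ->
  forall a b, K z *m curv a b = curv a b *m K z.
Proof.
move=> Gz dG a b.
have nz b' : nabla b' (K z) = dmx z (K b').
  by have [<- _] := nabla_gauss z b'; rewrite /nabla Gz mulmx0 mul0mx subrr addr0.
have comm c d : nabla c (dmx z (K d)) = dmx z (nabla c (K d)).
  by rewrite /nabla !(dmxD, dmxN, dmxM) !dG mulmx0 mul0mx addr0 add0r dmxC.
apply/eqP; rewrite -subr_eq0 -nabla_comm !nz !comm.
by have [-> _] := nabla_gauss a b; rewrite subrr.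
Qed.

End StructureEquations.
End Derivations.

(** * Linear algebra of the model curvature operators *)

Section Wedge.
Variables (A : comUnitRingType) (m : nat) (G : 'M[A]_m).
Hypothesis Gsym : G^T = G.
Hypothesis Gunit : G \in unitmx.

Lemma wedge_entry a b i j : wedge G a b i j = G i b * (a == j)%:R - G i a * (b == j)%:R.
Proof.
by rewrite wedgeE mx_addE mx_oppE !mxE !big_ord1 !mxE !eqxx /= [j == a]eq_sym [j == b]eq_sym.
Qed.

Lemma mul_wedge_entry p (X : 'M[A]_(p, m)) a b i j :
  (X *m wedge G a b) i j = (X *m G) i b * (a == j)%:R - (X *m G) i a * (b == j)%:R.
Proof.
have C c : X *m col c G = col c (X *m G) by rewrite !colE mulmxA.
rewrite wedgeE mulmxBr !mulmxA !C mx_addE mx_oppE.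
have S c d : (col c (X *m G) *m delta_mx 0 d) i j = (X *m G) i c * (d == j)%:R.
  by rewrite mxE big_ord1 [col _ _ _ _]mxE [delta_mx _ _ _ _]mxE eqxx eq_sym.
by rewrite !S.
Qed.

Lemma wedge_mul_entry p (X : 'M[A]_(m, p)) a b i j :
  (wedge G a b *m X) i j = G i b * X a j - G i a * X b j.
Proof.
rewrite wedgeE mulmxBl -!mulmxA !row_delta_mul mx_addE mx_oppE !mxE.
by rewrite !big_ord1 !mxE.
Qed.

Lemma sum_eqr (I : finType) (i : I) (F : I -> A) : \sum_k F k * (i == k)%:R = F i.
Proof.
rewrite (bigD1 i) //= eqxx mulr1 big1 ?addr0 // => k.
by rewrite eq_sym => /negbTE->; rewrite mulr0.
Qed.

(** For [i != j], column [i] of [k *m wedge G i j] is column [j] of [k *m G]; [m > 1] provides such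
    an [i] for every [j]. *)
Lemma row_wedge_eq0 p (k : 'M[A]_(p, m)) : (1 < m)%N ->
  (forall i j, k *m wedge G i j = 0) -> k = 0.
Proof.
move=> m2 kw; rewrite -[k](mulmxK Gunit).
suff -> : k *m G = 0 by rewrite mul0mx.
apply/matrixP => s j; rewrite [RHS]mxE.
have [i ij] : exists i : 'I_m, i != j.
  have m0 : (0 < m)%N by exact: ltn_trans m2.
  case: (eqVneq j (Ordinal m0)) => [->|]; last by rewrite eq_sym; exists (Ordinal m0).
  by exists (Ordinal m2).
have /matrixP/(_ s i) := kw i j; rewrite mul_wedge_entry eqxx mulr1 [RHS]mxE.
by rewrite eq_sym (negbTE ij) mulr0 subr0.
Qed.

Lemma wedge_scale_eq0 (k : A) : (1 < m)%N ->
  (forall i j, k *: wedge G i j = 0) -> k = 0.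
Proof.
move=> m2 kw; have /matrixP/(_ (Ordinal m2) (Ordinal m2)) : k%:M = 0 :> 'M[A]_m.
  apply: row_wedge_eq0 => // i j; rewrite mul_scalar_mx; exact: kw.
by rewrite !mxE eqxx.
Qed.

(** Schur's lemma for the rotation algebra. Over a ring there are no eigenspaces to use, so the
    commutation relation is contracted over the column index instead. *)
Lemma wedge_comm (X : 'M[A]_m) : (X *m G)^T = X *m G ->
  (forall i j, X *m wedge G i j = wedge G i j *m X) -> m%:R *: X = (\tr X)%:M.
Proof.
move=> XG Xw; suff e : m%:R *: X *m G = (\tr X)%:M *m G by rewrite -[LHS](mulmxK Gunit) e mulmxK.
rewrite mul_scalar_mx -scalemxAl; apply/matrixP => i b; rewrite !mx_scaleE.
have : \sum_a ((X *m wedge G a b) i a - (wedge G a b *m X) i a) = 0.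
  by rewrite big1 // => a _; rewrite Xw subrr.
have Zs : (X *m G) b i = (X *m G) i b by rewrite -[in LHS]XG mxE.
rewrite (eq_bigr (fun a => (X *m G) i b - (X *m G) i a * (b == a)%:R -
   (G i b * X a a - X b a * G a i))) => [|a _]; last first.
  rewrite mul_wedge_entry wedge_mul_entry eqxx mulr1; congr (_ - (_ - _)).
  by rewrite mulrC -{1}Gsym mxE.
rewrite !sumrB sumr_const card_ord sum_eqr -mulr_sumr -/(\tr X).
have -> : \sum_(i0 < m) X b i0 * G i0 i = (X *m G) b i by rewrite mxE.
rewrite Zs opprB addrA subrK mulr_natl => /eqP; rewrite subr_eq0 => /eqP ->.
by rewrite mulrC.
Qed.

(** The last hypothesis is invariance of the cubic form under the infinitesimal rotation
    [wedge G d a]. Contracted over [d], with traces zero, it leaves [(m - 1 + 1 + 1)] times the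
    form. *)
Lemma wedge_invariant_cubic_form_eq0 (L : 'I_m -> 'M[A]_m) :
  (forall a, (L a *m G)^T = L a *m G) -> (forall a i j, L a i j = L i a j) ->
  (forall a, \tr (L a) = 0) -> (m.+1%:R : A) \is a GRing.unit ->
  (forall d a b, L b *m wedge G d a - wedge G d a *m L b = \sum_c wedge G d a b c *: L c) ->
  forall a, L a = 0.
Proof.
move=> LG Lsw Ltr mu Lw b; rewrite -[L b](mulmxK Gunit).
suff -> : L b *m G = 0 by rewrite mul0mx.
apply: (scale_unit_eq0 mu); apply/matrixP => i a; rewrite mx_scaleE [RHS]mxE.
have : \sum_d ((L b *m wedge G d a) i d - (wedge G d a *m L b) i d -
    (\sum_c wedge G d a b c *: L c) i d) = 0.
  by rewrite big1 // => d _; rewrite -Lw mx_addE mx_oppE subrr.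
have Gc p q : G p q = G q p by rewrite -[in LHS]Gsym mxE.
have sy c p q : (L c *m G) p q = (L c *m G) q p by rewrite -[in LHS]LG mxE.
have sw c p q : (L c *m G) p q = (L p *m G) c q.
  by rewrite !mxE; apply: eq_bigr => s _; rewrite Lsw.
rewrite (eq_bigr (fun d => (L b *m G) i a - (L b *m G) i d * (a == d)%:R -
   (G i a * L b d d - L b a d * G d i) - (G b a * L i d d - L a i d * G d b))) => [|d _]; last first.
  rewrite mul_wedge_entry wedge_mul_entry eqxx mulr1; congr (_ - (_ - _) - _).
    by rewrite mulrC Gc.
  rewrite summxE (eq_bigr (fun c => G b a * L c i d * (d == c)%:R - G b d * L c i d * (a == c)%:R)).
    by rewrite sumrB !sum_eqr Lsw [G b d * _]mulrC [G b d]Gc.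
  by move=> c _; rewrite mx_scaleE wedge_entry; ring.
rewrite !sumrB sumr_const card_ord sum_eqr -!mulr_sumr -!/(\tr _) !Ltr !mulr0.
have -> : \sum_(i0 < m) L b a i0 * G i0 i = (L b *m G) i a by rewrite -sy mxE.
have -> : \sum_(i0 < m) L a i i0 * G i0 b = (L b *m G) i a.
  by transitivity ((L a *m G) i b); [rewrite mxE | rewrite sy sw sy].
by move=> <-; rewrite -[in m.+1%:R]addn1 natrD -mulr_natl; ring.
Qed.

End Wedge.

(** * Hyperspheres over a cylinder *)

Section ConstantForm.
Variables (A : comUnitRingType) (N n : nat) (D : 'I_N -> {additive A -> A}).
Hypothesis DM : forall d a b, D d (a * b) = D d a * b + a * D d b.

Lemma dmx_invmx d (E W : 'M[A]_n) : E \in unitmx ->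
  dmx D d E = W *m E -> dmx D d (invmx E) = - (invmx E *m W).
Proof.
move=> Eu dE; have : dmx D d (E *m invmx E) = 0.
  by rewrite mulmxV // dmx_scalar D1 // raddf0.
rewrite dmxM // dE mulmxK // => /(congr1 (mulmx (invmx E))).
by rewrite mulmx0 mulmxDr mulKmx // => /eqP; rewrite addrC addr_eq0 => /eqP.
Qed.

(** [Q] changes like the Gram matrix, in the moving frame [E], of a fixed bilinear form. The matrix
    of that form in ambient coordinates is therefore constant. *)
Lemma dmx_form_eq0 d (E W Q : 'M[A]_n) : E \in unitmx -> Q^T = Q ->
  dmx D d E = W *m E -> dmx D d Q = W *m Q + (W *m Q)^T ->
  dmx D d (invmx E *m Q *m (invmx E)^T) = 0.
Proof.
move=> Eu Qs dE dQ; rewrite !dmxM // dmx_tr (dmx_invmx Eu dE) dQ.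
rewrite [(W *m Q)^T]trmx_mul Qs tr_oppmx [(invmx E *m W)^T]trmx_mul.
by rewrite !(mulmxDl, mulmxDr, mulNmx, mulmxN) !mulmxA; mxring.
Qed.

End ConstantForm.

Lemma map_mx_tr (R S : Type) (f : R -> S) (p q : nat) (M : 'M[R]_(p, q)) :
  map_mx f M^T = (map_mx f M)^T.
Proof. by apply/matrixP => i j; rewrite !mxE. Qed.

Definition cylinder_christoffel (A : comUnitRingType) (m : nat) (gam : 'I_m -> 'M[A]_m)
    (d : 'I_(1 + m)) : 'M[A]_(1 + m) :=
  if fintype.split d is inr i then block_mx 0 0 0 (gam i) else 0.

Section CylinderChristoffel.
Variables (A : comUnitRingType) (m : nat) (gam : 'I_m -> 'M[A]_m).

Lemma cylinder_christoffel0 : cylinder_christoffel gam (lshift m 0) = 0.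
Proof. by rewrite /cylinder_christoffel -[lshift m 0]/(unsplit (inl 0)) unsplitK. Qed.

Lemma cylinder_christoffelS i :
  cylinder_christoffel gam (rshift 1 i) = block_mx 0 0 0 (gam i).
Proof. by rewrite /cylinder_christoffel -[rshift 1 i]/(unsplit (inr i)) unsplitK. Qed.

Lemma cylinder_christoffel_swap a b d : (forall i j k, gam i j k = gam j i k) ->
  cylinder_christoffel gam a b d = cylinder_christoffel gam b a d.
Proof.
move=> gam_swap; case: (split_ordP a) => i ->; case: (split_ordP b) => j ->.
- by rewrite !ord1.
- rewrite [i]ord1 cylinder_christoffel0 cylinder_christoffelS.
  by case: (split_ordP d) => k ->; rewrite mxE ?block_mxEul ?block_mxEur mxE.
- rewrite [j]ord1 cylinder_christoffel0 cylinder_christoffelS.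
  by case: (split_ordP d) => k ->; rewrite [RHS]mxE ?block_mxEul ?block_mxEur mxE.
- rewrite !cylinder_christoffelS.
  by case: (split_ordP d) => k ->; rewrite ?block_mxEdl ?block_mxEdr ?mxE.
Qed.

End CylinderChristoffel.

(* [A] stands for the smooth functions on a connected open set, [ev t] for the
   evaluation at the point [t] and [cst] for the embedding of the constants. *)
Section ProductHypersphere.
Variables (F : rcfType) (A : comUnitRingType) (T : Type) (t0 : T).
Variables (ev : T -> {rmorphism A -> F}) (cst : {rmorphism F -> A}).
Hypothesis ev_inj : forall a, (forall t, ev t a = 0) -> a = 0.
Hypothesis ev_unit : forall a, (forall t, ev t a != 0) -> a \is a GRing.unit.
Hypothesis ev_cst : forall t x, ev t (cst x) = x.
Variables (m : nat) (D : 'I_(1 + m) -> {additive A -> A}).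
Hypothesis DM : forall d a b, D d (a * b) = D d a * b + a * D d b.
Hypothesis DC : forall d e a, D d (D e a) = D e (D d a).
Hypothesis D_cst : forall d x, D d (cst x) = 0.
Hypothesis D_const : forall a, (forall d, D d a = 0) -> exists x, a = cst x.

Let z : 'I_(1 + m) := lshift m 0.
Let r (i : 'I_m) : 'I_(1 + m) := rshift 1 i.

Variables (G : 'M[A]_m) (gam : 'I_m -> 'M[A]_m).
Let h : 'M[A]_(1 + m) := block_mx 1 0 0 G.
Let Gam := cylinder_christoffel gam.
Let DR i := D (r i).

Variables (E : 'M[A]_(1 + (1 + m))) (H : A) (K : 'I_(1 + m) -> 'M[A]_(1 + m)) (c : F).
Hypothesis m_gt1 : (1 < m)%N.
Hypothesis Gsym : G^T = G.
Hypothesis Gpos : forall t (v : 'rV[F]_m), v != 0 ->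
  0 < (v *m map_mx (ev t) G *m v^T) 0 0.
Hypothesis gam_swap : forall a b d, gam a b d = gam b a d.
Hypothesis gam_metric : forall i, dmx D (r i) G = gam i *m G + (gam i *m G)^T.
Hypothesis dzG : dmx D z G = 0.
Hypothesis dzgam : forall i, dmx D z (gam i) = 0.
Hypothesis Eunit : E \in unitmx.
Hypothesis dE : forall d, dmx D d E =
  block_mx 0 (- H *: delta_mx 0 d) (col d h) (Gam d + K d) *m E.
Hypothesis DH : forall d, D d H = 0.
Hypothesis K_swap : forall a b d, K a b d = K b a d.
Hypothesis vol : \det E ^+ 2 = \det h.
Hypothesis c_neq0 : c != 0.
Hypothesis rie_const : forall i j, curv DR gam i j = cst c *: wedge G i j.

Lemma nat_unit n : (0 < n)%N -> (n%:R : A) \is a GRing.unit.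
Proof. by move=> n0; apply: ev_unit => t; rewrite rmorph_nat pnatr_eq0 -lt0n. Qed.

Lemma cst_unit x : x != 0 -> cst x \is a GRing.unit.
Proof. by move=> x0; apply: ev_unit => t; rewrite ev_cst. Qed.

Lemma map_ev_inj p q (M : 'M[A]_(p, q)) : (forall t, map_mx (ev t) M = 0) -> M = 0.
Proof.
move=> M0; apply/matrixP => i j; rewrite mxE; apply: ev_inj => t.
by have /matrixP/(_ i j) := M0 t; rewrite !mxE.
Qed.

Lemma metric_frame t : exists P : 'M[F]_m, P *m map_mx (ev t) G *m P^T = 1%:M.
Proof. by apply: orthonormal_basis; [rewrite -map_mx_tr Gsym | exact: Gpos]. Qed.

Lemma metric_unit : G \in unitmx.
Proof.
rewrite unitmxE; apply: ev_unit => t; rewrite -det_map_mx.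
have [P /(congr1 determinant)] := metric_frame t.
by rewrite !det_mulmx det1; case: eqP => // ->; rewrite mulr0 mul0r => /esym/eqP; rewrite oner_eq0.
Qed.
Let Gu := metric_unit.

Let hsym : h^T = h.
Proof. by rewrite tr_block_mx trmx1 !trmx0 Gsym. Qed.

Let hunit : h \in unitmx.
Proof. by rewrite unitmxE det_ublock det1 mul1r -unitmxE. Qed.

Let GamZ : Gam z = 0.
Proof. exact: cylinder_christoffel0. Qed.

Let GamR i : Gam (r i) = block_mx 0 0 0 (gam i).
Proof. exact: cylinder_christoffelS. Qed.

Let dzGam d : dmx D z (Gam d) = 0.
Proof.
rewrite /Gam /cylinder_christoffel; case: (fintype.split d) => [_|i]; first by rewrite dmx0.
by rewrite /dmx map_block_mx -!/(dmx D z _) !dmx0 dzgam block_mx0.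
Qed.

Let Gam_swap a b d : Gam a b d = Gam b a d.
Proof. exact: cylinder_christoffel_swap. Qed.

Let Gam_metric d : dmx D d h = Gam d *m h + (Gam d *m h)^T.
Proof.
rewrite /dmx /h map_block_mx -!/(dmx D d _) !dmx0 [dmx D d 1]dmx_scalar D1 // raddf0.
case: (split_ordP d) => i ->; first by rewrite [i]ord1 GamZ dzG mul0mx trmx0 addr0 block_mx0.
rewrite -/(r i) GamR gam_metric mulmx_block !(mul0mx, mulmx0, addr0, add0r).
by rewrite tr_block_mx !trmx0 add_block_mx !addr0.
Qed.

Let two_unit : (2 : A) \is a GRing.unit. Proof. exact: nat_unit. Qed.

Let Ksym := diff_tensor_sym DM DC Eunit dE K_swap Gam_swap Gam_metric.
Let Ktr := tr_diff_tensor DM dE hsym hunit two_unit Gam_metric vol.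
Let Kgauss := nabla_gauss DM DC Eunit dE hsym hunit two_unit K_swap Gam_swap Gam_metric.
Let Kcomm := diff_tensor_flat_comm DM DC Eunit dE hsym hunit two_unit K_swap Gam_swap Gam_metric GamZ dzGam.

Let curvZ d : curv D Gam z d = 0.
Proof. by rewrite /curv dzGam GamZ dmx0 mulmx0 mul0mx !subrr addr0. Qed.

Let curvR i j : curv D Gam (r i) (r j) = block_mx 0 0 0 (cst c *: wedge G i j).
Proof.
rewrite /curv !GamR /dmx !map_block_mx -!/(dmx D _ _) !dmx0 !mulmx_block.
rewrite !(mul0mx, mulmx0, addr0, add0r) -rie_const /curv.
by rewrite !opp_block_mx !add_block_mx !(oppr0, addr0).
Qed.

(** A normalised trace, so that it makes sense before this block is known to be scalar. *)
Definition diff_coef : A := m%:R^-1 * \tr (drsubmx (K z)).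
Let lam := diff_coef.

(** As [c] is invertible, commuting with the curvature means commuting with every [wedge G i j] on
    the second factor: the off-diagonal row is killed by all of them, and the lower block is scalar.
    Apolarity fixes the remaining entry. *)
Lemma diff_tensor_flat_direction : K z = block_mx (- (m%:R * lam))%:M 0 0 lam%:M.
Proof.
set k := ursubmx (K z); set k' := dlsubmx (K z); set X := drsubmx (K z).
have KE : K z = block_mx (ulsubmx (K z)) k k' X by rewrite submxK.
have cu := cst_unit c_neq0.
have comm i j : k *m wedge G i j = 0 /\ X *m wedge G i j = wedge G i j *m X.
  have := Kcomm (r i) (r j); rewrite curvR KE !mulmx_block.
  rewrite !(mul0mx, mulmx0, addr0, add0r) => /eq_block_mx [_ e1 _ e2].
  split; first by apply: (scale_unit_eq0 cu); rewrite scalemxAr.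
  apply/eqP; rewrite -subr_eq0; apply/eqP/(scale_unit_eq0 cu).
  by rewrite scalerBr scalemxAr e2 -scalemxAl subrr.
have k0 : k = 0 by apply: (row_wedge_eq0 Gu m_gt1) => i j; case: (comm i j).
have := Ksym z; rewrite {1 2}KE k0 mulmx_block !(mul0mx, mulmx0, addr0, add0r, mulmx1).
rewrite tr_block_mx trmx0 => /eq_block_mx [_ k'0 _ XG].
have XE : m%:R *: X = (\tr X)%:M by apply: (wedge_comm Gsym Gu XG) => i j; case: (comm i j).
have mu : (m%:R : A) \is a GRing.unit by apply: nat_unit; exact: ltnW.
have XE' : X = lam%:M by rewrite /lam /diff_coef -scale_scalar_mx -XE scalerA mulVr // scale1r.
have := Ktr z; rewrite KE mxtrace_block XE' mxtrace_scalar => /eqP.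
rewrite addr_eq0 => /eqP tr1.
have u1 : ulsubmx (K z) = (- (m%:R * lam))%:M.
  rewrite mulr_natl -tr1; apply/matrixP => i j; rewrite !ord1 [RHS]mxE eqxx /mxtrace big_ord1.
  by [].
rewrite u1 k0; congr block_mx.
by apply: trmx_inj; rewrite k'0 trmx0.
Qed.

Definition base_cubic (i : 'I_m) : 'M[A]_m := drsubmx (K (r i)).
Let L := base_cubic.

(** By total symmetry every component of the cubic form with an index in the line direction is
    already contained in [K z]. *)
Lemma diff_tensor_base_direction i :
  K (r i) = block_mx 0 (lam *: delta_mx 0 i) (lam *: col i G) (L i).
Proof.
have u : ulsubmx (K (r i)) = 0.
  apply/matrixP => a b; rewrite !ord1 !mxE K_swap -/z diff_tensor_flat_direction.
  by rewrite /r block_mxEdl mxE.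
have v : ursubmx (K (r i)) = lam *: delta_mx 0 i.
  apply/matrixP => a b; rewrite !ord1 !mxE K_swap -/z diff_tensor_flat_direction.
  by rewrite block_mxEdr !mxE eq_sym mulr_natr.
have KE : K (r i) = block_mx 0 (lam *: delta_mx 0 i) (dlsubmx (K (r i))) (L i).
  by rewrite -u -v submxK.
have := Ksym (r i); rewrite {1 2}KE mulmx_block !(mul0mx, mulmx0, addr0, add0r, mulmx1).
rewrite tr_block_mx trmx0 => /eq_block_mx [_ _ e _].
rewrite [LHS]KE -e -scalemxAl linearZ /= trmx_mul Gsym trmx_delta -colE.
by [].
Qed.

Lemma base_cubic_sym i : (L i *m G)^T = L i *m G.
Proof.
have := Ksym (r i); rewrite diff_tensor_base_direction mulmx_block.
rewrite !(mul0mx, mulmx0, addr0, add0r, mulmx1) tr_block_mx.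
by move=> /eq_block_mx [_ _ _ ->].
Qed.

Lemma base_cubic_swap a i j : L a i j = L i a j.
Proof. by rewrite !mxE K_swap. Qed.

Lemma base_cubic_tr i : \tr (L i) = 0.
Proof.
by have := Ktr (r i); rewrite diff_tensor_base_direction mxtrace_block mxtrace0 add0r.
Qed.

(** Planes containing the line direction are flat, so the corresponding entry of the Gauss equation
    reads [- m lam^2 - lam^2 - H = 0]. *)
Lemma mean_curvature_diff_coef : H = - (m.+1%:R * lam ^+ 2).
Proof.
pose i : 'I_m := Ordinal m_gt1.
have [_ /matrixP/(_ z (r i))] := Kgauss z (r i).
rewrite curvZ mx_addE mx_scaleE mx_addE mx_oppE [(0 : 'M[_]_(1 + m)) _ _]mxE wedge_entry.
rewrite diff_tensor_flat_direction diff_tensor_base_direction !mulmx_block /z /r !block_mxEur.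
rewrite block_mxEul eq_lrshift eqxx mulr0 mulr1 sub0r !mul_scalar_mx mul_mx_scalar !mul0mx.
rewrite addr0 add0r [(1 : 'M[_]_1) _ _]mxE eqxx scalerA !mx_scaleE !mxE !eqxx !mulr1.
move=> e; apply/eqP; rewrite -addr_eq0 -[X in _ == X]oppr0 e; apply/eqP.
by rewrite mulr1n -[in m.+1%:R]addn1 natrD; ring.
Qed.

Let wedge_product i j : wedge h (r i) (r j) = block_mx 0 0 0 (wedge G i j).
Proof.
have S a b : delta_mx (r a) (r b) = block_mx 0 0 0 (delta_mx a b) :> 'M[A]_(1 + m).
  by rewrite /r delta_mx_dshift delta_mx_rshift /block_mx row_mx0.
rewrite /wedge !S opp_block_mx add_block_mx mulmx_block.
by rewrite !(oppr0, addr0, mul0mx, mulmx0, add0r).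
Qed.

(** In the Gauss equation along the second factor, [lam ^+ 2] comes from the products that pass
    through the line direction. *)
Let kap := H - lam ^+ 2 - cst c.

Lemma base_gauss i j : L j *m L i - L i *m L j = kap *: wedge G i j.
Proof.
have [_] := Kgauss (r i) (r j); rewrite curvR wedge_product !diff_tensor_base_direction.
rewrite !mulmx_block scale_block_mx opp_block_mx !add_block_mx => /eq_block_mx [_ _ _].
rewrite -!scalemxAr -!scalemxAl !scalerA => e.
have -> : kap *: wedge G i j = H *: wedge G i j - lam ^+ 2 *: wedge G i j - cst c *: wedge G i j.
  by rewrite /kap !scalerBl.
by rewrite e (wedgeE G i j); mxring.
Qed.

Lemma base_codazzi i j : nabla DR gam i (L j) = nabla DR gam j (L i).
Proof.
have [e _] := Kgauss (r i) (r j); move: e.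
rewrite /nabla !GamR !diff_tensor_base_direction /dmx !map_block_mx -!/(dmx D _ _).
rewrite !mulmx_block !opp_block_mx !add_block_mx => /eq_block_mx [_ _ _].
by rewrite !(mul0mx, mulmx0, add0r).
Qed.

(** The full covariant derivative of the cubic form: unlike [nabla], it also differentiates the
    index [b]. *)
Definition nabla_cubic d b := nabla DR gam d (L b) - \sum_s gam d b s *: L s.
Let B := nabla_cubic.

Let gam_metric' i : dmx DR i G = gam i *m G + (gam i *m G)^T.
Proof. exact: gam_metric. Qed.

Lemma nabla_cubicC d b : B d b = B b d.
Proof.
rewrite /B /nabla_cubic base_codazzi; congr (_ - _).
by apply: eq_bigr => s _; rewrite gam_swap.
Qed.

Let DRM i a b : DR i (a * b) = DR i a * b + a * DR i b. Proof. exact: DM. Qed.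
Let DRC i j a : DR i (DR j a) = DR j (DR i a). Proof. exact: DC. Qed.

Lemma nabla_cubic_sym d b : (B d b *m G)^T = B d b *m G.
Proof.
rewrite /B /nabla_cubic mulmxBl linearB /= (nabla_sym DRM Gsym gam_metric') ?base_cubic_sym //.
congr (_ - _); rewrite mulmx_suml linear_sum; apply: eq_bigr => s _.
by rewrite -scalemxAl linearZ /= base_cubic_sym.
Qed.

Lemma nabla_cubic_swap a b i j : B a b i j = B a i b j.
Proof.
have S p q : (\sum_s gam a p s *: L s) q j = (gam a *m L q) p j.
  by rewrite summxE mxE; apply: eq_bigr => s _; rewrite mx_scaleE base_cubic_swap.
have S' p q : (L p *m gam a) q j = (L q *m gam a) p j.
  by rewrite !mxE; apply: eq_bigr => s _; rewrite base_cubic_swap.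
rewrite /B /nabla_cubic /nabla !(mx_addE, mx_oppE) !S !dmxE base_cubic_swap S'.
by ring.
Qed.

Lemma nabla_cubic_tr a b : \tr (B a b) = 0.
Proof.
rewrite /B /nabla_cubic /nabla !linearB linearD linearB /= mxtrace_dmx base_cubic_tr raddf0 add0r.
rewrite mxtrace_mulC subrr sub0r linear_sum big1 ?oppr0 // => s _.
by rewrite linearZ /= base_cubic_tr mulr0.
Qed.

(** The model curvature tensor is built from the metric alone, hence parallel; the right-hand side
    is the action of the connection on the indices [a] and [b]. *)
Lemma nabla_wedge d a b : nabla DR gam d (wedge G a b) =
  \sum_s gam d b s *: wedge G a s + \sum_s gam d a s *: wedge G s b.
Proof.
apply/matrixP => i j; rewrite /nabla !(mx_addE, mx_oppE) dmxE !wedge_entry.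
rewrite wedge_mul_entry mul_wedge_entry raddfB /= !DRM !Dnat // !mulr0 !addr0.
have DG p q : DR d (G p q) = (gam d *m G) p q + (gam d *m G) q p.
  have /matrixP/(_ p q) := gam_metric d; rewrite dmxE => ->.
  by rewrite mx_addE; congr (_ + _); rewrite mxE.
have Gc p q : G p q = G q p by rewrite -[in LHS]Gsym mxE.
have GgE p : (gam d *m G) p i = \sum_s gam d p s * G i s.
  by rewrite mxE; apply: eq_bigr => s _; rewrite Gc.
rewrite !DG !summxE.
rewrite [X in _ = X + _](_ : _ = (gam d *m G) b i * (a == j)%:R - G i a * gam d b j); last first.
  rewrite GgE mulr_suml -(sum_eqr j (gam d b)) mulr_sumr -sumrB; apply: eq_bigr => s _.
  by rewrite mx_scaleE wedge_entry [s == j]eq_sym; ring.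
rewrite [X in _ = _ + X](_ : _ = G i b * gam d a j - (gam d *m G) a i * (b == j)%:R); last first.
  rewrite GgE mulr_suml -(sum_eqr j (gam d a)) mulr_sumr -sumrB; apply: eq_bigr => s _.
  by rewrite mx_scaleE wedge_entry [s == j]eq_sym; ring.
ring.
Qed.

Lemma kap_const : exists x, kap = cst x.
Proof.
apply: D_const => d; rewrite /kap.
have e : D d (lam ^+ 2) = 0.
  have := DH d; rewrite mean_curvature_diff_coef raddfN /= DM Dnat // mul0r add0r => /eqP.
  rewrite oppr_eq0 => /eqP e; have u : (m.+1%:R : A) \is a GRing.unit by exact: nat_unit.
  by rewrite -[LHS](mulKr u) e mulr0.
by rewrite !raddfB /= DH e D_cst !subrr.
Qed.

(** Differentiate [base_gauss], with [kap] constant and the model curvature parallel; the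
    Christoffel terms on the two sides agree by [base_gauss] itself. *)
Lemma nabla_cubic_gauss d a b :
  B d b *m L a - L a *m B d b + (L b *m B d a - B d a *m L b) = 0.
Proof.
have [x kE] := kap_const.
have e : nabla DR gam d (L b *m L a - L a *m L b) =
    kap *: (\sum_s gam d b s *: wedge G a s + \sum_s gam d a s *: wedge G s b).
  by rewrite base_gauss nablaZ // nabla_wedge kE D_cst scale0r add0r.
have e1 : kap *: (\sum_s gam d b s *: wedge G a s) =
    (\sum_s gam d b s *: L s) *m L a - L a *m (\sum_s gam d b s *: L s).
  rewrite scaler_sumr mulmx_suml mulmx_sumr -sumrB; apply: eq_bigr => s _.
  by rewrite scalerA mulrC -scalerA -base_gauss scalerBr -scalemxAl -scalemxAr.
have e2 : kap *: (\sum_s gam d a s *: wedge G s b) =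
    L b *m (\sum_s gam d a s *: L s) - (\sum_s gam d a s *: L s) *m L b.
  rewrite scaler_sumr mulmx_suml mulmx_sumr -sumrB; apply: eq_bigr => s _.
  by rewrite scalerA mulrC -scalerA -base_gauss scalerBr -scalemxAl -scalemxAr.
move: e; rewrite scalerDr e1 e2 nablaB // !nablaM // /B /nabla_cubic.
move: (nabla _ _ _ (L a)) (nabla _ _ _ (L b)) (\sum_s gam d b s *: _) (\sum_s gam d a s *: _).
move=> Na Nb Sb Sa e; rewrite !(mulmxDl, mulmxDr, mulmxN, mulNmx).
rewrite -[RHS](subrr (Nb *m L a + L b *m Na - (Na *m L b + L a *m Nb))) {2}e.
by mxring.
Qed.

Let map_wedge t a b : map_mx (ev t) (wedge G a b) = wedge (map_mx (ev t) G) a b.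
Proof. by rewrite /wedge map_mxM map_mxB !map_delta_mx. Qed.

Let evL t a := map_mx (ev t) (L a).
Let evL_sym t a : (evL t a *m map_mx (ev t) G)^T = evL t a *m map_mx (ev t) G.
Proof. by rewrite -map_mxM -map_mx_tr base_cubic_sym. Qed.
Let evL_swap t a i j : evL t a i j = evL t i a j.
Proof. by rewrite !mxE K_swap. Qed.
Let evL_tr t a : \tr (evL t a) = 0.
Proof. by rewrite trace_map_mx base_cubic_tr rmorph0. Qed.
Let evL_gauss t a b : evL t b *m evL t a - evL t a *m evL t b =
  ev t kap *: wedge (map_mx (ev t) G) a b.
Proof. by rewrite -!map_mxM -map_mxB base_gauss map_mxZ map_wedge. Qed.
Let evG_sym t : (map_mx (ev t) G)^T = map_mx (ev t) G.
Proof. by rewrite -map_mx_tr Gsym. Qed.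

Lemma base_cubic_eq0 a : L a = 0.
Proof.
have [x kE] := kap_const; case: (eqVneq x 0) => [x0|x0].
  apply: map_ev_inj => t; have [P PG] := metric_frame t.
  apply: (cubic_form_eq0 erefl PG (evG_sym t) (evL_sym t) (@evL_swap t) (evL_tr t) (evL_gauss t)).
  by rewrite kE ev_cst.
(* For [kap != 0] the cubic form is parallel, by the pointwise algebra in an orthonormal frame. *)
have B0 d b : B d b = 0.
  apply: map_ev_inj => t; have [P PG] := metric_frame t.
  apply: (nabla_cubic_form_eq0 erefl PG (evG_sym t) (evL_sym t) (@evL_swap t) (evL_tr t)
    (evL_gauss t) (A := fun d b => map_mx (ev t) (B d b))).
  - by move=> i j; rewrite -map_mxM -map_mx_tr nabla_cubic_sym.
  - by move=> i j; rewrite nabla_cubicC.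
  - by move=> i j k l; rewrite mxE [RHS]mxE nabla_cubic_swap.
  - by move=> i j; rewrite trace_map_mx nabla_cubic_tr rmorph0.
  - by move=> i j k; rewrite -!map_mxM -!map_mxB -map_mxD nabla_cubic_gauss map_mx0.
  - by rewrite kE ev_cst.
have nL d b : nabla DR gam d (L b) = \sum_s gam d b s *: L s.
  by apply/eqP; rewrite -subr_eq0; apply/eqP; exact: B0.
apply: (wedge_invariant_cubic_form_eq0 Gsym Gu base_cubic_sym base_cubic_swap base_cubic_tr).
  exact: nat_unit.
(* For a parallel form the Ricci identity says that the curvature, hence every [wedge G d e], acts
   trivially on it. *)
move=> d e b; have cu := cst_unit c_neq0.
have nn i j : nabla DR gam i (nabla DR gam j (L b)) =
    \sum_s (dmx DR i (gam j) + gam j *m gam i) b s *: L s.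
  rewrite nL nabla_sum //.
  rewrite (eq_bigr (fun s => dmx DR i (gam j) b s *: L s +
     \sum_k (gam j b s * gam i s k) *: L k)) => [|s _]; last first.
    rewrite nablaZ // nL scaler_sumr dmxE; congr (_ + _); apply: eq_bigr => k _.
    by rewrite scalerA.
  rewrite big_split exchange_big -big_split; apply: eq_bigr => k _ /=.
  by rewrite mx_addE scalerDl; congr (_ + _); rewrite mxE scaler_suml.
have := nabla_comm DRM DRC gam d e (L b); rewrite !nn rie_const -sumrB.
rewrite (eq_bigr (fun s => cst c *: (wedge G d e b s *: L s))) => [|s _]; last first.
  rewrite -scalerBl scalerA -mx_scaleE -rie_const /curv; congr (_ *: _).
  by rewrite !(mx_addE, mx_oppE); ring.
rewrite -scaler_sumr -scalemxAl -scalemxAr -scalerBr => /eqP; rewrite eq_sym => /eqP E1.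
by apply/eqP; rewrite -subr_eq0; apply/eqP/(scale_unit_eq0 cu); rewrite scalerBr E1 subrr.
Qed.

(** With [L = 0] the Gauss equation gives [kap = 0], that is [c = H - lam^2] with
    [H = - (m + 1) lam^2]. *)
Lemma sectional_diff_coef : cst c = - (m.+2%:R * lam ^+ 2).
Proof.
have k0 : kap = 0.
  apply: (wedge_scale_eq0 Gu m_gt1) => i j.
  by rewrite -base_gauss !base_cubic_eq0 mulmx0 subrr.
apply/eqP; rewrite -subr_eq0 -oppr_eq0 -[X in _ == X]k0 /kap mean_curvature_diff_coef.
by apply/eqP; rewrite -[m.+2]addn1 natrD; ring.
Qed.

Lemma sectional_lt0 : c < 0.
Proof.
rewrite lt_neqAle c_neq0 /= -(ev_cst t0 c) sectional_diff_coef rmorphN rmorphM rmorph_nat rmorphXn.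
by rewrite oppr_le0 mulr_ge0 ?ler0n ?sqr_ge0.
Qed.

Lemma diff_coef_const : exists2 x, x != 0 & lam = cst x.
Proof.
have lu : lam \is a GRing.unit.
  have : cst c \is a GRing.unit by exact: cst_unit.
  by rewrite sectional_diff_coef unitrN unitrM unitrX_pos // => /andP[].
have [d|x lE] := D_const (a := lam).
  have := D_cst d c; rewrite sectional_diff_coef raddfN /= DM Dnat // mul0r add0r expr2 DM.
  move=> /eqP; rewrite oppr_eq0 => /eqP e.
  have u : m.+2%:R * 2 * lam \is a GRing.unit by rewrite unitrM lu andbT unitrM nat_unit.
  by rewrite -[LHS](mulKr u) (_ : _ * D d lam = 0) ?mulr0 // -e; ring.
exists x => //; apply/eqP => x0; move: lu; rewrite lE x0 rmorph0 => /(rmorph_unit (ev t0)).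
by rewrite rmorph0 unitr0.
Qed.

Variables (e q : A).
Hypothesis eq1 : e * q = 1.
Hypothesis dze : D z e = lam * e.
Hypothesis dre : forall i, D (r i) e = 0.

Let n : A := m.+1%:R.
Let Xi := usubmx E.
Let Yz := usubmx (dsubmx E).
Let Yb := dsubmx (dsubmx E).

Let EE : E = col_mx Xi (col_mx Yz Yb). Proof. by rewrite !vsubmxK. Qed.

Let dzE : [/\ dmx D z Xi = - H *: Yz, dmx D z Yz = Xi - (m%:R * lam) *: Yz
  & dmx D z Yb = lam *: Yb].
Proof.
have := dE z; rewrite {1}EE /dmx !map_col_mx -!/(dmx D z _) GamZ add0r.
rewrite diff_tensor_flat_direction EE.
have -> : delta_mx 0 z = row_mx 1 0 :> 'rV[A]_(1 + m).
  by rewrite /z delta_mx_lshift; congr row_mx; apply/matrixP => i j; rewrite !ord1 !mxE.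
have -> : col z h = col_mx 1 0 :> 'cV[A]_(1 + m).
  apply/matrixP => i j; rewrite [LHS]mxE /h /z; case: (split_ordP i) => k ->.
    by rewrite block_mxEul col_mxEu !ord1.
  by rewrite block_mxEdl col_mxEd !mxE.
rewrite mul_block_col mul0mx add0r scale_row_mx scaler0 mul_row_col mul0mx addr0.
rewrite mul_block_col !mul0mx addr0 add0r mul_col_mx mul1mx mul0mx add_col_mx add0r.
move=> /eq_col_mx [-> /eq_col_mx [-> ->]].
by rewrite -[(- H *: 1) *m Yz]scalemxAl mul1mx !mul_scalar_mx !scaleNr.
Qed.

Let drE j : [/\ dmx D (r j) Xi = - H *: row j Yb, dmx D (r j) Yz = lam *: row j Yb
  & dmx D (r j) Yb = col j G *m (Xi + lam *: Yz) + gam j *m Yb].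
Proof.
have := dE (r j); rewrite {1}EE /dmx !map_col_mx -!/(dmx D (r j) _) GamR.
rewrite diff_tensor_base_direction base_cubic_eq0 add_block_mx !addr0 add0r EE.
have -> : delta_mx 0 (r j) = row_mx 0 (delta_mx 0 j) :> 'rV[A]_(1 + m).
  by rewrite /r delta_mx_rshift.
have -> : col (r j) h = col_mx 0 (col j G) :> 'cV[A]_(1 + m).
  apply/matrixP => i k; rewrite [LHS]mxE /h /r; case: (split_ordP i) => l ->.
    by rewrite block_mxEur col_mxEu !mxE.
  by rewrite block_mxEdr col_mxEd !mxE.
rewrite mul_block_col mul0mx add0r scale_row_mx scaler0 mul_row_col mul0mx add0r.
rewrite mul_block_col mul0mx add0r mul_col_mx mul0mx add_col_mx add0r.
move=> /eq_col_mx [-> /eq_col_mx [-> ->]]; rewrite add0r.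
by rewrite -!scalemxAl row_delta_mul mulmxDr -scalemxAr addrA.
Qed.

Let nu : n \is a GRing.unit. Proof. exact: nat_unit. Qed.
Let lamu : lam \is a GRing.unit.
Proof. by have [x x0 ->] := diff_coef_const; exact: cst_unit. Qed.
Let dlam d : D d lam = 0.
Proof. by have [x _ ->] := diff_coef_const; exact: D_cst. Qed.
Let dn d : D d n = 0. Proof. exact: Dnat. Qed.

(** Since [- H = n lam^2] is a nonzero constant and the normal has derivative [- H] times that of
    the position, this vector differs from the position by a constant, the centre of the
    hypersphere. *)
Definition centered_position : 'rV[A]_(1 + (1 + m)) := (n * lam ^+ 2)^-1 *: Xi.
Let Y := centered_position.

Let XiE : Xi = (n * lam ^+ 2) *: Y.
Proof. by rewrite scalerA mulrV ?scale1r // unitrM nu unitrX. Qed.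

Lemma d_centered_position d : dmx D d Y = row d (dsubmx E).
Proof.
have S : (n * lam ^+ 2) *: dmx D d Y = (n * lam ^+ 2) *: row d (dsubmx E).
  rewrite -[LHS]addr0 -{1}(scale0r Y) addrC.
  have {1}-> : 0 = D d (n * lam ^+ 2) by rewrite DM dn mul0r add0r expr2 DM dlam mul0r mulr0 addr0 mulr0.
  rewrite -dmxZ // -XiE.
  have -> : n * lam ^+ 2 = - H by rewrite mean_curvature_diff_coef opprK.
  case: (split_ordP d) => i ->.
    rewrite [i]ord1 -/z; have [-> _ _] := dzE; congr (_ *: _).
    by apply/rowP => j; rewrite !mxE; congr (E _ _).
  rewrite -/(r i); have [-> _ _] := drE i; congr (_ *: _).
  by apply/rowP => j; rewrite !mxE; congr (E _ _).
apply/eqP; rewrite -subr_eq0; apply/eqP/(scale_unit_eq0 (a := n * lam ^+ 2)).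
  by rewrite unitrM nu unitrX.
by rewrite scalerBr S subrr.
Qed.

Let dzY : dmx D z Y = Yz.
Proof. by rewrite d_centered_position; apply/rowP => j; rewrite !mxE; congr (E _ _); exact/val_inj. Qed.

Let drY j : dmx D (r j) Y = row j Yb.
Proof. by rewrite d_centered_position; apply/rowP => k; rewrite !mxE; congr (E _ _). Qed.

(** The equation [Y_zz = n lam^2 Y - m lam Y_z] with [n = m + 1] factors with roots [lam] and
    [- n lam]. Hence [P] decays like [e ^- n], [Q] grows like [e], and the rescalings below remove
    the dependence on the line coordinate. Along the second factor [Y_z] has derivative [lam] times
    that of [Y], so [P] is constant there too. *)
Let P := Yz - lam *: Y.
Let Q := Yz + (n * lam) *: Y.
Definition null_vector := e ^+ m.+1 *: P.
Definition hyperboloid_vector := q *: Q.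
Definition hyperboloid_frame := q *: Yb.
Let Ph := null_vector.
Let Qh := hyperboloid_vector.
Let Yh := hyperboloid_frame.

Let De k : D z (e ^+ k) = k%:R * lam * e ^+ k.
Proof.
elim: k => [|k IH]; first by rewrite expr0 D1 // !mul0r.
by rewrite exprS DM IH dze -natr1; ring.
Qed.

Let Dre j k : D (r j) (e ^+ k) = 0.
Proof.
elim: k => [|k IH]; first by rewrite expr0 D1.
by rewrite exprS DM IH dre mul0r mulr0 addr0.
Qed.

Let dq d : D d q = - (q * q * D d e).
Proof.
have : D d (e * q) = 0 by rewrite eq1 D1.
rewrite DM => /(congr1 ( *%R q)); rewrite mulr0 mulrDr [q * (e * _)]mulrA [q * e]mulrC eq1 mul1r.
by move=> /eqP; rewrite addrC addr_eq0 => /eqP ->; ring.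
Qed.

Let dzq : D z q = - lam * q.
Proof.
have -> : - lam * q = - lam * q * (e * q) by rewrite eq1 mulr1.
by rewrite dq dze; ring.
Qed.
Let drq j : D (r j) q = 0. Proof. by rewrite dq dre mulr0 oppr0. Qed.

Let dzPh : dmx D z Ph = 0.
Proof.
have [_ e2 _] := dzE.
rewrite /Ph /null_vector dmxZ // De /P dmxB dmxZ // dlam dzY e2 XiE scale0r add0r.
by rewrite /n -natr1; mxring.
Qed.

Let drPh j : dmx D (r j) Ph = 0.
Proof.
have [_ e2 _] := drE j.
by rewrite /Ph /null_vector dmxZ // Dre /P dmxB dmxZ // dlam drY e2; mxring.
Qed.

Let dzQh : dmx D z Qh = 0.
Proof.
have [_ e2 _] := dzE.
rewrite /Qh /hyperboloid_vector dmxZ // dzq /Q dmxD dmxZ // DM dlam dn dzY e2 XiE.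
by rewrite /n -natr1; mxring.
Qed.

Let drQh j : dmx D (r j) Qh = (m.+2%:R * lam) *: row j Yh.
Proof.
have [_ e2 _] := drE j.
rewrite /Qh /hyperboloid_vector dmxZ // drq /Q dmxD dmxZ // DM dlam dn drY e2.
have -> : row j Yh = q *: row j Yb by apply/rowP => k; rewrite !mxE.
by rewrite /n -!natr1; mxring.
Qed.

Let dzYh : dmx D z Yh = 0.
Proof.
have [_ _ e3] := dzE.
by rewrite /Yh /hyperboloid_frame dmxZ // dzq e3; mxring.
Qed.

Let drYh j : dmx D (r j) Yh = lam *: (col j G *m Qh) + gam j *m Yh.
Proof.
have [_ _ e3] := drE j.
rewrite /Yh /hyperboloid_frame dmxZ // drq scale0r add0r e3 XiE.
rewrite /Qh /hyperboloid_vector /Q -!scalemxAr !scalerDr; congr (_ + _).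
by rewrite !mulmxDr -!scalemxAr; mxring.
Qed.

Definition normal_frame : 'M[A]_(1 + (1 + m)) := col_mx Ph (col_mx Qh Yh).
(** The entry [- (m + 2)] is what keeps [Qh] orthogonal to [Yh]: the derivative of [Qh] is
    [(m + 2) lam] times a row of [Yh], while that of [Yh] contains [lam G] times [Qh]. The entry 1
    is a free normalisation of the constant vector. *)
Definition normal_gram : 'M[A]_(1 + (1 + m)) :=
  block_mx 1 0 0 (block_mx (- m.+2%:R)%:M 0 0 G).

Let s : A := m.+2%:R^-1.
Let sE : m.+2%:R * s = 1. Proof. by rewrite /s mulrV // nat_unit. Qed.
Let eqk k : e ^+ k * q ^+ k = 1. Proof. by rewrite -exprMn eq1 expr1n. Qed.

Let QE : Q = e *: Qh. Proof. by rewrite scalerA eq1 scale1r. Qed.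
Let PE : P = q ^+ m.+1 *: Ph. Proof. by rewrite scalerA mulrC eqk scale1r. Qed.

(** Eliminating [Y_z] gives [Q - P = (n + 1) lam Y], with [n + 1 = m + 2]. *)
Lemma centered_position_frame :
  Y = (s * lam^-1) *: (e *: Qh - q ^+ m.+1 *: Ph).
Proof.
rewrite -QE -PE.
have -> : Q - P = (m.+2%:R * lam) *: Y by rewrite /Q /P /n -!natr1; mxring.
rewrite scalerA (_ : _ * _ = (m.+2%:R * s) * (lam * lam^-1)); last by ring.
by rewrite sE mulrV // mulr1 scale1r.
Qed.

Let YbE : Yb = e *: Yh. Proof. by rewrite scalerA eq1 scale1r. Qed.

(** [M] expresses the original frame through the new one, so [\det normal_frame] divides the unit
    [\det E]. *)
Lemma normal_frame_unit : normal_frame \in unitmx.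
Proof.
pose M : 'M[A]_(1 + (1 + m)) :=
  block_mx (- (n * lam * s * q ^+ m.+1))%:M (row_mx (n * lam * s * e)%:M 0)
   (col_mx ((1 - s) * q ^+ m.+1)%:M 0) (block_mx (s * e)%:M 0 0 e%:M).
have ll : lam * lam^-1 = 1 by rewrite mulrV.
have lin1 k a b (u v : 'rV[A]_(1 + (1 + m))) :
  k *: (a *: u - b *: v) = (- (k * b)) *: v + (k * a) *: u by mxring.
have lin2 l a b (u v : 'rV[A]_(1 + (1 + m))) :
  b *: v + l *: (a *: u - b *: v) = ((1 - l) * b) *: v + (l * a) *: u by mxring.
have EM : E = M *m normal_frame.
  rewrite EE /M /normal_frame mul_block_col mul_row_col mul0mx addr0 mul_col_mx.
  rewrite mul_block_col !mul0mx addr0 add0r add_col_mx add0r !mul_scalar_mx -YbE.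
  congr col_mx; last congr col_mx.
    rewrite XiE centered_position_frame scalerA.
    rewrite (_ : n * lam ^+ 2 * (s * lam^-1) = n * lam * s * (lam * lam^-1)); last by ring.
    by rewrite ll mulr1 lin1.
  transitivity (P + lam *: Y); first by rewrite /P subrK.
  rewrite centered_position_frame scalerA PE.
  rewrite (_ : lam * (s * lam^-1) = s * (lam * lam^-1)); last by ring.
  by rewrite ll mulr1 lin2.
by have := Eunit; rewrite !unitmxE EM det_mulmx unitrM => /andP[].
Qed.

Lemma map_cst_ev p k (M : 'M[A]_(p, k)) : (forall d, dmx D d M = 0) ->
  M = map_mx cst (map_mx (ev t0) M).
Proof.
move=> M0; apply/matrixP => i j; rewrite !mxE.
have [d|x ->] := @D_const (M i j); last by rewrite ev_cst.
by rewrite -dmxE M0 mxE.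
Qed.

Lemma null_vector_const : null_vector = map_mx cst (map_mx (ev t0) null_vector).
Proof.
apply: map_cst_ev => d; case: (split_ordP d) => i ->; last exact: drPh.
by rewrite [i]ord1; exact: dzPh.
Qed.

Lemma normal_gram_const : exists B0 : 'M[F]_(1 + (1 + m)),
  normal_frame *m map_mx cst B0 *m normal_frame^T = normal_gram.
Proof.
have Fu := normal_frame_unit.
have Ns : normal_gram^T = normal_gram.
  by rewrite !tr_block_mx !trmx0 trmx1 tr_scalar_mx Gsym.
pose Bf := invmx normal_frame *m normal_gram *m (invmx normal_frame)^T.
exists (map_mx (ev t0) Bf); rewrite -map_cst_ev.
  rewrite !mulmxA mulmxV // mul1mx -mulmxA trmx_inv mulVmx ?mulmx1 //.
  by rewrite unitmx_tr.
move=> d; case: (split_ordP d) => i -> {d}.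
  rewrite [i]ord1; apply: (dmx_form_eq0 DM Fu Ns (W := 0)).
    rewrite mul0mx /normal_frame /dmx !map_col_mx -!/(dmx D _ _) dzPh dzQh dzYh.
    by rewrite !col_mx0.
  rewrite mul0mx trmx0 addr0 /normal_gram /dmx !map_block_mx -!/(dmx D _ _) !dmx0 dzG.
  by rewrite !dmx_scalar raddfN /= Dnat // D1 // oppr0 raddf0 !block_mx0.
(* [W] is the connection matrix of [Ph], [Qh], [Yh] in direction [i] of the second factor; along the
   line it is zero. *)
apply: (dmx_form_eq0 DM Fu Ns (W := block_mx 0 0 0
   (block_mx 0 ((m.+2%:R * lam) *: delta_mx 0 i) (lam *: col i G) (gam i)))).
  rewrite /normal_frame /dmx !map_col_mx -!/(dmx D _ _) drPh drQh drYh.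
  rewrite mul_block_col !mul0mx !add0r mul_block_col mul0mx add0r.
  by rewrite -!scalemxAl row_delta_mul.
rewrite /normal_gram /dmx !map_block_mx -!/(dmx D _ _) !dmx0 gam_metric.
rewrite !dmx_scalar raddfN /= Dnat // D1 // oppr0 raddf0.
rewrite mulmx_block !(mul0mx, mulmx0, add0r, addr0) mulmx_block !(mul0mx, mulmx0, add0r, addr0).
rewrite !tr_block_mx !trmx0 !add_block_mx !add0r; congr block_mx; congr block_mx.
  rewrite -!scalemxAl !linearZ /= trmx_mul tr_scalar_mx tr_col Gsym.
  by rewrite mul_scalar_mx rowE; mxring.
rewrite -!scalemxAl !linearZ /= trmx_mul trmx_delta Gsym mul_mx_scalar colE.
by mxring.
Qed.

End ProductHypersphere.

(** * The Levi-Civita connection of a Gram matrix *)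

Section LeviCivitaFormula.
Variables (A : comUnitRingType) (m : nat) (D : 'I_m -> {additive A -> A}).
Variables (G : 'M[A]_m).
Hypothesis Gsym : G^T = G.

Definition christoffel_symbol (k i j : 'I_m) : A :=
  2^-1 * \sum_l invmx G k l * (D i (G j l) + D j (G i l) - D l (G i j)).

Definition christoffel_mx (i : 'I_m) : 'M[A]_m := \matrix_(j, k) christoffel_symbol k i j.

Let Gc i j : G i j = G j i. Proof. by rewrite -[in LHS]Gsym mxE. Qed.

Lemma christoffel_mx_swap a b d : christoffel_mx a b d = christoffel_mx b a d.
Proof.
rewrite !mxE /christoffel_symbol; congr (_ * _); apply: eq_bigr => l _.
by rewrite [G a b]Gc [X in _ * (X - _)]addrC.
Qed.

Hypothesis Gunit : G \in unitmx.
Hypothesis two_unit : (2 : A) \is a GRing.unit.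

Lemma christoffel_mx_metric d : dmx D d G = christoffel_mx d *m G + (christoffel_mx d *m G)^T.
Proof.
(* The Koszul formula; the last two terms cancel on symmetrisation in [a] and [b]. *)
have E a b : 2 * (christoffel_mx d *m G) a b = D d (G a b) + D a (G d b) - D b (G d a).
  rewrite mxE mulr_sumr.
  rewrite (eq_bigr (fun k => \sum_l (D d (G a l) + D a (G d l) - D l (G d a)) * (G b k * invmx G k l))).
    rewrite exchange_big (eq_bigr (fun l => (D d (G a l) + D a (G d l) - D l (G d a)) * (b == l)%:R)).
      by rewrite sum_eqr.
    move=> l _; rewrite -mulr_sumr; congr (_ * _).
    by have /matrixP/(_ b l) := mulmxV Gunit; rewrite !mxE.
  move=> k _; rewrite mxE /christoffel_symbol -mulrA mulrA mulrV // mul1r mulr_suml.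
  by apply: eq_bigr => l _; rewrite [G k b]Gc; ring.
apply/matrixP => a b; apply: (mulrI two_unit); rewrite mx_addE mulrDr E [X in _ + 2 * X]mxE E.
by rewrite dmxE [G b a]Gc; ring.
Qed.

Variables (F : comUnitRingType) (ev : {rmorphism A -> F}).

Lemma ev_christoffel_symbol k i j : ev (christoffel_symbol k i j) =
  2^-1 * \sum_l ev (invmx G k l) * (ev (D i (G j l)) + ev (D j (G i l)) - ev (D l (G i j))).
Proof.
rewrite /christoffel_symbol rmorphM rmorphV // rmorph_nat rmorph_sum; congr (_ * _).
by apply: eq_bigr => l _; rewrite rmorphM rmorphB rmorphD.
Qed.

Lemma ev_curv i j k l : ev (curv D christoffel_mx i j k l) =
  ev (D i (christoffel_symbol l j k)) - ev (D j (christoffel_symbol l i k)) +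
  \sum_s (ev (christoffel_symbol l i s) * ev (christoffel_symbol s j k) -
          ev (christoffel_symbol l j s) * ev (christoffel_symbol s i k)).
Proof.
rewrite /curv !(mx_addE, mx_oppE) !dmxE !mxE rmorphD !rmorphB !rmorph_sum -sumrB.
congr (_ + _); apply: eq_bigr => s _; rewrite !mxE !rmorphM.
by rewrite mulrC [X in _ - X]mulrC.
Qed.

Lemma ev_invmx : map_mx ev (invmx G) = invmx (map_mx ev G).
Proof.
have e : map_mx ev (invmx G) *m map_mx ev G = 1%:M.
  by rewrite -map_mxM mulVmx // map_mx1.
by have [_ u] := mulmx1_unit e; rewrite -[LHS](mulmxK u) e mul1mx.
Qed.

End LeviCivitaFormula.

Lemma ev_constant_curvature (A : comUnitRingType) (m : nat) (D : 'I_m -> {additive A -> A})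
    (G : 'M[A]_m) (F : realFieldType) (ev : {rmorphism A -> F}) (c : F) (gam : 'I_m -> 'M[A]_m) :
  (forall d a b, D d (a * b) = D d a * b + a * D d b) ->
  (forall d e a, D d (D e a) = D e (D d a)) ->
  G^T = G -> G \in unitmx ->
  (forall a b d, gam a b d = gam b a d) ->
  (forall d, dmx D d G = gam d *m G + (gam d *m G)^T) -> c != 0 ->
  (forall v w : 'rV[F]_m, row_free (col_mx v w) ->
     (w *m (\sum_i \sum_j (v 0 i * w 0 j) *: map_mx ev (curv D gam i j)) *m map_mx ev G *m v^T) 0 0 /
     ((v *m map_mx ev G *m v^T) 0 0 * (w *m map_mx ev G *m w^T) 0 0
      - (v *m map_mx ev G *m w^T) 0 0 ^+ 2) = c) ->
  forall i j, map_mx ev (curv D gam i j) = c *: map_mx ev (wedge G i j).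
Proof.
move=> DM DC Gs Gu gsw gmet c0 sec i j.
have -> : map_mx ev (wedge G i j) = wedge (map_mx ev G) i j.
  by rewrite /wedge map_mxM map_mxB !map_delta_mx.
apply: (@constant_curvature _ _ _ (fun i j => map_mx ev (curv D gam i j))) => //.
- by move: Gu; rewrite !unitmxE det_map_mx; exact: rmorph_unit.
- by rewrite -map_mx_tr Gs.
- by move=> a b; rewrite curvN map_mxN.
- move=> a b; rewrite -map_mxM -map_mx_tr (curv_anti DM DC Gs gmet).
  by rewrite map_mxN.
- have mE (X : 'M[A]_m) k l : map_mx ev X k l = ev (X k l) by rewrite mxE.
  by move=> a b d e; rewrite !mE -!rmorphD curv_bianchi // rmorph0.
Qed.

Lemma map_curv (A B : comUnitRingType) (f : {rmorphism A -> B}) (n : nat)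
    (D : 'I_n -> {additive A -> A}) (D' : 'I_n -> {additive B -> B}) (gam : 'I_n -> 'M[A]_n) i j :
  (forall k a, D' k (f a) = f (D k a)) ->
  curv D' (fun k => map_mx f (gam k)) i j = map_mx f (curv D gam i j).
Proof.
move=> fD; have dfD k (M : 'M[_]_n) : dmx D' k (map_mx f M) = map_mx f (dmx D k M).
  by apply/matrixP => a b; rewrite !mxE fD.
by rewrite /curv map_mxD !map_mxB !map_mxM -!dfD.
Qed.

Lemma map_mx_swap (A B : Type) (f : A -> B) (n : nat) (gam : 'I_n -> 'M[A]_n) :
  (forall a b d, gam a b d = gam b a d) ->
  forall a b d, map_mx f (gam a) b d = map_mx f (gam b) a d.
Proof. by move=> gs a b d; rewrite mxE gs [RHS]mxE. Qed.

Lemma mx_subE (V : zmodType) (p q : nat) (A B : 'M[V]_(p, q)) i j :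
  (A - B) i j = A i j - B i j.
Proof. by rewrite mx_addE mx_oppE. Qed.

Lemma map_frame_gram (A B : comUnitRingType) (f : {rmorphism A -> B}) (s : B -> A) (k m : nat)
    (p q : 'rV[A]_(1 + (1 + m))) (Y : 'M[A]_(m, 1 + (1 + m))) (C : 'M[B]_(1 + (1 + m))) (G : 'M[A]_m) :
  cancel s f ->
  col_mx p (col_mx q Y) *m map_mx s C *m (col_mx p (col_mx q Y))^T =
    block_mx 1 0 0 (block_mx (- k%:R)%:M 0 0 G) ->
  let E := col_mx (map_mx f p) (col_mx (map_mx f q) (map_mx f Y)) in
  E *m C *m E^T = block_mx 1 0 0 (block_mx (- k%:R)%:M 0 0 (map_mx f G)).
Proof.
move=> sK /(congr1 (map_mx f)); rewrite !map_mxM map_mx_tr !map_block_mx !map_col_mx.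
rewrite !map_mx0 map_mx1 map_scalar_mx rmorphN rmorph_nat.
by have -> // : map_mx f (map_mx s C) = C; apply/matrixP => i j; rewrite !mxE sK.
Qed.

Lemma map_mx_comb (A B : comUnitRingType) (f : {rmorphism A -> B}) (n p q : nat)
    (k a b : A) (u v : 'M[A]_(p, q)) :
  map_mx f (k *: (a *: u - b ^+ n *: v)) =
  f k *: (f a *: map_mx f u - f b ^+ n *: map_mx f v).
Proof. by rewrite map_mxZ map_mxB !map_mxZ rmorphXn. Qed.

(** * Affine coordinates of the Calabi composition *)

Lemma map_null_vector (A B : comUnitRingType) (f : {rmorphism A -> B}) (m : nat)
    (E : 'M[A]_(1 + (1 + m))) K e : map_mx f (null_vector E K e) = f e ^+ m.+1 *:
  (map_mx f (usubmx (dsubmx E)) - f (diff_coef K) *: map_mx f (centered_position E K)).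
Proof. by rewrite map_mxZ rmorphXn map_mxB map_mxZ. Qed.

Lemma map_centered_position (A B : comUnitRingType) (f : {rmorphism A -> B}) (m : nat)
    (E : 'M[A]_(1 + (1 + m))) K : m.+1%:R * diff_coef K ^+ 2 \is a GRing.unit ->
  map_mx f (usubmx E) =
    f (m.+1%:R * diff_coef K ^+ 2) *: map_mx f (centered_position E K).
Proof. by move=> u; rewrite -map_mxZ scalerA mulrV // scale1r. Qed.

Section CalabiCoordinates.
Variables (F : rcfType) (m : nat) (T : Type) (t0 : T).
Variables (p : 'rV[F]_(1 + (1 + m))) (B : 'M[F]_(1 + (1 + m))).
Variables (Q : T -> 'rV[F]_(1 + (1 + m))) (Y : T -> 'M[F]_(m, 1 + (1 + m))).
Variables (G : T -> 'M[F]_m) (P : 'M[F]_m).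
Hypothesis PG : P *m G t0 *m P^T = 1%:M.
Hypothesis gram : forall t, let E := col_mx p (col_mx (Q t) (Y t)) in
  E *m B *m E^T = block_mx 1 0 0 (block_mx (- m.+2%:R)%:M 0 0 (G t)).

Let eta : 'M[F]_(1 + (1 + m)) := block_mx 1 0 0 (block_mx (- 1)%:M 0 0 1%:M).

Let sq : F := Num.sqrt m.+2%:R.
Let sqE : sq ^+ 2 = m.+2%:R. Proof. by rewrite sqr_sqrtr ?ler0n. Qed.
Let sq0 : sq != 0.
Proof. by rewrite gt_eqF // sqrtr_gt0 ltr0n. Qed.

(** The frame at the base point made orthonormal for [B], whose signature is read off [eta]; its
    inverse [W] is the change of coordinates. *)
Let F0 := col_mx p (col_mx (sq^-1 *: Q t0) (P *m Y t0)).

Let F0B : F0 *m B *m F0^T = eta.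
Proof.
pose T0 : 'M[F]_(1 + (1 + m)) := block_mx 1 0 0 (block_mx sq^-1%:M 0 0 P).
have FE : F0 = T0 *m col_mx p (col_mx (Q t0) (Y t0)).
  by rewrite /F0 /T0 !mul_block_col !mul0mx !addr0 !add0r mul1mx mul_scalar_mx.
set E0 := col_mx p _ in FE.
rewrite FE trmx_mul; transitivity (T0 *m (E0 *m B *m E0^T) *m T0^T).
  by rewrite !mulmxA.
rewrite (gram t0).
rewrite /T0 !tr_block_mx !trmx0 trmx1 tr_scalar_mx !mulmx_block.
rewrite !(mulmx0, mul0mx, mulmx1, mul1mx, addr0, add0r) mulmx_block.
rewrite !(mulmx0, mul0mx, mulmx1, mul1mx, addr0, add0r) PG /eta.
rewrite -!scalar_mxM; congr (block_mx _ _ _ (block_mx _%:M _ _ _)).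
by rewrite -sqE; field.
Qed.

Let eta2 : eta *m eta = 1%:M.
Proof.
rewrite /eta !mulmx_block !(mulmx0, mul0mx, mulmx1, addr0, add0r) -scalar_mxM mulrNN mulr1.
by rewrite -!scalar_mx_block.
Qed.

Let F0u : F0 \in unitmx.
Proof.
have : F0 *m (B *m F0^T *m eta) = 1%:M by rewrite !mulmxA F0B eta2.
by case/mulmx1_unit.
Qed.

Let W := invmx F0.

Let BE : B = W *m eta *m W^T.
Proof.
rewrite -F0B /W !mulmxA mulVmx // mul1mx -mulmxA trmx_inv mulmxV ?mulmx1 //.
by rewrite unitmx_tr.
Qed.

Let pW : p *m W = row_mx 1 0.
Proof.
have := mulmxV F0u; rewrite -/W /F0 mul_col_mx [RHS](scalar_mx_block 1 (1 + m) 1).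
by move=> /eq_col_mx [].
Qed.

Let form_eta (u v : 'rV[F]_(1 + (1 + m))) : u *m B *m v^T = (u *m W) *m eta *m (v *m W)^T.
Proof. by rewrite BE trmx_mul !mulmxA. Qed.

Let a t : 'M[F]_1 := lsubmx (Q t *m W).
Let b t : 'M[F]_1 := lsubmx (rsubmx (Q t *m W)).
Let v t : 'rV[F]_m := rsubmx (rsubmx (Q t *m W)).
Let QW t : Q t *m W = row_mx (a t) (row_mx (b t) (v t)). Proof. by rewrite !hsubmxK. Qed.

Let gramE t : Q t *m B *m p^T = 0 /\ Q t *m B *m (Q t)^T = (- m.+2%:R)%:M.
Proof.
have := gram t; rewrite /= !mul_col_mx tr_col_mx tr_col_mx !mul_mx_row.
rewrite {1}/block_mx => /eq_col_mx [_].
rewrite -block_mxEv block_mxEh -[in RHS](@col_mx0 _ 1 m 1) => /eq_row_mx [/eq_col_mx [e1 _]].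
by rewrite [in RHS]block_mxEv => /eq_col_mx [/eq_row_mx [e2 _] _].
Qed.

Let a0 t : a t = 0.
Proof.
have [<- _] := gramE t; rewrite form_eta pW QW tr_row_mx trmx1 trmx0 /eta.
by rewrite mul_row_block mul_row_col !(mulmx0, mulmx1, addr0).
Qed.

Let b2 t : (b t) 0 0 ^+ 2 - (v t *m (v t)^T) 0 0 = m.+2%:R.
Proof.
have [_ ] := gramE t; rewrite form_eta QW a0 /eta.
rewrite mul_row_block !(mulmx0, mul0mx, addr0, add0r) mul_row_block.
rewrite !(mulmx0, mulmx1, addr0, add0r) tr_row_mx mul_row_col mul0mx add0r.
rewrite tr_row_mx mul_row_col mul_mx_scalar -scalemxAl => /matrixP/(_ 0 0).
rewrite mx_addE mx_scaleE [(_ *m (b t)^T) _ _]mxE big_ord1 [((b t)^T) _ _]mxE [RHS]mxE eqxx mulr1n.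
by move=> /(congr1 -%R); rewrite opprK => <-; ring.
Qed.

Variables (k : F) (e q : T -> F).
Hypothesis k0 : k != 0.
Hypothesis eq1 : forall t, e t * q t = 1.

Let y t := k *: (e t *: Q t - q t ^+ m.+1 *: p).

(** The constant value of the Calabi expression before normalisation; dividing the first coordinate
    by its square root makes it 1. *)
Let rho : F := k ^+ 2 * (k ^+ 2 * m.+2%:R) ^+ m.+1.
Let rho_gt0 : 0 < rho.
Proof.
have k2 : 0 < k ^+ 2 by rewrite exprn_even_gt0.
by rewrite /rho mulr_gt0 // exprn_gt0 // mulr_gt0 // ltr0n.
Qed.
Let sr : F := Num.sqrt rho.
Let srE : sr ^+ 2 = rho. Proof. by rewrite sqr_sqrtr // ltW. Qed.
Let sr0 : sr != 0. Proof. by rewrite gt_eqF // sqrtr_gt0. Qed.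

(* The coordinate singled out by the negative direction of the form becomes
   the last one. *)
Let sig (i : 'I_m.+2) : 'I_m.+2 :=
  if i == ord0 then ord0 else if i == ord_max then lift ord0 ord0
  else inord i.+1.

Let sig_inj : injective sig.
Proof.
have v1 (i : 'I_m.+2) : i != ord0 -> i != ord_max -> (sig i = i.+1 :> nat) /\ (0 < i < m.+1)%N.
  move=> i0 im; have lt : (i < m.+1)%N.
    by rewrite ltn_neqAle -ltnS ltn_ord andbT; apply: contra im => /eqP im; apply/eqP/val_inj.
  by rewrite lt lt0n /sig (negbTE i0) (negbTE im) inordK ?ltnS //; split=> //; rewrite andbT.
have v0 : sig ord0 = 0%N :> nat by [].
have vm : sig ord_max = 1%N :> nat by rewrite /sig eqxx.
move=> i j /(congr1 val) /=; case: (eqVneq i ord0) => [->|i0].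
  case: (eqVneq j ord0) => [->//|j0]; case: (eqVneq j ord_max) => [->|jm].
    by rewrite v0 vm.
  by have [-> _] := v1 j j0 jm; rewrite v0.
case: (eqVneq i ord_max) => [->|im].
  case: (eqVneq j ord0) => [->|j0]; first by rewrite v0 vm.
  case: (eqVneq j ord_max) => [->//|jm].
  by have [-> /andP[j1 _]] := v1 j j0 jm; rewrite vm => -[] jj; rewrite -jj in j1.
have [-> /andP[i1 _]] := v1 i i0 im.
case: (eqVneq j ord0) => [->|j0]; first by rewrite v0.
case: (eqVneq j ord_max) => [->|jm].
  by rewrite vm => -[] jj; rewrite jj in i1.
by have [-> _] := v1 j j0 jm => -[] jj; exact/val_inj.
Qed.

Let S : 'M[F]_(1 + (1 + m)) := block_mx sr^-1%:M 0 0 1%:M.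

(** In the coordinates of [F0], [p] is the first basis vector and [Q t] lies on a hyperboloid in the
    span of the others. So [y t] has first coordinate [- k q^(m+1)], the Lorentzian square of the
    rest is [k^2 (m + 2) e^2], and the powers of [e] and [q] cancel in the product. The clause on
    [p] serves the transversality of the first axis. *)
Lemma calabi_coordinates : exists2 M : 'M[F]_m.+2, M \in unitmx &
  (exists2 s, s != 0 & delta_mx 0 ord0 *m invmx M = s *: p) /\
  forall t, (y t *m M) 0 ord0 ^+ 2 *
    ((y t *m M) 0 ord_max ^+ 2 - \sum_(i < m.+2 | (0 < i < m.+1)%N) (y t *m M) 0 i ^+ 2) ^+ m.+1 = 1.
Proof.
have Su : S \in unitmx.
  by rewrite unitmxE /S det_ublock det1 mulr1 det_scalar expr1 unitfE invr_eq0.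
pose M := col_perm (perm sig_inj) (W *m S).
have Mu : M \in unitmx.
  by rewrite /M col_permE !unitmx_mul unitmx_perm Su unitmx_inv F0u.
have ME (u : 'rV[F]_m.+2) j : (u *m M) 0 j = (u *m W *m S) 0 (sig j).
  rewrite -[u *m W *m S]mulmxA /M !mxE; apply: eq_bigr => i _.
  by rewrite [col_perm _ _ _ _]mxE permE.
exists M => //; split.
  exists sr; first exact: sr0.
  have pM : p *m M = sr^-1 *: delta_mx 0 ord0.
    apply/rowP => j; rewrite ME pW /S mul_row_block !(mulmx0, mul0mx, addr0) mul_mx_scalar.
    rewrite scalemx1 mx_scaleE [delta_mx _ _ _ _]mxE eqxx /=.
    case: (eqVneq j ord0) => [->|j0].
      have -> : sig ord0 = lshift (1 + m) (ord0 : 'I_1) by apply: val_inj.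
      by rewrite row_mxEl mxE eqxx mulr1n mulr1.
    rewrite mulr0; have : sig j != ord0.
      by apply: contra j0 => /eqP sj; apply/eqP/sig_inj; rewrite sj.
    case: (split_ordP (sig j : 'I_(1 + (1 + m)))) => l ->; last by rewrite row_mxEr mxE.
    by rewrite ord1 => /eqP []; exact: val_inj.
  have -> : delta_mx 0 ord0 = sr *: (p *m M) by rewrite pM scalerA mulfV // scale1r.
  by rewrite -scalemxAl mulmxK.
move=> t.
have yE : y t *m W *m S = row_mx (- (k * q t ^+ m.+1 * sr^-1))%:M
    (row_mx ((k * e t) *: b t) ((k * e t) *: v t)).
  rewrite /y -scalemxAl mulmxBl -!scalemxAl QW a0 pW !scale_row_mx opp_row_mx add_row_mx.
  rewrite !scaler0 oppr0 addr0 sub0r.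
  rewrite /S mul_row_block !(mulmx0, mul0mx, mulmx1, addr0, add0r) mul_mx_scalar.
  rewrite !scale_row_mx.
  rewrite !scalerA; congr row_mx.
  apply/matrixP => i j; rewrite !ord1 mx_scaleE mx_oppE mx_scaleE !mxE eqxx.
  by rewrite !mulr1n; ring.
rewrite !ME yE.
have -> : sig ord0 = lshift (1 + m) (ord0 : 'I_1) by apply: val_inj.
have -> : sig ord_max = rshift 1 (lshift m (ord0 : 'I_1)) by apply: val_inj; rewrite /sig eqxx.
rewrite row_mxEl row_mxEr row_mxEl mxE eqxx mulr1n mx_scaleE.
have -> : \sum_(i < m.+2 | (0 < i < m.+1)%N) (y t *m M) 0 i ^+ 2 =
   (k * e t) ^+ 2 * (v t *m (v t)^T) 0 0.
  rewrite big_mkcond big_ord_recl big_ord_recr /= ltnn add0r addr0 mxE mulr_sumr.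
  apply: eq_bigr => i _; rewrite /bump /= add1n ltnS ltn_ord ME yE.
  have -> : sig (lift ord0 (widen_ord (leqnSn m) i)) = rshift 1 (rshift 1 i).
    apply: val_inj; rewrite /sig /= /bump /= add1n.
    rewrite -[lift _ _ == ord_max]/(_ == _ :> nat) /= /bump /= add1n eqSS ltn_eqF //=.
    by rewrite inordK // !ltnS.
  by rewrite !row_mxEr mxE [((v t)^T) _ _]mxE; ring.
have -> : (k * e t * b t 0 0) ^+ 2 - (k * e t) ^+ 2 * (v t *m (v t)^T) 0 0 =
    (k ^+ 2 * m.+2%:R) * e t ^+ 2 by rewrite -(b2 t); ring.
have -> : (- (k * q t ^+ m.+1 * sr^-1)) ^+ 2 = k ^+ 2 * (q t ^+ 2) ^+ m.+1 * (sr ^+ 2)^-1.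
  by rewrite (exprAC (q t) 2); field.
rewrite [(_ * e t ^+ 2) ^+ m.+1]exprMn srE.
have -> : k ^+ 2 * (q t ^+ 2) ^+ m.+1 / rho * ((k ^+ 2 * m.+2%:R) ^+ m.+1 * (e t ^+ 2) ^+ m.+1) =
   (e t * q t) ^+ 2 ^+ m.+1 * (rho / rho).
  rewrite (exprMn 2 (e t)) (exprMn m.+1 (e t ^+ 2)) {2}/rho.
  by move: (rho^-1) => r; ring.
by rewrite eq1 !expr1n mul1r mulfV // gt_eqF.
Qed.

End CalabiCoordinates.

(** * Smooth functions *)

Section CkTheory.
Variables (R : realType) (V : normedModType R).
Implicit Types (U : set V) (k : nat).

Lemma near_eq_differentiable (W : normedModType R) (f g : V -> W) (u : V) :
  {near u, f =1 g} -> differentiable f u -> differentiable g u.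
Proof.
move=> fg df; have [dfc dfo] := (diff_locallyP _ _).1 df.
have dgo : g \o shift u = cst (g u) + 'd f u +o_ 0 id.
  apply/eqaddoP => e e0; move/eqaddoP : dfo => /(_ e e0).
  apply: filter_app; near=> h => /=; rewrite !fctE /= -(nbhs_singleton fg).
  suff -> : f (h + u) = g (h + u) by [].
  near: h; have : \forall y \near u, f y = g y by exact: fg.
  rewrite (near_shift 0) /= => H.
  by apply: filter_app H; near=> h; rewrite /= subr0.
have e : 'd g u = 'd f u :> (V -> W) by exact: diff_unique.
by apply/diff_locallyP; rewrite e.
Unshelve. all: by end_near.
Qed.

Lemma Ck_ext (W : normedModType R) k U (f g : V -> W) : open U ->
  (forall u, U u -> f u = g u) -> Ck k U f -> Ck k U g.
Proof.
move=> Uo; have nr (f' g' : V -> W) : (forall u, U u -> f' u = g' u) ->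
    forall u, U u -> {near u, f' =1 g'}.
  by move=> fg u Uu; near=> x; apply: fg; near: x; exact: open_nbhs_nbhs.
elim: k f g => [|k IH] f g fg /= Cf.
  move=> u Uu; apply: cvg_trans (_ : f @ u --> g u); last by rewrite -fg //; exact: Cf.
  by apply: near_eq_cvg; apply: nr.
split=> [u Uu|v].
  by apply: near_eq_differentiable (Cf.1 u Uu); exact: nr.
apply: IH (Cf.2 v) => u Uu; apply: near_eq_derive; exact: (nr f g fg u Uu).
Unshelve. all: by end_near.
Qed.

Lemma Ck_le (W : normedModType R) k U (f : V -> W) : Ck k.+1 U f -> Ck k U f.
Proof.
elim: k f => [|k IH] f; first by move=> [df _] u Uu; exact/differentiable_continuous/df.
by move=> [df dv]; split=> // v; apply: IH; exact: dv.
Qed.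

Lemma Ck_cst (W : normedModType R) k U (a : W) : open U -> Ck k U (cst a : V -> W).
Proof.
move=> Uo; elim: k a => [|k IH] a; first by move=> u _; exact: cst_continuous.
split=> [u _|v]; first exact: differentiable_cst.
by apply: (Ck_ext Uo) (IH 0) => u _; rewrite derive_cst.
Qed.

Lemma CkD (W : normedModType R) k U (f g : V -> W) : open U ->
  Ck k U f -> Ck k U g -> Ck k U (f + g).
Proof.
move=> Uo; elim: k f g => [|k IH] f g Cf Cg.
  by move=> u Uu; apply: continuousD; [exact: Cf | exact: Cg].
split=> [u Uu|v]; first by apply: differentiableD; [exact: Cf.1 | exact: Cg.1].
apply: (Ck_ext Uo) (IH _ _ (Cf.2 v) (Cg.2 v)) => u Uu.
by rewrite deriveD //; apply: diff_derivable; [exact: Cf.1 | exact: Cg.1].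
Qed.

Lemma CkN (W : normedModType R) k U (f : V -> W) : open U -> Ck k U f -> Ck k U (- f).
Proof.
move=> Uo; elim: k f => [|k IH] f Cf; first by move=> u Uu; apply: continuousN; exact: Cf.
split=> [u Uu|v]; first by apply: differentiableN; exact: Cf.1.
apply: (Ck_ext Uo) (IH _ (Cf.2 v)) => u Uu.
by rewrite deriveN //; apply: diff_derivable; exact: Cf.1.
Qed.

Lemma CkM k U (f g : V -> R^o) : open U ->
  Ck k U f -> Ck k U g -> Ck k U (fun u => f u * g u : R^o).
Proof.
move=> Uo; elim: k f g => [|k IH] f g Cf Cg.
  by move=> u Uu; apply: continuousM; [exact: Cf | exact: Cg].
split=> [u Uu|v]; first by apply: differentiableM; [exact: Cf.1 | exact: Cg.1].
have := CkD Uo (IH _ _ (Ck_le Cf) (Cg.2 v)) (IH _ _ (Ck_le Cg) (Cf.2 v)).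
apply: (Ck_ext Uo) => u Uu.
rewrite (deriveM (f := f) (g := g)) //; apply: diff_derivable; [exact: Cf.1 | exact: Cg.1].
Qed.

Lemma CkV k U (f : V -> R^o) : open U -> (forall u, U u -> f u != 0) ->
  Ck k U f -> Ck k U (fun u => (f u)^-1 : R^o).
Proof.
move=> Uo f0; elim: k => [|k IH] Cf.
  by move=> u Uu; apply: continuousV; [exact: f0 | exact: Cf].
split=> [u Uu|v]; first by apply: differentiableV; [exact: Cf.1 | exact: f0].
have Ci := IH (Ck_le Cf).
have := CkN Uo (CkM Uo (CkM Uo Ci Ci) (Cf.2 v)).
apply: (Ck_ext Uo) => u Uu.
rewrite (deriveV (f := f)) ?f0 //; last by apply: diff_derivable; exact: Cf.1.
by rewrite /= !fctE expr2 invfM scaleNr.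
Qed.

Lemma Ck_entry p q k U (F : V -> 'M[R]_(p, q)) i j : open U ->
  Ck k U F -> Ck k U (fun u => F u i j : R^o).
Proof.
move=> Uo; elim: k F => [|k IH] F CF.
  move=> u Uu; apply: (@continuous_comp _ _ _ F (fun M : 'M[R]_(p, q) => M i j : R^o)).
    exact: CF.
  exact: coord_continuous.
split=> [u Uu|v].
  apply: (@differentiable_comp _ _ _ _ F (fun M : 'M[R]_(p, q) => M i j : R^o)).
    exact: CF.1.
  exact: differentiable_coord.
apply: (Ck_ext Uo) (IH _ (CF.2 v)) => u Uu.
by rewrite derive_mx ?mxE //; apply: diff_derivable; exact: CF.1.
Qed.

Lemma derive_line (W : normedModType R) (f : V -> W) (p v : V) (s : R) :
  differentiable f (p + s *: v) ->
  is_derive s (1 : R) (fun t : R => f (p + t *: v)) ('D_v f (p + s *: v)).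
Proof.
move=> df; have E : (fun h : R => h^-1 *: (((fun t : R => f (p + t *: v)) \o shift s) (h *: (1 : R)) - f (p + s *: v)))
   = (fun h : R => h^-1 *: ((f \o shift (p + s *: v)) (h *: v) - f (p + s *: v))).
  apply/funext => h /=; congr (_ *: (f _ - _)).
  by rewrite scalerDl -[h *: (1 : R)]/(h * 1) mulr1 addrCA.
apply: DeriveDef; last by rewrite /derive E.
by rewrite /derivable E; exact: (diff_derivable df).
Qed.

Lemma smooth_ext (W : normedModType R) U (f g : V -> W) : open U ->
  (forall u, U u -> f u = g u) -> smooth_on U f -> smooth_on U g.
Proof. by move=> Uo fg Cf k; apply: (Ck_ext Uo fg). Qed.

Lemma smooth_derive (W : normedModType R) U (f : V -> W) v :
  smooth_on U f -> smooth_on U (fun u => 'D_v f u).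
Proof. by move=> Cf k; have [_] := Cf k.+1; exact. Qed.

Lemma smooth_differentiable (W : normedModType R) U (f : V -> W) u :
  smooth_on U f -> U u -> differentiable f u.
Proof. by move=> Cf Uu; have [] := Cf 1%N; move=> + _; exact. Qed.

Lemma smooth_subset (W : normedModType R) U U' (f : V -> W) : U' `<=` U ->
  smooth_on U f -> smooth_on U' f.
Proof.
move=> UU' Cf k; have := Cf k; elim: k f {Cf} => [|k IH] f /=.
  by move=> Cf u /UU'; exact: Cf.
by move=> [df dv]; split=> [u /UU'|v]; [exact: df | exact/IH/dv].
Qed.

(* The second difference of [f] equals [h ^ 2] times the value of either mixed
   derivative at some point of the parallelogram. *)
Lemma second_difference (f : V -> R^o) (p v w : V) (h : R) : 0 < h ->
  (forall s t, 0 <= s <= h -> 0 <= t <= h -> differentiable f (p + s *: v + t *: w)) ->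
  (forall s t, 0 <= s <= h -> 0 <= t <= h ->
     differentiable (fun u => 'D_v f u : R^o) (p + s *: v + t *: w)) ->
  exists s t, [/\ 0 <= s <= h, 0 <= t <= h &
    f (p + h *: v + h *: w) - f (p + h *: v) - f (p + h *: w) + f p =
    h ^+ 2 * 'D_w (fun u => 'D_v f u : R^o) (p + s *: v + t *: w)].
Proof.
move=> h0 df ddf.
have h00 : (0 : R) <= 0 <= h by rewrite lexx ltW.
have hh : 0 <= h <= h by rewrite lexx ltW.
pose g := (fun s : R => f (p + h *: w + s *: v)) - (fun s : R => f (p + s *: v)).
have gd s : 0 <= s <= h -> is_derive s (1 : R) (g : R -> R^o)
    ('D_v f (p + h *: w + s *: v) - 'D_v f (p + s *: v)).
  move=> sh; apply: is_deriveB; apply: derive_line.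
    by rewrite addrAC; exact: df.
  by have := df s 0 sh h00; rewrite scale0r addr0.
have inn (a : R) : a \in `]0, h[%R -> 0 <= a <= h.
  by rewrite in_itv /= => /andP[/ltW -> /ltW ->].
have [|s sh gE] := @MVT R g (fun s => 'D_v f (p + h *: w + s *: v) - 'D_v f (p + s *: v)) 0 h h0 (fun s sI => gd s (inn s sI)).
  apply: derivable_within_continuous => s; rewrite in_itv /= => sh.
  by have [] := gd s sh.
have {}sh := inn s sh.
pose q := p + s *: v.
have [|t th tE] := @MVT R (fun t : R => 'D_v f (q + t *: w) : R^o)
    (fun t : R => 'D_w (fun u => 'D_v f u : R^o) (q + t *: w)) 0 h h0
    (fun t tI => derive_line (ddf s t sh (inn t tI))).
  apply: derivable_within_continuous => t; rewrite in_itv /= => th.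
  by have [] := derive_line (ddf s t sh th).
exists s, t; split=> //; first exact: inn.
move: gE tE; rewrite /g !fctE !scale0r !addr0 !subr0 /q => gE tE.
rewrite expr2 -mulrA [h * ('D_w _ _)]mulrC -tE [p + s *: v + _]addrAC mulrC -gE addrAC.
rewrite [p + h *: w + h *: v]addrAC; ring.
Qed.

Lemma near_dist (F : V -> R^o) (u : V) (e : R) : {for u, continuous F} -> 0 < e ->
  \forall y \near u, `|F u - F y| < e.
Proof. by move=> cF e0; move/cvgrPdist_lt : cF; exact. Qed.

Lemma eq_at_limit (F1 F2 : V -> R^o) (u : V) :
  {for u, continuous F1} -> {for u, continuous F2} ->
  (forall d, 0 < d -> exists p1 p2, [/\ `|u - p1| < d, `|u - p2| < d & F1 p1 = F2 p2]) ->
  F1 u = F2 u.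
Proof.
move=> c1 c2 H; apply/eqP; rewrite -subr_eq0 -normr_le0.
apply/ler_addgt0Pr => e e0; rewrite add0r.
have e2 : 0 < e / 2 by rewrite divr_gt0.
have [d1 /= d10 H1] := (nbhs_normP _ _).1 (near_dist c1 e2).
have [d2 /= d20 H2] := (nbhs_normP _ _).1 (near_dist c2 e2).
have [|p1 [p2 [n1 n2 E]]] := H (Num.min d1 d2); first by rewrite lt_min d10.
move: n1 n2; rewrite !lt_min => /andP[/H1 /= n1 _] /andP[_ /H2 /= n2].
rewrite -(subrKA (F1 p1)) (splitr e); apply: le_trans (ler_normD _ _) _.
by rewrite lerD // ltW // E distrC.
Qed.

(** Both mixed derivatives compute the same second difference, at two points of a parallelogram that
    shrinks to [u]; continuity then identifies the limits. *)
Lemma derive_comm U (f : V -> R^o) (v w u : V) : open U -> Ck 2 U f -> U u ->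
  'D_v (fun y => 'D_w f y : R^o) u = 'D_w (fun y => 'D_v f y : R^o) u.
Proof.
move=> Uo Cf Uu; apply: (@eq_at_limit (fun u => 'D_v (fun y => 'D_w f y : R^o) u)
  (fun u => 'D_w (fun y => 'D_v f y : R^o) u)).
- exact: ((Cf.2 w).2 v u Uu).
- exact: ((Cf.2 v).2 w u Uu).
move=> d' d'0; have [d0 /= d00 dU] := (nbhs_normP _ _).1 (open_nbhs_nbhs (conj Uo Uu)).
pose d := Num.min d' d0.
have d_gt0 : 0 < d by rewrite lt_min d'0.
(* Small enough for the parallelogram with sides [h v] and [h w] to stay in the ball of radius [d];
   the summand 1 covers [v = w = 0]. *)
pose h := d / (2 * (`|v| + `|w| + 1)).
have vw0 : 0 < `|v| + `|w| + 1 by rewrite ltr_wpDl // addr_ge0.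
have h0 : 0 < h by rewrite divr_gt0 // mulr_gt0.
have inb s t : 0 <= s <= h -> 0 <= t <= h -> `|u - (u + s *: v + t *: w)| < d.
  move=> /andP[s0 sh] /andP[t0 th]; rewrite -addrA opprD addrA subrr sub0r normrN.
  apply: le_lt_trans (ler_normD _ _) _; rewrite !normrZ !ger0_norm //.
  apply: (@le_lt_trans _ _ (h * (`|v| + `|w| + 1))).
    by rewrite !mulrDr mulr1; apply: ler_wpDr; [exact: ltW | apply: lerD; apply: ler_wpM2r].
  rewrite /h invfM mulrA -mulrA mulVf ?gt_eqF // mulr1 ltr_pdivrMr // ltr_pMr // ltr1n.
  by [].
have inU s t : 0 <= s <= h -> 0 <= t <= h -> U (u + s *: v + t *: w).
  by move=> sh th; apply: dU; have := inb s t sh th; rewrite lt_min => /andP[].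
have inU' s t : 0 <= s <= h -> 0 <= t <= h -> U (u + s *: w + t *: v).
  by move=> sh th; rewrite addrAC; exact: inU.
have [s [t [sh th E1]]] := second_difference h0
  (fun s t sh th => Cf.1 _ (inU s t sh th)) (fun s t sh th => (Cf.2 v).1 _ (inU s t sh th)).
have [s' [t' [sh' th' E2]]] := second_difference h0
  (fun s t sh th => Cf.1 _ (inU' s t sh th)) (fun s t sh th => (Cf.2 w).1 _ (inU' s t sh th)).
exists (u + s' *: w + t' *: v), (u + s *: v + t *: w); split.
- by rewrite addrAC; have := inb t' s' th' sh'; rewrite lt_min => /andP[].
- by have := inb s t sh th; rewrite lt_min => /andP[].
have h2 : h ^+ 2 != 0 by rewrite expf_eq0 /= gt_eqF.
have aux (a b c e k x y : R) : k != 0 ->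
    a - b - c + e = k * x -> a - c - b + e = k * y -> y = x.
  by move=> k0 e1 e2; apply: (mulfI k0); rewrite -e1 -e2; ring.
rewrite [u + h *: w + h *: v]addrAC in E2; exact: (aux _ _ _ _ _ _ _ h2 E1 E2).
Qed.

End CkTheory.

(** * The ring of smooth functions on a convex domain *)

Section SmoothRing.
Variables (R : realType) (n : nat).

(** Convexity is there so that vanishing partial derivatives imply constancy, and the base point
    makes the ring of functions nonzero. *)
Record domain := Domain {
  dset :> 'rV[R]_n -> Prop;
  dpt : 'rV[R]_n;
  dset_open : open (dset : set 'rV[R]_n);
  dset_pt : dset dpt;
  dset_convex : forall u v t, dset u -> dset v -> 0 <= t <= 1 -> dset (u + t *: (v - u)) }.

Variable O : domain.

(* Functions vanish outside [O], so that Leibniz equality is equality on [O]. *)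
Record sfun := SFun {
  sfv : 'rV[R]_n -> R^o;
  sfv_smooth : smooth_on O sfv;
  sfv_out : forall u, ~ O u -> sfv u = 0 }.

Let Oo := @dset_open O.

Lemma sfun_eq (f g : sfun) : (forall u, O u -> sfv f u = sfv g u) -> f = g.
Proof.
case: f g => [f fs fo] [g gs go] /= fg.
have E : f = g.
  by apply/funext => u; have [/fg //|Ou] := pselect (O u); rewrite fo // go.
by subst g; congr SFun; exact: Prop_irrelevance.
Qed.

Definition restrict0 (f : 'rV[R]_n -> R^o) : 'rV[R]_n -> R^o :=
  fun u => if `[< O u >] then f u else 0.

Lemma restrict0_in f u : O u -> restrict0 f u = f u.
Proof. by move=> Ou; rewrite /restrict0; case: asboolP. Qed.

Lemma restrict0_smooth f : smooth_on O f -> smooth_on O (restrict0 f).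
Proof. by apply: smooth_ext => // u Ou; rewrite restrict0_in. Qed.

Lemma restrict0_out f u : ~ O u -> restrict0 f u = 0.
Proof. by move=> Ou; rewrite /restrict0; case: asboolP. Qed.

Definition mksfun f (fs : smooth_on O f) : sfun :=
  SFun (restrict0_smooth fs) (@restrict0_out f).

Lemma mksfunE f (fs : smooth_on O f) u : O u -> sfv (mksfun fs) u = f u.
Proof. by move=> Ou; rewrite /= restrict0_in. Qed.

HB.instance Definition _ := gen_eqMixin sfun.
HB.instance Definition _ := gen_choiceMixin sfun.

Lemma scst_smooth (x : R) : smooth_on O (cst x : 'rV[R]_n -> R^o).
Proof. by move=> k; apply: Ck_cst. Qed.

Lemma sadd_smooth (f g : sfun) : smooth_on O (fun u => sfv f u + sfv g u : R^o).
Proof. by move=> k; apply: CkD => //; exact: sfv_smooth. Qed.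

Lemma sopp_smooth (f : sfun) : smooth_on O (fun u => - sfv f u : R^o).
Proof. by move=> k; apply: CkN => //; exact: sfv_smooth. Qed.

Lemma smul_smooth (f g : sfun) : smooth_on O (fun u => sfv f u * sfv g u : R^o).
Proof. by move=> k; apply: CkM => //; exact: sfv_smooth. Qed.

Definition sconst x := mksfun (scst_smooth x).
Definition sadd f g := mksfun (sadd_smooth f g).
Definition sopp f := mksfun (sopp_smooth f).
Definition smul f g := mksfun (smul_smooth f g).

Let sE := mksfunE.

Lemma saddA : associative sadd.
Proof. by move=> f g h; apply: sfun_eq => u Ou; rewrite !sE // addrA. Qed.
Lemma saddC : commutative sadd.
Proof. by move=> f g; apply: sfun_eq => u Ou; rewrite !sE // addrC. Qed.
Lemma sadd0 : left_id (sconst 0) sadd.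
Proof. by move=> f; apply: sfun_eq => u Ou; rewrite !sE // add0r. Qed.
Lemma saddN : left_inverse (sconst 0) sopp sadd.
Proof. by move=> f; apply: sfun_eq => u Ou; rewrite !sE // addNr. Qed.

HB.instance Definition _ := GRing.isZmodule.Build sfun saddA saddC sadd0 saddN.

Lemma smulA : associative smul.
Proof. by move=> f g h; apply: sfun_eq => u Ou; rewrite !sE // mulrA. Qed.
Lemma smulC : commutative smul.
Proof. by move=> f g; apply: sfun_eq => u Ou; rewrite !sE // mulrC. Qed.
Lemma smul1 : left_id (sconst 1) smul.
Proof. by move=> f; apply: sfun_eq => u Ou; rewrite !sE // mul1r. Qed.
Lemma smulD : left_distributive smul sadd.
Proof. by move=> f g h; apply: sfun_eq => u Ou; rewrite !sE // mulrDl. Qed.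
Lemma sone_neq0 : sconst 1 != sconst 0.
Proof.
apply/eqP => /(congr1 (fun f => sfv f (dpt O))).
have Op := dset_pt O; by rewrite !(sE _ Op) /= => /eqP; rewrite oner_eq0.
Qed.

HB.instance Definition _ :=
  GRing.Zmodule_isComNzRing.Build sfun smulA smulC smul1 smulD sone_neq0.

Definition sunit : {pred sfun} := fun f => `[< forall u, O u -> sfv f u != 0 >].

Lemma sinv_smooth (f : sfun) : smooth_on O (fun u =>
  if f \in sunit then (sfv f u)^-1 else sfv f u : R^o).
Proof.
have [fu|_] := boolP (f \in sunit); last exact: sfv_smooth.
by move=> k; apply: CkV => //; [move/asboolP : fu; exact | exact: sfv_smooth].
Qed.

Definition sinv f := mksfun (sinv_smooth f).

Lemma smulVx : {in sunit, left_inverse (1 : sfun) sinv *%R}.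
Proof.
move=> f fu; apply: sfun_eq => u Ou; rewrite /= !restrict0_in // fu.
by rewrite mulVf //; move/asboolP : fu; exact.
Qed.

Lemma sunitPl (f g : sfun) : g * f = 1 -> sunit f.
Proof.
move=> gf; apply/asboolP => u Ou; apply/eqP => f0.
have /(congr1 (fun f => sfv f u)) := gf.
by rewrite !sE // f0 mulr0 => /esym/eqP; rewrite oner_eq0.
Qed.

Lemma sinv_out : {in [predC sunit], sinv =1 id}.
Proof.
by move=> f; rewrite inE => /negbTE fu; apply: sfun_eq => u Ou; rewrite !sE // fu.
Qed.

HB.instance Definition _ :=
  GRing.ComNzRing_hasMulInverse.Build sfun smulVx sunitPl sinv_out.

Lemma sunitE (f : sfun) : (forall u, O u -> sfv f u != 0) -> f \is a GRing.unit.
Proof. by move=> f0; apply/asboolP. Qed.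

Definition point := {u | O u}.

Definition sev (p : point) (f : sfun) : R := sfv f (sval p).

Lemma sev_zmod p : zmod_morphism (sev p).
Proof. by case: p => u Ou f g; rewrite /sev /= !restrict0_in. Qed.

Lemma sev_monoid p : monoid_morphism (sev p).
Proof. by case: p => u Ou; split=> [|f g]; rewrite /sev /= !restrict0_in. Qed.

HB.instance Definition _ p := GRing.isZmodMorphism.Build sfun R (sev p) (sev_zmod p).
HB.instance Definition _ p := GRing.isMonoidMorphism.Build sfun R (sev p) (sev_monoid p).

Lemma sconst_zmod : zmod_morphism sconst.
Proof. by move=> x y; apply: sfun_eq => u Ou; rewrite /= !restrict0_in. Qed.

Lemma sconst_monoid : monoid_morphism sconst.
Proof.
by split=> // x y; apply: sfun_eq => u Ou; rewrite /= !restrict0_in.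
Qed.

HB.instance Definition _ := GRing.isZmodMorphism.Build R sfun sconst sconst_zmod.
HB.instance Definition _ := GRing.isMonoidMorphism.Build R sfun sconst sconst_monoid.

Lemma sder_smooth (v : 'rV[R]_n) (f : sfun) : smooth_on O (fun u => 'D_v (sfv f) u : R^o).
Proof. exact/smooth_derive/sfv_smooth. Qed.

Definition sder v f := mksfun (sder_smooth v f).

Lemma sderE v f u : O u -> sfv (sder v f) u = 'D_v (sfv f) u.
Proof. by move=> Ou; rewrite sE. Qed.

Let sd (f : sfun) u v : O u -> derivable (sfv f) u v.
Proof. by move=> Ou; apply/diff_derivable/(smooth_differentiable (@sfv_smooth f)). Qed.

Lemma derive_eq_on (f g : 'rV[R]_n -> R^o) v u : O u -> (forall u, O u -> f u = g u) ->
  'D_v f u = 'D_v g u.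
Proof.
move=> Ou fg; apply: near_eq_derive; near=> x; apply: fg; near: x.
exact: (open_nbhs_nbhs (conj Oo Ou)).
Unshelve. all: by end_near.
Qed.

Lemma sder_zmod v : zmod_morphism (sder v).
Proof.
move=> f g; apply: sfun_eq => u Ou; rewrite sderE // !sE //.
rewrite -(deriveB (f := sfv f) (g := sfv g)); [|exact: sd|exact: sd].
by apply: derive_eq_on => // y Oy; rewrite !sE.
Qed.

HB.instance Definition _ v := GRing.isZmodMorphism.Build sfun sfun (sder v) (sder_zmod v).

Lemma sderM v f g : sder v (f * g) = sder v f * g + f * sder v g.
Proof.
apply: sfun_eq => u Ou; rewrite sderE // !sE //.
transitivity ('D_v (sfv f * sfv g) u).
  by apply: derive_eq_on => // y Oy; rewrite sE.
rewrite deriveM; [|exact: sd|exact: sd].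
by rewrite addrC mulrC.
Qed.

Lemma sderC v w f : sder v (sder w f) = sder w (sder v f).
Proof.
have E a b u : O u -> sfv (sder a (sder b f)) u = 'D_a (fun y => 'D_b (sfv f) y : R^o) u.
  move=> Ou; apply: (etrans (sderE a (sder b f) Ou)); apply: derive_eq_on => // y Oy.
  exact: sderE.
apply: sfun_eq => u Ou; apply: (etrans (E v w u Ou)); apply: (etrans _ (esym (E w v u Ou))).
exact: (@derive_comm R _ (O : set _) (sfv f) v w u Oo (@sfv_smooth f 2) Ou).
Qed.

Lemma sder_const v x : sder v (sconst x) = 0.
Proof.
apply: sfun_eq => u Ou; rewrite sderE // [RHS]sE //.
rewrite (derive_eq_on (g := cst x)) //; last by move=> y Oy; rewrite sE.
by rewrite derive_cst.
Qed.

(** The mean value theorem on the segment from the base point, which stays in the domain by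
    convexity. *)
Lemma sder_eq0_const f : (forall i, sder (delta_mx 0 i) f = 0) -> exists x, f = sconst x.
Proof.
move=> df; exists (sfv f (dpt O)); apply: sfun_eq => u Ou; rewrite sE //.
pose p := dpt O; pose g (t : R) : R^o := sfv f (p + t *: (u - p)).
have gd (t : R) : 0 <= t <= 1 -> is_derive t (1 : R) g (0 : R^o).
  move=> t01; have Op : O (p + t *: (u - p)) by apply: dset_convex => //; exact: dset_pt.
  have fd := smooth_differentiable (@sfv_smooth f) Op.
  have := derive_line (f := sfv f) fd.
  suff -> : 'D_(u - p) (sfv f) (p + t *: (u - p)) = 0 by [].
  rewrite deriveE // [X in 'd _ _ X](matrix_sum_delta (u - p)) big_ord1 linear_sum big1 // => i _.
  rewrite linearZ /= -deriveE //.
  have /(congr1 (fun h => sfv h (p + t *: (u - p)))) := df i.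
  by rewrite sderE // sE // => ->; rewrite scaler0.
have inn (t : R) : t \in `]0, 1[%R -> 0 <= t <= 1.
  by rewrite in_itv /= => /andP[/ltW -> /ltW ->].
have [|t _] := @MVT R g (cst 0) 0 1 ltr01 (fun t tI => gd t (inn t tI)).
  apply: derivable_within_continuous => t; rewrite in_itv /= => t01.
  by have [] := gd t t01.
rewrite /g /= scale1r scale0r addr0 mul0r [p + _]addrC subrK => /eqP.
by rewrite subr_eq0 => /eqP.
Qed.

End SmoothRing.

(** * Chain rule and matrix-valued smooth maps *)

Section Composition.
Variables (R : realType).

Lemma Ck_sum (V W : normedModType R) k (U : set V) (I : finType) (F : I -> V -> W) :
  open U -> (forall i, Ck k U (F i)) -> Ck k U (fun u => \sum_i F i u).
Proof.
move=> Uo CF; have -> : (fun u => \sum_i F i u) = \sum_i F i.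
  by apply/funext => u; rewrite fct_sumE.
by elim/big_ind : _ => //; [exact: Ck_cst | move=> f g; exact: CkD].
Qed.

Lemma derive_comp (V : normedModType R) (W : normedModType R) n (psi : V -> 'rV[R]_n) (f : 'rV[R]_n -> W)
    (u v : V) : differentiable psi u -> differentiable f (psi u) ->
  'D_v (f \o psi) u = \sum_i ('D_v psi u) 0 i *: 'D_(delta_mx 0 i) f (psi u).
Proof.
move=> dpsi df; rewrite deriveE; last exact: differentiable_comp.
rewrite diff_comp //=; have -> : 'd psi u v = 'D_v psi u by rewrite deriveE.
move: ('D_v psi u) => w; rewrite {1}(matrix_sum_delta w) big_ord1 linear_sum.
by apply: eq_bigr => i _; rewrite linearZ /= -deriveE.
Qed.

Lemma Ck_comp (V : normedModType R) n k (psi : V -> 'rV[R]_n) (f : 'rV[R]_n -> R^o)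
    (U : set V) (U' : set 'rV[R]_n) : open U -> (forall u, U u -> U' (psi u)) ->
  Ck k U' f -> Ck k U psi -> Ck k U (f \o psi).
Proof.
move=> Uo UU'; elim: k f => [|k IH] f Cf Cp.
  by move=> u Uu; apply: continuous_comp; [exact: Cp | exact/Cf/UU'].
split=> [u Uu|v].
  by apply: differentiable_comp; [exact: Cp.1 | exact/Cf.1/UU'].
have H : Ck k U (fun u => \sum_i ('D_v psi u) 0 i * 'D_(delta_mx 0 i) f (psi u) : R^o).
  apply: Ck_sum => // i; apply: CkM => //.
    by apply: Ck_entry => //; exact: Cp.2.
  by apply: (IH (fun y => 'D_(delta_mx 0 i) f y : R^o)); [exact: Cf.2 | exact: Ck_le].
apply: (Ck_ext Uo) H => u Uu; rewrite (@derive_comp _ _ _ psi f) //; [exact: Cp.1 | exact/Cf.1/UU'].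
Qed.

Lemma differentiable_mx (V : normedModType R) p q (F : V -> 'M[R]_(p, q)) u :
  (forall i j, differentiable (fun y => F y i j : R^o) u) -> differentiable F u.
Proof.
move=> dF; have -> : F = \sum_i \sum_j (fun y => F y i j *: delta_mx i j).
  apply/funext => y; rewrite [LHS]matrix_sum_delta fct_sumE; apply: eq_bigr => i _.
  by rewrite fct_sumE.
elim/big_ind : _ => [|f g|i _]; [exact: differentiable_cst | exact: differentiableD|].
elim/big_ind : _ => [|f g|j _]; [exact: differentiable_cst | exact: differentiableD|].
exact: (differentiableZl _ (dF i j)).
Qed.

Lemma Ck_mx (V : normedModType R) p q k (U : set V) (F : V -> 'M[R]_(p, q)) : open U ->
  (forall i j, Ck k U (fun u => F u i j : R^o)) -> Ck k U F.
Proof.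
move=> Uo; elim: k F => [|k IH] F CF.
  move=> u Uu; have -> : F = \sum_i \sum_j (fun y => F y i j *: delta_mx i j).
    apply/funext => y; rewrite [LHS]matrix_sum_delta fct_sumE; apply: eq_bigr => i _.
    by rewrite fct_sumE.
  elim/big_ind : _ => [|f g|i _]; [exact: cst_continuous | exact: continuousD|].
  elim/big_ind : _ => [|f g|j _]; [exact: cst_continuous | exact: continuousD|].
  by apply: continuousZr_tmp; exact: CF.
have dF u : U u -> differentiable F u.
  by move=> Uu; apply: differentiable_mx => i j; exact: (CF i j).1.
split=> // v; apply: IH => i j; apply: (Ck_ext Uo) ((CF i j).2 v) => u Uu.
by rewrite derive_mx ?mxE //; exact/diff_derivable/dF.
Qed.

Lemma smooth_comp_mx (V : normedModType R) n p q (psi : V -> 'rV[R]_n) (f : 'rV[R]_n -> 'M[R]_(p, q))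
    (U : set V) (U' : set 'rV[R]_n) : open U -> open U' -> (forall u, U u -> U' (psi u)) ->
  smooth_on U' f -> smooth_on U psi -> smooth_on U (f \o psi).
Proof.
move=> Uo Uo' UU' Cf Cp k; apply: Ck_mx => // i j.
by apply: (@Ck_comp _ _ k psi (fun y => f y i j : R^o) U U') => //; exact: Ck_entry.
Qed.

Lemma derive_rsubmx m1 m2 (W : normedModType R) (f : 'rV[R]_m2 -> W) (u v : 'rV[R]_(m1 + m2)) :
  'D_v (fun y => f (rsubmx y)) u = 'D_(rsubmx v) f (rsubmx u).
Proof.
rewrite /derive.
have -> : (fun h : R => h^-1 *: (((fun y => f (rsubmx y)) \o shift u) (h *: v) - f (rsubmx u))) =
    (fun h => h^-1 *: ((f \o shift (rsubmx u)) (h *: rsubmx v) - f (rsubmx u))).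
  by apply/funext => h /=; congr (_ *: (f _ - _)); apply/rowP => i; rewrite !mxE.
by [].
Qed.

Lemma Ck_rsubmx m1 m2 (W : normedModType R) k (U : set 'rV[R]_(m1 + m2)) (U' : set 'rV[R]_m2)
    (f : 'rV[R]_m2 -> W) : (forall u, U u -> U' (rsubmx u)) -> Ck k U' f ->
  Ck k U (fun u => f (rsubmx u)).
Proof.
move=> UU'; elim: k f => [|k IH] f Cf.
  move=> u Uu; apply: (@continuous_comp _ _ _ rsubmx f); last exact/Cf/UU'.
  exact/differentiable_continuous/differentiable_rsubmx.
split=> [u Uu|v].
  apply: (@differentiable_comp _ _ _ _ rsubmx f); last exact/Cf.1/UU'.
  exact: differentiable_rsubmx.
have -> : (fun u => 'D_v (fun u0 => f (rsubmx u0)) u) = (fun u => 'D_(rsubmx v) f (rsubmx u)).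
  by apply/funext => u; rewrite derive_rsubmx.
by apply: (IH (fun y => 'D_(rsubmx v) f y)); exact: Cf.2.
Qed.

Lemma derive_coord n (v u : 'rV[R]_n) (j : 'I_n) :
  'D_v (fun y : 'rV[R]_n => y 0 j : R^o) u = v 0 j.
Proof.
have := @derive_mx R 'rV[R]_n 1 n id u v (@derivable_id _ _ u v); rewrite derive_id.
by move=> /matrixP/(_ 0 j); rewrite mxE => ->.
Qed.

Lemma derive_expR_coord n (x : R) (j : 'I_n) (v u : 'rV[R]_n) :
  differentiable (fun y : 'rV[R]_n => expR (x * y 0 j) : R^o) u /\
  'D_v (fun y : 'rV[R]_n => expR (x * y 0 j) : R^o) u = x * v 0 j * expR (x * u 0 j).
Proof.
pose l := (fun y : 'rV[R]_n => x * y 0 j : R^o).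
have dl : differentiable l u.
  apply: (@differentiableM _ _ (cst x) (fun y : 'rV[R]_n => y 0 j : R^o)).
    exact: differentiable_cst.
  exact: differentiable_coord.
have Dl : 'D_v l u = x * v 0 j.
  rewrite /l (@deriveMl _ _ (fun y : 'rV[R]_n => y 0 j : R^o)) ?derive_coord //.
  by apply/diff_derivable/differentiable_coord.
have de : differentiable (expR : R -> R^o) (l u) by exact/derivable1_diffP.
have df : differentiable ((expR : R -> R^o) \o l) u by exact: differentiable_comp.
split=> //; rewrite -[X in 'D_v X u]/((expR : R -> R^o) \o l) deriveE // diff_comp //=.
have -> : 'd l u v = x * v 0 j by rewrite -deriveE.
by rewrite diff1E //= derive1E derive_val.
Qed.

Lemma smooth_expR n (x : R) (j : 'I_n) (U : set 'rV[R]_n) : open U ->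
  smooth_on U (fun y : 'rV[R]_n => expR (x * y 0 j) : R^o).
Proof.
move=> Uo; elim=> [|k IH].
  by move=> u _; apply: differentiable_continuous; have [] := derive_expR_coord x j 0 u.
split=> [u _|v]; first by have [] := derive_expR_coord x j 0 u.
have H : Ck k U (fun y : 'rV[R]_n => x * v 0 j * expR (x * y 0 j) : R^o).
  by apply: (@CkM _ _ k U (cst (x * v 0 j)) (fun y : 'rV[R]_n => expR (x * y 0 j) : R^o)) => //; exact: Ck_cst.
by apply: (Ck_ext Uo) H => u Uu; have [_ ->] := derive_expR_coord x j v u.
Qed.

End Composition.

(** * Functions of the second factor, viewed on the product *)

Section Pullback.
Variables (R : realType) (m1 m2 : nat) (O : domain R (m1 + m2)) (O' : domain R m2).
Hypothesis OO' : forall w, O w -> O' (rsubmx w).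

Lemma pull_smooth (f : sfun O') : smooth_on O (fun w => sfv f (rsubmx w) : R^o).
Proof. by move=> k; apply: (Ck_rsubmx OO'); exact: sfv_smooth. Qed.

Definition pull (f : sfun O') : sfun O := mksfun (pull_smooth f).

Lemma pullE f w : O w -> sfv (pull f) w = sfv f (rsubmx w).
Proof. by move=> Ow; exact: mksfunE. Qed.

Lemma pull_zmod : zmod_morphism pull.
Proof.
by move=> f g; apply: sfun_eq => w Ow; rewrite /= !restrict0_in //; exact: OO'.
Qed.

Lemma pull_monoid : monoid_morphism pull.
Proof.
by split=> [|f g]; apply: sfun_eq => w Ow; rewrite /= !restrict0_in //; exact: OO'.
Qed.

HB.instance Definition _ := GRing.isZmodMorphism.Build (sfun O') (sfun O) pull pull_zmod.
HB.instance Definition _ := GRing.isMonoidMorphism.Build (sfun O') (sfun O) pull pull_monoid.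

Lemma sder_pull v f : sder v (pull f) = pull (sder (rsubmx v) f).
Proof.
apply: sfun_eq => w Ow; rewrite sderE // pullE // [RHS]sderE; last exact: OO'.
rewrite -derive_rsubmx; apply: (@derive_eq_on _ _ O) => // y Oy; exact: pullE.
Qed.

Lemma sder0 (f : sfun O') : sder 0 f = 0.
Proof.
apply: sfun_eq => w Ow; rewrite (sderE 0 f Ow) derive0.
by rewrite mksfunE.
Qed.

Lemma pull_const x : pull (sconst O' x) = sconst O x.
Proof. by apply: sfun_eq => w Ow; rewrite pullE // !mksfunE //; exact: OO'. Qed.

End Pullback.

(** * From sectional curvature to the curvature operator *)

Section LeviCivita.
Variables (R : realType) (m : nat) (O : domain R m) (g : 'rV[R]_m -> 'M[R]_m) (c : R).
Hypothesis g_smooth : smooth_on O g.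
Hypothesis g_posdef : forall u, O u -> posdef (g u).
Hypothesis c_neq0 : c != 0.
Hypothesis g_sec : forall u v w, O u -> row_free (col_mx v w) ->
  sectional_curvature g u v w = c.

Lemma smooth_entry i j : smooth_on O (fun u => g u i j : R^o).
Proof. by move=> k; apply: Ck_entry => //; exact: dset_open. Qed.

Definition smetric : 'M[sfun O]_m := \matrix_(i, j) mksfun (smooth_entry i j).
Let G := smetric.

Definition spartial (i : 'I_m) : {additive sfun O -> sfun O} := sder (delta_mx 0 i).
Let D := spartial.

Let DM d a b : D d (a * b) = D d a * b + a * D d b.
Proof. exact: sderM. Qed.
Let DC d e a : D d (D e a) = D e (D d a).
Proof. exact: sderC. Qed.

Lemma smetricE (p : point O) : map_mx (sev p) G = g (sval p).
Proof.
by case: p => u Ou; apply/matrixP => i j; rewrite !mxE /sev mksfunE.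
Qed.

Lemma smetric_sym : G^T = G.
Proof.
apply/matrixP => i j; apply: sfun_eq => u Ou; rewrite !mxE !mksfunE //.
by have [gs _] := g_posdef Ou; rewrite -[in LHS]gs mxE.
Qed.

Lemma smetric_pos (p : point O) (v : 'rV[R]_m) : v != 0 ->
  0 < (v *m map_mx (sev p) G *m v^T) 0 0.
Proof.
by case: p => u Ou v0; rewrite smetricE; have [_] := g_posdef Ou; exact.
Qed.

Lemma sev_unit (f : sfun O) : (forall p, sev p f != 0) -> f \is a GRing.unit.
Proof. by move=> f0; apply: sunitE => u Ou; exact: (f0 (exist _ u Ou)). Qed.

Lemma sev_inj (f h : sfun O) : (forall p, sev p f = sev p h) -> f = h.
Proof. by move=> fh; apply: sfun_eq => u Ou; exact: (fh (exist _ u Ou)). Qed.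

Lemma sev_cst (p : point O) x : sev p (sconst O x) = x.
Proof. by case: p => u Ou; rewrite /sev mksfunE. Qed.

Lemma smetric_unit : G \in unitmx.
Proof. exact: (metric_unit sev_unit smetric_sym smetric_pos). Qed.

Let two_unit : (2 : sfun O) \is a GRing.unit.
Proof. by apply: sev_unit => p; rewrite rmorph_nat pnatr_eq0. Qed.

Definition sgam : 'I_m -> 'M[sfun O]_m := christoffel_mx D G.

Lemma sgam_swap a b d : sgam a b d = sgam b a d.
Proof. exact: (christoffel_mx_swap D smetric_sym). Qed.

Lemma sgam_metric d : dmx D d G = sgam d *m G + (sgam d *m G)^T.
Proof. exact: (christoffel_mx_metric D smetric_sym smetric_unit two_unit). Qed.

Lemma sev_partial (p : point O) i (f : sfun O) (F : 'rV[R]_m -> R^o) :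
  (forall u, O u -> sfv f u = F u) -> sev p (D i f) = pd i F (sval p).
Proof.
case: p => u Ou fF; apply: (etrans (sderE (delta_mx 0 i) f Ou)).
exact: (derive_eq_on (O := O)).
Qed.

Lemma sev_christoffel k i j (p : point O) :
  sev p (christoffel_symbol D G k i j) = christoffel g k i j (sval p).
Proof.
apply: (etrans (ev_christoffel_symbol D G two_unit (sev p) k i j)).
rewrite /christoffel; congr (_ * _); apply: eq_bigr => l _.
have e : sev p (invmx G k l) = invmx (g (sval p)) k l.
  by rewrite -smetricE -(ev_invmx smetric_unit (sev p)) mxE.
congr (_ * (_ + _ - _)); first exact: e; apply: sev_partial => u Ou; by rewrite mxE mksfunE.
Qed.

Lemma sev_curv i j k l (p : point O) :
  sev p (curv D sgam i j k l) = riemann g l i j k (sval p).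
Proof.
have chr a b d u : O u -> sfv (christoffel_symbol D G a b d) u = christoffel g a b d u.
  by move=> Ou; exact: (sev_christoffel a b d (exist _ u Ou)).
apply: (etrans (ev_curv D G (sev p) i j k l)); rewrite /riemann; congr (_ - _ + _).
- by apply: sev_partial => u Ou; exact: chr.
- by apply: sev_partial => u Ou; exact: chr.
by apply: eq_bigr => s _; congr (_ * _ - _ * _); exact: sev_christoffel.
Qed.

Lemma curv_const i j : curv D sgam i j = sconst O c *: wedge G i j.
Proof.
apply/matrixP => k l; apply: sev_inj => p.
have sec (v w : 'rV[R]_m) : row_free (col_mx v w) ->
     (w *m (\sum_i \sum_j (v 0 i * w 0 j) *: map_mx (sev p) (curv D sgam i j))
        *m map_mx (sev p) G *m v^T) 0 0 /
     ((v *m map_mx (sev p) G *m v^T) 0 0 * (w *m map_mx (sev p) G *m w^T) 0 0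
      - (v *m map_mx (sev p) G *m w^T) 0 0 ^+ 2) = c.
  move=> vw; rewrite -[RHS](g_sec (svalP p) vw) /sectional_curvature /bform smetricE.
  congr (((_ *m _ *m _) 0 0) / _); apply/rowP => s; rewrite [RHS]mxE.
  rewrite mulmx_sumr summxE; apply: eq_bigr => a _; rewrite mulmx_sumr summxE.
  apply: eq_bigr => b _; rewrite -scalemxAr mx_scaleE mxE mulr_sumr; apply: eq_bigr => e _.
  by rewrite [map_mx _ _ _ _]mxE sev_curv mulrA.
have := ev_constant_curvature DM DC smetric_sym smetric_unit sgam_swap sgam_metric c_neq0 sec i j.
move=> /matrixP/(_ k l); rewrite [LHS]mxE => ->.
rewrite mx_scaleE [map_mx _ _ _ _]mxE mx_scaleE rmorphM; congr (_ * _).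
exact: (esym (sev_cst p c)).
Qed.

End LeviCivita.

(** * Matrices of smooth functions *)

Section SmoothMatrices.
Variables (R : realType) (N : nat) (O : domain R N).
Let Oo := @dset_open _ _ O.
Let A := sfun O.
Let D := spartial O.

Definition entry_smooth p q (X : 'rV[R]_N -> 'M[R]_(p, q)) (Xs : smooth_on O X) i j :
  smooth_on O (fun w => X w i j : R^o) := fun k => Ck_entry i j Oo (Xs k).

Definition smx p q (X : 'rV[R]_N -> 'M[R]_(p, q)) (Xs : smooth_on O X) : 'M[A]_(p, q) :=
  \matrix_(i, j) mksfun (entry_smooth Xs i j).

Lemma ev_smx p q (X : 'rV[R]_N -> 'M[R]_(p, q)) (Xs : smooth_on O X) (w : point O) :
  map_mx (sev w) (smx Xs) = X (sval w).
Proof. by case: w => w Ow; apply/matrixP => i j; rewrite !mxE /sev mksfunE. Qed.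

Lemma ev_dmx_eq p q (M : 'M[A]_(p, q)) (X : 'rV[R]_N -> 'M[R]_(p, q)) d (w : point O) :
  (forall w : point O, differentiable X (sval w)) ->
  (forall w : point O, map_mx (sev w) M = X (sval w)) ->
  map_mx (sev w) (dmx D d M) = 'D_(delta_mx 0 d) X (sval w).
Proof.
move=> dX MX; rewrite derive_mx; last exact/diff_derivable/dX.
apply/matrixP => i j; rewrite !mxE; case: w => w Ow.
apply: (etrans (sderE _ _ Ow)); apply: (derive_eq_on (O := O)) => // y Oy.
by have /matrixP/(_ i j) := MX (exist _ y Oy); rewrite mxE.
Qed.

Lemma smx_eq p q (M M' : 'M[A]_(p, q)) :
  (forall w : point O, map_mx (sev w) M = map_mx (sev w) M') -> M = M'.
Proof.
move=> e; apply/matrixP => i j; apply: sev_inj => w.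
by have /matrixP/(_ i j) := e w; rewrite !mxE.
Qed.

End SmoothMatrices.

Lemma dotmx_gt0 (F : realFieldType) n (u : 'rV[F]_n) : u != 0 -> 0 < (u *m u^T) 0 0.
Proof.
move=> u0; rewrite mxE lt_neqAle sumr_ge0 ?andbT; last first.
  by move=> i _; rewrite mxE -expr2 sqr_ge0.
apply: contra u0; rewrite eq_sym psumr_eq0; last by move=> i _; rewrite mxE -expr2 sqr_ge0.
move=> /allP z; apply/eqP/rowP => i; have := z i (mem_index_enum i).
by rewrite !mxE -expr2 sqrf_eq0 => /eqP.
Qed.

Lemma row_jacobian (R : realType) N k (f : 'rV[R]_N -> 'rV[R]_k) w d :
  differentiable f w -> row d ('J f w) = 'D_(delta_mx 0 d) f w.
Proof. by move=> df; rewrite deriveEjacobian // -rowE. Qed.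

(** * Constancy of the shape operator of a hypersphere *)

Section ConstantShape.
Variables (R : realType) (N k : nat) (O : domain R N) (Y Xi : 'rV[R]_N -> 'rV[R]_k).
Hypothesis Y_smooth : smooth_on O Y.
Hypothesis Xi_smooth : smooth_on O Xi.
Hypothesis Xi_transversal : forall w, O w -> ~~ (Xi w <= 'J Y w)%MS.
Hypothesis Xi_tangent : forall w v, O w -> ('D_v Xi w <= 'J Y w)%MS.

Let A := sfun O.
Let D := spartial O.
Let DM d a b : D d (a * b) = D d a * b + a * D d b. Proof. exact: sderM. Qed.
Let YA := smx Y_smooth.
Let XA := smx Xi_smooth.
Let dY w d : map_mx (sev w) (dmx D d YA) = 'D_(delta_mx 0 d) Y (sval w).
Proof.
apply: ev_dmx_eq => w'; last exact: ev_smx.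
exact/(smooth_differentiable Y_smooth)/svalP.
Qed.
Let dX w d : map_mx (sev w) (dmx D d XA) = 'D_(delta_mx 0 d) Xi (sval w).
Proof.
apply: ev_dmx_eq => w'; last exact: ev_smx.
exact/(smooth_differentiable Xi_smooth)/svalP.
Qed.

Let Xi_neq0 w : O w -> Xi w != 0.
Proof. by move=> Ow; apply: contra (Xi_transversal Ow) => /eqP ->; exact: sub0mx. Qed.

Let Xi_coef w a : O w -> (a *: Xi w <= 'J Y w)%MS -> a = 0.
Proof.
move=> Ow; have [//|a0 s] := eqVneq a 0; case/negP: (Xi_transversal Ow).
by rewrite -[Xi w]scale1r -(mulVf a0) -scalerA scalemx_sub.
Qed.

Let shape_of_partial a w v : O w ->
  (forall d, 'D_(delta_mx 0 d) Xi w = a *: 'D_(delta_mx 0 d) Y w) ->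
  'D_v Xi w = a *: 'D_v Y w.
Proof.
move=> Ow e; have dy := smooth_differentiable Y_smooth Ow.
have dx := smooth_differentiable Xi_smooth Ow.
rewrite !deriveEjacobian // scalemxAr; congr (_ *m _); apply/row_matrixP => d.
transitivity (a *: row d ('J Y w)); last by apply/rowP => j; rewrite !mxE.
apply: (etrans (row_jacobian d dx)); rewrite e; congr (_ *: _).
exact/esym/row_jacobian.
Qed.

(** Write [o - Y = f Xi] and differentiate: the transversal component of the result is the
    derivative of [f], so [f] is a constant, and the tangential part says that the shape operator is
    its inverse. *)
Lemma proper_shape (o : 'rV[R]_k) : (0 < N)%N ->
  (forall w, O w -> row_free ('J Y w)) ->
  (forall w, O w -> exists t, Y w + t *: Xi w = o) ->
  exists H, forall w v, O w -> 'D_v Xi w = - H *: 'D_v Y w.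
Proof.
(* The pointwise coefficient given by [oE] is not known to be smooth; an auxiliary Euclidean product
   with [Xi] recovers it as a quotient of smooth functions. *)
move=> N0 rf oE; pose u : A := (XA *m XA^T) 0 0.
have uu : u \is a GRing.unit.
  apply: sev_unit => w; rewrite /u -[sev _ _]/(sev w (_ 0 0)).
  have -> : sev w ((XA *m XA^T) 0 0) = (map_mx (sev w) (XA *m XA^T)) 0 0 by rewrite [RHS]mxE.
  by rewrite map_mxM map_mx_tr ev_smx gt_eqF // dotmx_gt0 // Xi_neq0 //; exact: svalP.
pose oA : 'M[A]_(1, k) := map_mx (sconst O) o.
pose f : A := ((oA - YA) *m XA^T) 0 0 * u^-1.
have evo w : map_mx (sev w) oA = o.
  by apply/matrixP => i j; rewrite !mxE; exact: sev_cst.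
have fE : oA - YA = f *: XA.
  apply: smx_eq => w; rewrite map_mxB map_mxZ evo !ev_smx.
  have [t tE] := oE _ (svalP w); rewrite -tE addrC addKr; congr (_ *: _).
  rewrite rmorphM rmorphV //=.
  have -> : sev w (((oA - YA) *m XA^T) 0 0) = t * sev w u.
    have -> : sev w u = (map_mx (sev w) (XA *m XA^T)) 0 0 by rewrite [RHS]mxE.
    have -> : sev w (((oA - YA) *m XA^T) 0 0) = (map_mx (sev w) ((oA - YA) *m XA^T)) 0 0.
      by rewrite [RHS]mxE.
    rewrite !map_mxM map_mxB map_mx_tr evo !ev_smx -tE addrC addKr -scalemxAl.
    by rewrite mx_scaleE.
  by rewrite mulfK // -unitfE; exact: rmorph_unit.
have dfE d : - dmx D d YA = D d f *: XA + f *: dmx D d XA.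
  rewrite -dmxZ // -fE dmxB -[LHS]add0r; congr (_ - _).
  by apply/matrixP => i j; rewrite !mxE; exact/esym/sder_const.
have df d : D d f = 0.
  apply: sev_inj => w; rewrite rmorph0; apply: (Xi_coef (svalP w)).
  have := congr1 (map_mx (sev w)) (dfE d).
  rewrite map_mxN map_mxD !map_mxZ dY dX ev_smx => e.
  rewrite -[X in (X <= _)%MS](addrK (sev w f *: 'D_(delta_mx 0 d) Xi (sval w))) -e.
  apply: addmx_sub; last by rewrite eqmx_opp; apply: scalemx_sub; apply: Xi_tangent; exact: svalP.
  rewrite eqmx_opp.
  rewrite deriveEjacobian ?submxMl //; exact/(smooth_differentiable Y_smooth)/svalP.
have [x xE] := sder_eq0_const df.
have YX w d : O w -> - 'D_(delta_mx 0 d) Y w = x *: 'D_(delta_mx 0 d) Xi w.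
  move=> Ow; pose p : point O := exist _ w Ow.
  have := congr1 (map_mx (sev p)) (dfE d).
  rewrite df scale0r add0r map_mxN map_mxZ dY dX => ->; congr (_ *: _).
  by rewrite xE; exact: sev_cst.
(* Otherwise all partial derivatives of [Y] would vanish, although [Y] is an immersion of positive
   dimension. *)
have x0 : x != 0.
  apply/eqP => x0; have Op := dset_pt O; have := rf _ Op.
  suff -> : 'J Y (dpt O) = 0 by rewrite /row_free mxrank0 eq_sym (gtn_eqF N0).
  apply/row_matrixP => d; rewrite row0 rowE -deriveEjacobian; last exact: (smooth_differentiable Y_smooth).
  by apply/eqP; rewrite -oppr_eq0 YX // x0 scale0r.
exists x^-1 => w v Ow; apply: shape_of_partial => // d.
by rewrite scaleNr -scalerN YX // scalerA mulVf // scale1r.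
Qed.

(** A normal of constant direction has derivatives proportional to itself; being also tangent, they
    vanish, so [H = 0]. *)
Lemma improper_shape :
  (forall w w', O w -> O w' -> exists t, Xi w = t *: Xi w') ->
  exists H, forall w v, O w -> 'D_v Xi w = - H *: 'D_v Y w.
Proof.
move=> par; exists 0 => w v Ow; rewrite oppr0; apply: shape_of_partial => // d.
rewrite scale0r; have Op := dset_pt O; set e := delta_mx 0 d.
pose X0 := Xi (dpt O); pose n0 := (X0 *m X0^T) 0 0.
have n0u : n0 != 0 by rewrite gt_eqF // dotmx_gt0 // Xi_neq0.
pose XA0 : 'M[A]_(1, k) := map_mx (sconst O) X0.
pose f : A := (XA *m XA0^T) 0 0 * sconst O n0^-1.
have ev0 w' : map_mx (sev w') XA0 = X0.
  by apply/matrixP => i j; rewrite !mxE; exact: sev_cst.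
have fE : XA = f *: XA0.
  apply: smx_eq => w'; rewrite map_mxZ ev0 ev_smx.
  have [t tE] := par _ _ (svalP w') Op; rewrite tE -/X0; congr (_ *: _).
  apply/esym/(etrans (rmorphM (sev w') _ _)).
  rewrite [X in _ * X](_ : _ = n0^-1); last exact: sev_cst.
  rewrite [X in X * _](_ : _ = t * n0); first by rewrite mulfK.
  transitivity ((map_mx (sev w') (XA *m XA0^T)) 0 0); first by rewrite [RHS]mxE.
  by rewrite map_mxM map_mx_tr ev0 ev_smx tE -/X0 -scalemxAl mx_scaleE.
pose p : point O := exist _ w Ow.
have XwE : Xi w = sev p f *: X0.
  by rewrite -[in LHS](ev_smx Xi_smooth p) -/XA fE map_mxZ ev0.
have dXE : 'D_e Xi w = sev p (D d f) *: X0.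
  rewrite -(dX p d) fE dmxZ // map_mxD !map_mxZ ev0.
  have -> : dmx D d XA0 = 0 by apply/matrixP => i j; rewrite !mxE; exact: sder_const.
  by rewrite map_mx0 scaler0 addr0.
have f0 : sev p f != 0.
  by apply: contra (Xi_neq0 Ow) => /eqP f0; rewrite XwE f0 scale0r.
have e1 : 'D_e Xi w = (sev p (D d f) / sev p f) *: Xi w.
  by rewrite XwE scalerA divfK.
by have := Xi_tangent e Ow; rewrite {1}e1 => /(Xi_coef Ow) e0; rewrite e1 e0 scale0r.
Qed.

End ConstantShape.

(** * The theorem in product coordinates *)

Section LocalHypersphere.
Variables (R : realType) (m : nat) (O : domain R (1 + m)) (O' : domain R m).
Hypothesis OO' : forall w, O w -> O' (rsubmx w).
Variables (g : 'rV[R]_m -> 'M[R]_m) (c : R).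
Hypothesis m_gt1 : (1 < m)%N.
Hypothesis g_smooth : smooth_on O' g.
Hypothesis g_posdef : forall u, O' u -> posdef (g u).
Hypothesis c_neq0 : c != 0.
Hypothesis g_sec : forall u v w, O' u -> row_free (col_mx v w) ->
  sectional_curvature g u v w = c.
Variables (Y Xi : 'rV[R]_(1 + m) -> 'rV[R]_(1 + (1 + m))).
Hypothesis Y_smooth : smooth_on O Y.
Hypothesis Xi_smooth : smooth_on O Xi.
Let hh (w : 'rV[R]_(1 + m)) : 'M[R]_(1 + m) := block_mx 1 0 0 (g (rsubmx w)).
Hypothesis Y_gauss : forall w v v', O w ->
  ('D_v (fun y => 'D_v' Y y) w - bform (hh w) v v' *: Xi w <= 'J Y w)%MS.
Hypothesis Y_vol : forall w, O w ->
  `|\det (col_mx (Xi w) ('J Y w) : 'M[R]_(1 + (1 + m)))| = Num.sqrt `|\det (hh w)|.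
Variable H : R.
Hypothesis Xi_shape : forall w v, O w -> 'D_v Xi w = - H *: 'D_v Y w.

Let Oo := @dset_open _ _ O.
Let A := sfun O.

Let D (d : 'I_(1 + m)) : {additive A -> A} := sder (delta_mx 0 d).
Let DM d a b : D d (a * b) = D d a * b + a * D d b. Proof. exact: sderM. Qed.
Let DC d e a : D d (D e a) = D e (D d a). Proof. exact: sderC. Qed.

Let YA := smx Y_smooth.
Let XA := smx Xi_smooth.
Let JA : 'M[A]_(1 + m, 1 + (1 + m)) := \matrix_(a, j) D a (YA 0 j).
Let E : 'M[A]_(1 + (1 + m)) := col_mx XA JA.

Let row_JA a : row a JA = dmx D a YA.
Proof. by apply/rowP => j; rewrite !mxE. Qed.

Let Yd (w : point O) : differentiable Y (sval w).
Proof. exact/(smooth_differentiable Y_smooth)/svalP. Qed.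

Let Yvd v (w : point O) : differentiable (fun y => 'D_v Y y) (sval w).
Proof. by apply: (smooth_differentiable (smooth_derive v Y_smooth)); exact: svalP. Qed.

Let Xd (w : point O) : differentiable Xi (sval w).
Proof. exact/(smooth_differentiable Xi_smooth)/svalP. Qed.

Let ev_row_JA w a : map_mx (sev w) (row a JA) = 'D_(delta_mx 0 a) Y (sval w).
Proof. by rewrite row_JA; apply: ev_dmx_eq => // w'; exact: ev_smx. Qed.

Let ev_JA w : map_mx (sev w) JA = 'J Y (sval w).
Proof.
by apply/row_matrixP => a; rewrite -map_row ev_row_JA deriveEjacobian // -rowE.
Qed.

Let ev_E w : map_mx (sev w) E = col_mx (Xi (sval w)) ('J Y (sval w)).
Proof. by rewrite map_col_mx ev_smx ev_JA. Qed.

Let G := map_mx (pull OO') (smetric g_smooth).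
Let gam (i : 'I_m) := map_mx (pull OO') (sgam g_smooth i).
Let h : 'M[A]_(1 + m) := block_mx 1 0 0 G.

Let ev_G w : map_mx (sev w) G = g (rsubmx (sval w)).
Proof.
case: w => w Ow; apply/matrixP => i j; rewrite !mxE; apply: (etrans (pullE _ _ Ow)).
by rewrite mksfunE //; exact: OO'.
Qed.

Let ev_h w : map_mx (sev w) h = hh (sval w).
Proof. by rewrite map_block_mx !map_mx0 map_mx1 ev_G. Qed.

Let gpos u : O' u -> 0 < \det (g u).
Proof.
move=> /g_posdef [gs gp]; have [P /(congr1 determinant)] := orthonormal_basis gs gp.
rewrite !det_mulmx det_tr det1 => e.
have P0 : \det P != 0.
  by apply/eqP => P0; move: e; rewrite P0 !mul0r => /esym/eqP; rewrite oner_eq0.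
have : 0 < \det P ^+ 2 by rewrite exprn_even_gt0.
move=> p2; rewrite -(pmulr_rgt0 _ p2).
by have -> : \det P ^+ 2 * \det (g u) = 1 by rewrite -e; ring.
Qed.

Let vol : \det E ^+ 2 = \det h.
Proof.
apply: sev_inj => w; rewrite rmorphXn -!det_map_mx ev_E ev_h -real_normK ?num_real //.
rewrite (Y_vol (svalP w)) sqr_sqrtr ?normr_ge0 // ger0_norm // det_ublock det1 mul1r.
by apply/ltW/gpos/OO'/svalP.
Qed.

Let Eu : E \in unitmx.
Proof.
rewrite unitmxE; apply: sev_unit => w; apply/eqP => d0.
have : sev w (\det E ^+ 2) != 0.
  by rewrite vol -det_map_mx ev_h det_ublock det1 mul1r gt_eqF //; exact/gpos/OO'/svalP.
by rewrite rmorphXn /= d0 expr0n eqxx.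
Qed.

Let invE : [/\ XA *m invmx E = row_mx 1 0 & JA *m invmx E = row_mx 0 1%:M].
Proof.
have := mulmxV Eu; rewrite mul_col_mx [RHS](scalar_mx_block 1 (1 + m) 1).
by move=> /eq_col_mx [-> ->].
Qed.

(** The second derivatives of [Y] expanded in the frame [E], without their normal component: the
    coefficients of the induced connection. *)
Let hA d := rsubmx (dmx D d JA *m invmx E).
Let K d := hA d - cylinder_christoffel gam d.

Let dJ_normal d : lsubmx (dmx D d JA *m invmx E) = col d h.
Proof.
apply/colP => a; apply: sev_inj => w.
have [Xe Je] := invE.
have -> : (lsubmx (dmx D d JA *m invmx E)) a 0 = (row a (dmx D d JA) *m invmx E) 0 (lshift (1 + m) 0).
  by rewrite -row_mul !mxE.
have e : map_mx (sev w) (row a (dmx D d JA)) =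
    'D_(delta_mx 0 d) (fun y => 'D_(delta_mx 0 a) Y y) (sval w).
  have -> : row a (dmx D d JA) = dmx D d (row a JA) by apply/rowP => j; rewrite !mxE.
  by apply: ev_dmx_eq => w'; [exact: Yvd | exact: ev_row_JA].
have /submxP [s sE] := Y_gauss (delta_mx 0 d) (delta_mx 0 a) (svalP w).
have XeR : map_mx (sev w) XA *m map_mx (sev w) (invmx E) = row_mx 1 0.
  by rewrite -map_mxM Xe map_row_mx map_mx1 map_mx0.
have JeR : map_mx (sev w) JA *m map_mx (sev w) (invmx E) = row_mx 0 1%:M.
  by rewrite -map_mxM Je map_row_mx map_mx1 map_mx0.
transitivity ((map_mx (sev w) (row a (dmx D d JA)) *m map_mx (sev w) (invmx E)) 0 (lshift (1 + m) 0)).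
  by rewrite -map_mxM [RHS]mxE.
rewrite e -(subrK (bform (hh (sval w)) (delta_mx 0 d) (delta_mx 0 a) *: Xi (sval w)) ('D_ _ _ _)).
rewrite sE mulmxDl -mulmxA -ev_JA JeR mul_mx_row mulmx0 -scalemxAl -(ev_smx Xi_smooth) XeR.
rewrite scale_row_mx add_row_mx row_mxEl mx_addE mx_zeroE add0r mx_scaleE.
have hsym : h^T = h by rewrite tr_block_mx trmx1 !trmx0 -map_mx_tr smetric_sym.
rewrite [(1 : 'M[R]_1) _ _]mxE eqxx mulr1n mulr1 /bform -rowE trmx_delta -colE -ev_h.
have hE : (col d h) a 0 = h d a by rewrite mxE -[in LHS]hsym mxE.
by rewrite hE !mxE.
Qed.

Let dXi d : dmx D d XA = - sconst O H *: row d JA.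
Proof.
apply/rowP => j; apply: sev_inj => w.
have /matrixP/(_ 0 j) := ev_dmx_eq d w Xd (ev_smx Xi_smooth).
rewrite mxE => ->; rewrite Xi_shape; last exact: svalP.
rewrite -ev_row_JA mx_scaleE [in RHS]mx_scaleE rmorphM; congr (_ * _); last by rewrite mxE.
by apply: (etrans _ (esym (rmorphN (sev w) _))); congr (- _); exact/esym/sev_cst.
Qed.

Let dE d : dmx D d E =
  block_mx 0 (- sconst O H *: delta_mx 0 d) (col d h) (cylinder_christoffel gam d + K d) *m E.
Proof.
rewrite /dmx map_col_mx -!/(dmx D d _) dXi mul_block_col mul0mx add0r -scalemxAl -rowE.
congr col_mx; rewrite /K subrKC -(dJ_normal d) -mul_row_col hsubmxK mulmxKV //.
Qed.

Let K_swap a b d : K a b d = K b a d.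
Proof.
have hAE a' b' d' : hA a' b' d' = (row b' (dmx D a' JA) *m invmx E) 0 (rshift 1 d').
  by rewrite -row_mul !mxE.
have gs i j k : gam i j k = gam j i k.
  exact: (map_mx_swap (pull OO') (sgam_swap g_smooth g_posdef)).
have S : row b (dmx D a JA) = row a (dmx D b JA).
  by apply/rowP => j; rewrite !mxE; exact: DC.
have hAs : hA a b d = hA b a d.
  by apply: (etrans (hAE a b d)); rewrite S; exact/esym/hAE.
apply: (etrans (mx_subE _ _ _ _)); apply: (etrans _ (esym (mx_subE _ _ _ _))).
exact: (congr2 (fun x y => x - y) hAs (cylinder_christoffel_swap a b d gs)).
Qed.

Let pullD (f : sfun O') i : D (rshift 1 i) (pull OO' f) = pull OO' (spartial O' i f).
Proof.
by apply: (etrans (sder_pull OO' _ f)); rewrite delta_mx_rshift row_mxKr.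
Qed.

Let pullD0 (f : sfun O') : D (lshift m 0) (pull OO' f) = 0.
Proof.
apply: (etrans (sder_pull OO' _ f)); rewrite delta_mx_lshift row_mxKr.
by rewrite (sder0 f) raddf0.
Qed.

Let pull_dmx p q (M : 'M[sfun O']_(p, q)) i :
  dmx D (rshift 1 i) (map_mx (pull OO') M) = map_mx (pull OO') (dmx (spartial O') i M).
Proof. by apply/matrixP => a b; rewrite !mxE; exact: pullD. Qed.

Let pull_dmx0 p q (M : 'M[sfun O']_(p, q)) : dmx D (lshift m 0) (map_mx (pull OO') M) = 0.
Proof. by apply/matrixP => a b; rewrite !mxE; exact: pullD0. Qed.

Let Gsym : G^T = G.
Proof. by rewrite -map_mx_tr smetric_sym. Qed.

Let Gpos (t : point O) (v : 'rV[R]_m) : v != 0 -> 0 < (v *m map_mx (sev t) G *m v^T) 0 0.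
Proof. by move=> v0; rewrite ev_G; have [_] := g_posdef (OO' (svalP t)); exact. Qed.

Let gam_swap a b d : gam a b d = gam b a d.
Proof. exact: (map_mx_swap (pull OO') (sgam_swap g_smooth g_posdef)). Qed.

Let gam_metric i : dmx D (rshift 1 i) G = gam i *m G + (gam i *m G)^T.
Proof.
by rewrite pull_dmx (sgam_metric g_smooth) // map_mxD map_mx_tr map_mxM.
Qed.

Let rie_const i j :
  curv (fun k => D (rshift 1 k)) gam i j = sconst O c *: wedge G i j.
Proof.
transitivity (map_mx (pull OO') (curv (spartial O') (sgam g_smooth) i j)).
  by apply: map_curv => k a; exact: pullD.
rewrite (curv_const g_smooth g_posdef c_neq0 g_sec) map_mxZ; congr (_ *: _); first exact: pull_const.
by rewrite /wedge map_mxM map_mxB !map_delta_mx.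
Qed.

Let ev (t : point O) : {rmorphism A -> R} := sev t.
Let cst : {rmorphism R -> A} := sconst O.
Let t0 : point O := exist _ (dpt O) (dset_pt O).
Let ev_inj (a : A) : (forall t, ev t a = 0) -> a = 0.
Proof. by move=> a0; apply: sev_inj => t; rewrite [RHS]rmorph0; exact: a0. Qed.
Let ev_unit (a : A) : (forall t, ev t a != 0) -> a \is a GRing.unit.
Proof. exact: sev_unit. Qed.
Let ev_cst t x : ev t (cst x) = x. Proof. exact: sev_cst. Qed.
Let D_cst d x : D d (cst x) = 0. Proof. exact: sder_const. Qed.
Let D_const (a : A) : (forall d, D d a = 0) -> exists x, a = cst x.
Proof. exact: sder_eq0_const. Qed.

Let dzG : dmx D (lshift m 0) G = 0. Proof. exact: pull_dmx0. Qed.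
Let dzgam i : dmx D (lshift m 0) (gam i) = 0. Proof. exact: pull_dmx0. Qed.
Let DH d : D d (cst H) = 0. Proof. exact: D_cst. Qed.

Local Notation local_thm X := (X R A (point O) t0 ev cst ev_inj ev_unit ev_cst m D DM DC
  D_cst D_const G gam E (cst H) K c m_gt1 Gsym Gpos gam_swap gam_metric dzG dzgam
  Eu dE DH K_swap vol c_neq0 rie_const).

Let Xi_transversal (w : point O) : ~~ (Xi (sval w) <= 'J Y (sval w))%MS.
Proof.
apply/negP => /submxP [s sE].
have [/(congr1 (map_mx (sev w))) Xe /(congr1 (map_mx (sev w))) Je] := invE.
move: Xe Je; rewrite !map_mxM ev_smx ev_JA sE -mulmxA => + Je.
rewrite Je !map_row_mx map_mx1 !map_mx0 map_mx1 mul_mx_row mulmx0 => /eq_row_mx [/matrixP/(_ 0 0)].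
by rewrite !mxE eqxx => /esym/eqP; rewrite oner_eq0.
Qed.

(** The last clause says that the axis of the first Calabi coordinate, brought back to the original
    coordinates, is not tangent. It makes the projection along this axis a local diffeomorphism. *)
Theorem local_calabi_composition : c < 0 /\
  exists (M : 'M[R]_m.+2) (b : 'rV[R]_m.+2), M \in unitmx /\
    forall w, O w -> calabi_composition R m.+1 (Y w *m M + b) /\
      ~~ ((delta_mx 0 ord0 : 'rV[R]_m.+2) *m invmx M <= 'J Y w)%MS.
Proof.
split; first exact: (local_thm (@sectional_lt0)).
have [x x0 lamE] := local_thm (@diff_coef_const).
pose z : 'I_(1 + m) := lshift m 0.
pose e : A := mksfun (smooth_expR x z Oo).
pose q : A := mksfun (smooth_expR (- x) z Oo).
have eq1 : e * q = 1.
  apply: sfun_eq => u Ou; rewrite !mksfunE // -expRD mulNr subrr expR0.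
  by [].
have De d : D d e = cst (x * (delta_mx 0 d : 'rV[R]_(1 + m)) 0 z) * e.
  apply: sfun_eq => u Ou; apply: (etrans (sderE _ _ Ou)).
  rewrite (derive_eq_on (O := O) (g := fun y : 'rV[R]_(1 + m) => expR (x * y 0 z) : R^o)) //; last first.
    by move=> y Oy; rewrite mksfunE.
  by have [_ ->] := derive_expR_coord x z (delta_mx 0 d) u; rewrite !mksfunE.
have Dze : D z e = diff_coef K * e by rewrite De lamE !mxE !eqxx mulr1.
have Dre i : D (rshift 1 i) e = 0.
  by rewrite De mxE eqxx /= mulr0 rmorph0 mul0r.
have pE : null_vector E K e = map_mx cst (map_mx (ev t0) (null_vector E K e)).
  exact: (local_thm (@null_vector_const) Dze Dre).
have [B gramE] := local_thm (@normal_gram_const) eq1 Dze Dre.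
have YE := local_thm (@centered_position_frame) eq1.
have dY := local_thm (@d_centered_position).
set Yc := centered_position E K in YE dY.
set pA := null_vector E K e in pE YE.
set QA := hyperboloid_vector E K q in YE.
pose p := map_mx (sev t0) pA.
have evp t : map_mx (sev t) pA = p.
  by rewrite pE; apply/matrixP => i j; rewrite !mxE; exact: sev_cst.
(* The scalar factor of [centered_position_frame], a constant because [lam] is. *)
pose k : R := m.+2%:R^-1 / x.
have k0 : k != 0 by rewrite mulf_neq0 // invr_eq0 // pnatr_eq0.
have nu n : (n.+1%:R : A) \is a GRing.unit by apply: ev_unit => t; rewrite rmorph_nat pnatr_eq0.
have xu : cst x \is a GRing.unit by apply: ev_unit => t; rewrite ev_cst.
have evk t : ev t (m.+2%:R^-1 / diff_coef K) = k.
  by rewrite rmorphM rmorphV // rmorph_nat lamE rmorphV // ev_cst.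
have [P PG] := metric_frame Gsym Gpos t0.
have [||M Mu [[s s0 sp] calM]] := @calabi_coordinates R m (point O) t0 p B
  (fun t => map_mx (sev t) QA) (fun t => map_mx (sev t) (hyperboloid_frame E q))
  (fun t => map_mx (sev t) G) P PG _ k (fun t => sev t e) (fun t => sev t q) k0.
- by move=> t; rewrite -(evp t); apply: (map_frame_gram (f := ev t) (ev_cst t) gramE).
- by move=> t; rewrite -[LHS](rmorphM (ev t)) eq1 rmorph1.
(* [Y] and [Yc] have the same partial derivatives; the constant of integration [b] is the centre. *)
have [b bE] : exists b : 'rV[R]_m.+2, forall t : point O, Y (sval t) = map_mx (sev t) Yc + b.
  exists (Y (sval t0) - map_mx (sev t0) Yc) => t; apply/rowP => j.
  have [d|y yE] := @D_const (YA 0 j - Yc 0 j).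
    rewrite raddfB /=; have /matrixP/(_ 0 j) := dY d.
    by rewrite col_mxKd row_JA mxE [RHS]mxE => ->; rewrite subrr.
  have at_ t' : Y (sval t') 0 j - (map_mx (sev t') Yc) 0 j = y.
    rewrite -(ev_smx Y_smooth t') [in X in X - _]mxE [in X in _ - X]mxE.
    by rewrite -[LHS](rmorphB (ev t')) yE; exact: ev_cst.
  by rewrite mx_addE mx_subE at_ -(at_ t) subrKC.
exists M, (- (b *m M)); split=> // w Ow.
pose t : point O := exist _ w Ow.
have Yw := bE t; rewrite /= in Yw.
have YcE : map_mx (sev t) Yc = k *: (sev t e *: map_mx (sev t) QA - sev t q ^+ m.+1 *: p).
  rewrite [in LHS]YE; apply: (etrans (map_mx_comb (ev t) _ _ _ _ _ _)).
  by rewrite -(evp t); congr (_ *: _); exact: evk.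
split.
  by rewrite Yw mulmxDl addrK YcE; exact: calM.
(* The axis is spanned by [p]. If [p] were tangent, so would be [Yc], a combination of [p] and the
   tangent vector [Y_z], and with it the normal, a multiple of [Yc]. *)
rewrite sp; apply/negP => sub; have {sub} psub : (p <= 'J Y w)%MS.
  by rewrite -[p]scale1r -(mulVf s0) -scalerA scalemx_sub.
have Yz : map_mx (sev t) (usubmx JA) = 'D_(delta_mx 0 z) Y w.
  rewrite -(ev_row_JA t z); congr map_mx; apply/rowP => j; rewrite !mxE.
  by congr (D _ _); apply: val_inj.
have eu : sev t e != 0.
  apply/eqP => e0; have := etrans (esym (rmorphM (ev t) e q)) (congr1 (ev t) eq1).
  by rewrite rmorph1 [ev t e]e0 mul0r => /esym/eqP; rewrite oner_eq0.
have Ycsub : (map_mx (sev t) Yc <= 'J Y w)%MS.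
  have pE' : p = sev t e ^+ m.+1 *: ('D_(delta_mx 0 z) Y w - x *: map_mx (sev t) Yc).
    have := map_null_vector (ev t) E K e; rewrite col_mxKd lamE [ev t (cst x)]ev_cst => e1.
    by rewrite -(evp t) -Yz; exact: e1.
  have -> : map_mx (sev t) Yc = x^-1 *: ('D_(delta_mx 0 z) Y w - (sev t e ^+ m.+1)^-1 *: p).
    by rewrite pE' scalerK ?expf_neq0 // opprB addrC subrK scalerK.
  rewrite scalemx_sub // addmx_sub ?(deriveEjacobian _ (Yd t)) ?submxMl //.
  by rewrite eqmx_opp scalemx_sub.
have /negP := Xi_transversal t; apply.
have un : m.+1%:R * diff_coef K ^+ 2 \is a GRing.unit by rewrite unitrM nu unitrX // lamE.
have -> : Xi (sval t) = sev t (m.+1%:R * diff_coef K ^+ 2) *: map_mx (sev t) Yc.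
  have := map_centered_position (ev t) E un; rewrite col_mxKu => e1.
  by rewrite -(ev_smx Xi_smooth t); exact: e1.
exact: scalemx_sub.
Qed.

End LocalHypersphere.

(** * Open mapping *)

Section OpenMapping.
Variables (R : realType) (N : nat).
Implicit Types (f : 'rV[R]_N -> 'rV[R]_N) (u v w y z t : 'rV[R]_N).

(** The norm on row vectors is the maximum norm, which is not differentiable; minimisation needs the
    squared Euclidean distance. *)
Definition dist2 y z : R := \sum_j (z 0 j - y 0 j) ^+ 2.

Lemma dist2_ge0 y z : 0 <= dist2 y z.
Proof. by apply: sumr_ge0 => j _; exact: sqr_ge0. Qed.

Lemma dist2_eq0 y z : dist2 y z = 0 -> z = y.
Proof.
move=> /eqP; rewrite psumr_eq0; last by move=> j _; exact: sqr_ge0.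
move=> /allP z0; apply/rowP => j; have := z0 j (mem_index_enum j).
by rewrite sqrf_eq0 subr_eq0 => /eqP.
Qed.

Lemma dist2_triangle y z t : dist2 y z <= 2 * dist2 t z + 2 * dist2 y t.
Proof.
rewrite /dist2 !mulr_sumr -big_split /=; apply: ler_sum => j _.
rewrite -subr_ge0 [leRHS](_ : _ = (z 0 j - t 0 j - (t 0 j - y 0 j)) ^+ 2); last by ring.
exact: sqr_ge0.
Qed.

Lemma is_derive_dist2 (V : normedModType R) (F : V -> 'rV[R]_N) y (p q : V) : differentiable F p ->
  differentiable (fun s : V => dist2 y (F s) : R^o) p /\
  'D_q (fun s : V => dist2 y (F s) : R^o) p = 2 * \sum_j (F p 0 j - y 0 j) * ('D_q F p) 0 j.
Proof.
move=> dF; pose G j := (fun s : V => F s 0 j : R^o) - cst (y 0 j).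
have dFj j : differentiable (fun s : V => F s 0 j : R^o) p.
  apply: (@differentiable_comp _ _ _ _ F (fun M : 'rV[R]_N => M 0 j : R^o)) => //.
  exact: differentiable_coord.
have dG j : differentiable (G j) p.
  by apply: differentiableB; [exact: dFj | exact: differentiable_cst].
have -> : (fun s : V => dist2 y (F s) : R^o) = \sum_j (G j * G j).
  by apply/funext => z; rewrite fct_sumE; apply: eq_bigr => j _; rewrite expr2.
have DG j : is_derive p q (G j) (('D_q F p) 0 j).
  apply: DeriveDef; first exact: diff_derivable.
  rewrite /G (@deriveB _ _ _ (fun s : V => F s 0 j : R^o) (cst (y 0 j))) ?derive_cst ?subr0 //.
    by rewrite derive_mx ?mxE //; exact: diff_derivable.
  exact/diff_derivable/dFj.
split; first by apply: differentiable_sum => j; exact: differentiableM.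
rewrite (@derive_val _ _ _ _ _ _ _ (is_derive_sum (fun j => is_deriveM (DG j) (DG j)))).
rewrite mulr_sumr; apply: eq_bigr => j _; rewrite /G !fctE /= -[_ *: _]/(_ * _); ring.
Qed.

Lemma differentiable_mulmxr (k : nat) (M : 'M[R]_(N, k)) u :
  differentiable (mulmxr M : 'rV[R]_N -> 'rV[R]_k) u.
Proof.
apply: differentiable_mx => i j.
have -> : (fun y : 'rV[R]_N => mulmxr M y i j : R^o) =
    \sum_l (fun y : 'rV[R]_N => y i l * M l j : R^o).
  by apply/funext => y; rewrite fct_sumE mxE.
apply: differentiable_sum => l.
apply: (@differentiableM _ _ (fun y : 'rV[R]_N => y i l : R^o) (cst (M l j))).
  exact: differentiable_coord.
exact: differentiable_cst.
Qed.

(** After composition with the inverse Jacobian the differential at [u] is the identity. With an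
    error of at most half of [w - u], the equality [f w = f u] forces [w - u = 0]. *)
Lemma local_injective f u : differentiable f u -> 'J f u \in unitmx ->
  exists2 r : R, 0 < r & forall w, `|w - u| <= r -> f w = f u -> w = u.
Proof.
move=> df Ju; pose g := (mulmxr (invmx ('J f u)) : 'rV[R]_N -> 'rV[R]_N) \o f.
have dl : differentiable (mulmxr (invmx ('J f u)) : 'rV[R]_N -> 'rV[R]_N) (f u).
  exact: differentiable_mulmxr.
have dg : differentiable g u by exact: differentiable_comp.
have Dg v : 'd g u v = v.
  have Lc : continuous (mulmxr (invmx ('J f u)) : 'rV[R]_N -> 'rV[R]_N).
    by move=> y; exact/differentiable_continuous/differentiable_mulmxr.
  rewrite (diff_comp df dl) /=; apply: (etrans (congr1 (fun F => F ('d f u v)) (diff_lin (f u) Lc))).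
  by rewrite -deriveE // deriveEjacobian //= mulmxK.
have [_ /eqaddoP/(_ 2^-1)] := (diff_locallyP _ _).1 dg.
rewrite invr_gt0 ltr0n => /(_ isT) /nbhs_normP [r /= r0 H].
exists (r / 2) => [|w wr fw]; first by rewrite divr_gt0.
have := H (w - u); rewrite /= sub0r normrN.
have wr' : `|w - u| < r by apply: le_lt_trans wr _; rewrite ltr_pdivrMr // ltr_pMr // ltr1n.
move=> /(_ wr'); rewrite !fctE /= subrK Dg /g /= fw opprD addNKr normrN.
move=> le2; apply/eqP; rewrite -subr_eq0 -normr_le0.
by have := normr_ge0 (w - u); lra.
Qed.

Lemma compact_closed_ball u (r : R) : compact [set w : 'rV[R]_N | `|u - w| <= r].
Proof.
apply: bounded_closed_compact; last exact: closed_closed_ball_.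
exists (`|u| + r); split; first exact: num_real.
move=> M lt w /= wr; apply: le_trans (ltW lt).
by rewrite -[w](subKr u); apply: le_trans (ler_normB _ _) _; rewrite lerD2l.
Qed.

Lemma compact_sphere u (r : R) : compact [set w : 'rV[R]_N | `|u - w| = r].
Proof.
have : closed [set w : 'rV[R]_N | `|u - w| = r]; last first.
  by move=> cl; refine (@subclosed_compact _ _ _ cl (@compact_closed_ball u r) _) => w /= ->.
rewrite -/((@Num.norm R _ \o (fun y : 'rV[R]_N => u - y)) @^-1` [set x : R | x = r]).
apply: (preimage_closed _ (@closed_eq _ _)) => y _.
apply: (continuous_comp _ (@norm_continuous _ _ _)).
exact: (continuousB (@cst_continuous _ _ _ _)).
Qed.

(* At an interior minimum [w] of the distance from [f w] to [y] on a closed ball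
   the differential annihilates [f w - y], hence [f w = y]. *)
Lemma open_mapping (O : set 'rV[R]_N) f : open O ->
  (forall w, O w -> differentiable f w) -> (forall w, O w -> 'J f w \in unitmx) ->
  forall u, O u -> nbhs (f u) (f @` O).
Proof.
move=> Oo df Ju u Ou.
have [r0 r00 inj] := local_injective (df u Ou) (Ju u Ou).
have [r1 /= r10 Or] := (nbhs_normP _ _).1 (open_nbhs_nbhs (conj Oo Ou)).
pose r := Num.min r0 (r1 / 2).
have r_gt0 : 0 < r by rewrite lt_min r00 divr_gt0.
have BO w : `|u - w| <= r -> O w.
  rewrite le_min => /andP[_ wr]; apply: Or => /=; apply: le_lt_trans wr _.
  by rewrite ltr_pdivrMr // ltr_pMr // ltr1n.
have phic y w : O w -> {for w, continuous (fun w => dist2 y (f w) : R^o)}.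
  by move=> Ow; apply: differentiable_continuous; have [] := is_derive_dist2 y 0 (df w Ow).
pose B := [set w : 'rV[R]_N | `|u - w| <= r].
have [mu mu0 muP] : exists2 mu, 0 < mu & forall w, `|u - w| = r -> mu <= dist2 (f u) (f w).
  (* The sphere is empty in dimension 0, and then any positive [mu] will do. *)
  have [S0|/set0P/negP/negPn/eqP S0] := pselect ([set w : 'rV[R]_N | `|u - w| = r] !=set0); last first.
    exists 1 => // w wr; suff : [set w : 'rV[R]_N | `|u - w| = r] w by rewrite S0.
    exact: wr.
  have [|w wS wmin] := @EVT_min_rV R N (fun w => dist2 (f u) (f w)) _ S0 (@compact_sphere u r).
    apply: continuous_in_subspaceT => w; rewrite inE => /= wr; apply: phic; apply: BO.
    by rewrite wr.
  exists (dist2 (f u) (f w)); last by move=> z zr; apply: wmin; rewrite inE.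
  rewrite lt_neqAle dist2_ge0 andbT eq_sym; apply/eqP => /dist2_eq0 fw.
  move: wS; rewrite inE => /= wr; have wu : w = u.
    by apply: inj => //; rewrite distrC wr ge_min lexx.
  by move: r_gt0; rewrite -wr wu subrr normr0 ltxx.
(* The constant 4 excludes minima on the sphere: there [dist2_triangle] would bound [mu] by four
   times [dist2 (f u) y]. *)
have near_y : \forall y \near f u, dist2 (f u) y < mu / 4.
  have : {for f u, continuous (fun y => dist2 (f u) y : R^o)}.
    by apply: differentiable_continuous; have [] := @is_derive_dist2 _ id (f u) (f u) 0 _.
  move=> /cvgr_lt; apply.
  by rewrite /dist2 big1 ?divr_gt0 // => j _; rewrite subrr expr0n.
near=> y.
have yE : dist2 (f u) y < mu / 4 by near: y.
have Bu : B !=set0 by exists u; rewrite /B /= subrr normr0 ltW.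
have [|w] := @EVT_min_rV R N (fun w => dist2 y (f w)) _ Bu (@compact_closed_ball u r).
  by apply: continuous_in_subspaceT => w; rewrite inE => /= wr; apply: phic; exact: BO.
rewrite inE => /= wr wmin.
have w_lt : `|u - w| < r.
  rewrite lt_neqAle wr andbT; apply/eqP => we.
  have h1 := muP w we; have h2 : dist2 y (f w) <= dist2 y (f u).
    by apply: wmin; rewrite inE /B /= subrr normr0 ltW.
  have h3 : dist2 y (f u) = dist2 (f u) y.
    by apply: eq_bigr => j _; rewrite -sqrrN opprB.
  have h4 := dist2_triangle (f u) (f w) y.
  lra.
have Ow : O w by apply: BO; exact: ltW.
have D0 v : 'D_v (fun w => dist2 y (f w) : R^o) w = 0.
  pose g (t : R) : R^o := dist2 y (f (w + t *: v)).
  have dph : differentiable (fun w => dist2 y (f w) : R^o) (w + 0 *: v).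
    by rewrite scale0r addr0; have [] := is_derive_dist2 y v (df w Ow).
  have gD : is_derive (0 : R) (1 : R) g ('D_v (fun w => dist2 y (f w) : R^o) w).
    by have := derive_line dph; rewrite scale0r addr0.
  pose e := (r - `|u - w|) / (`|v| + 1).
  have v1 : 0 < `|v| + 1 by rewrite ltr_wpDl.
  have e0 : 0 < e by rewrite divr_gt0 // subr_gt0.
  have gin (t : R) : t \in `]- e, e[%R -> `|u - (w + t *: v)| <= r.
    rewrite in_itv /= -ltr_norml => te; rewrite opprD addrA.
    apply: le_trans (ler_normB _ _) _; rewrite normrZ -lerBrDl.
    apply: (@le_trans _ _ (e * (`|v| + 1))); last by rewrite divfK // gt_eqF.
    by apply: ler_pM => //; [exact: ltW | rewrite lerDl].
  have g0 : is_derive (0 : R) (1 : R) g (0 : R^o).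
    apply: (@derive1_at_min R g (- e) e 0); first by rewrite ge0_cp // ltW.
    - move=> t /gin /BO Ot; have [dp _] := is_derive_dist2 y v (df _ Ot).
      by have [] := derive_line dp.
    - by rewrite in_itv /= oppr_lt0 e0.
    by move=> t /gin tr; rewrite /g scale0r addr0; apply: wmin; rewrite inE.
  by rewrite -(@derive_val _ _ _ _ _ _ _ gD) (@derive_val _ _ _ _ _ _ _ g0).
exists w => //; apply/rowP => j; apply/eqP; rewrite -subr_eq0; apply/eqP.
pose a : 'rV[R]_N := f w - y.
have : 'J f w *m a^T = 0.
  apply/colP => i; have := D0 (delta_mx 0 i).
  have [_ ->] := is_derive_dist2 y (delta_mx 0 i) (df w Ow) => /eqP.
  rewrite mulf_eq0 pnatr_eq0 /= => /eqP e; rewrite mxE [RHS]mxE -[RHS]e.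
  apply: eq_bigr => l _; rewrite !mxE mulrC; congr (_ * _).
  by rewrite deriveE //; exact: df.
move=> /(congr1 (mulmx (invmx ('J f w)))); rewrite mulKmx ?Ju // mulmx0.
by move=> /colP/(_ j); rewrite !mxE.
Unshelve. all: by end_near.
Qed.

End OpenMapping.

(** * Openness of the image in the Calabi composition *)

Section CalabiImage.
Variables (R : realType) (n : nat).
Hypothesis n0 : (0 < n)%N.

Let tl (y : 'rV[R]_n.+1) : 'rV[R]_n := @rsubmx R 1 1 n y.

(** The equation determines the square of the first coordinate from the others, and the sign
    condition removes the ambiguity. *)
Lemma calabi_composition_fiber (y z : 'rV[R]_n.+1) :
  calabi_composition R n y -> calabi_composition R n z -> tl y = tl z ->
  0 < y 0 ord0 * z 0 ord0 -> y = z.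
Proof.
rewrite /calabi_composition /= => ySt zSt yz pos.
have co j : j != ord0 -> y 0 j = z 0 j.
  case: (split_ordP (j : 'I_(1 + n))) => i ->; last by have /rowP/(_ i) := yz; rewrite !mxE.
  by rewrite ord1 => /eqP []; exact: val_inj.
have mx : ord_max != ord0 :> 'I_n.+1 by rewrite -val_eqE /= -lt0n.
have e : (y 0 ord_max ^+ 2 - \sum_(i < n.+1 | (0 < i < n)%N) y 0 i ^+ 2) ^+ n =
    (z 0 ord_max ^+ 2 - \sum_(i < n.+1 | (0 < i < n)%N) z 0 i ^+ 2) ^+ n.
  rewrite co //; congr ((_ - _) ^+ _); apply: eq_bigr => i /andP[i0 _].
  by rewrite co // -val_eqE /= -lt0n.
rewrite e in ySt; set q := (_ ^+ n) in ySt zSt.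
have q0 : q != 0 by apply/eqP => q0; move: zSt; rewrite q0 mulr0 => /esym/eqP; rewrite oner_eq0.
have /(mulIf q0) sq : y 0 ord0 ^+ 2 * q = z 0 ord0 ^+ 2 * q by rewrite ySt zSt.
have e0 : y 0 ord0 = z 0 ord0.
  move/eqP: sq; rewrite eqf_sqr => /orP[/eqP //|/eqP yz0].
  by move: pos; rewrite yz0 mulNr oppr_gt0 -expr2 ltNge sqr_ge0.
apply/rowP => j; case: (eqVneq j ord0) => [->|/co] //.
Qed.

(** Forgetting the first coordinate gives a map [f] between spaces of equal dimension. Its Jacobian
    is invertible because the forgotten direction is not tangent, so [f] is open, and a point of the
    composition over its image is recovered up to the sign of [x_1]. *)
Lemma calabi_image (O : set 'rV[R]_n) (Z : 'rV[R]_n -> 'rV[R]_n.+1) : open O ->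
  (forall w, O w -> differentiable Z w) -> (forall w, O w -> row_free ('J Z w)) ->
  (forall w, O w -> ~~ ((delta_mx 0 ord0 : 'rV[R]_n.+1) <= 'J Z w)%MS) ->
  (forall w, O w -> calabi_composition R n (Z w)) ->
  forall w, O w -> exists O1 Ot, [/\ open O1, O1 w, O1 `<=` O, open Ot
    & Z @` O1 = calabi_composition R n `&` Ot].
Proof.
move=> Oo dZ rf tr calZ w0 Ow0.
pose f := tl \o Z.
have dtl y : differentiable tl y by exact: (@differentiable_rsubmx R 1 1 n y).
have df w : O w -> differentiable f w by move=> Ow; apply: differentiable_comp => //; exact: dZ.
have JfE w v : O w -> v *m 'J f w = tl (v *m 'J Z w).
  move=> Ow; rewrite -(deriveEjacobian v (df w Ow)) -(deriveEjacobian v (dZ w Ow)).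
  apply/rowP => j; rewrite derive_mx; last exact/diff_derivable/df.
  rewrite [RHS]mxE derive_mx; last exact/diff_derivable/dZ.
  by rewrite mxE [RHS]mxE; congr ('D_v _ w); apply/funext => y; rewrite mxE.
have Ju w : O w -> 'J f w \in unitmx.
  move=> Ow; rewrite -row_free_unit; apply: inj_row_free => v; rewrite JfE // => v0.
  have vE : v *m 'J Z w = (v *m 'J Z w) 0 ord0 *: delta_mx 0 ord0.
    apply/rowP => j; rewrite [RHS]mxE; case: (split_ordP (j : 'I_(1 + n))) => i ->.
      have -> : lshift n i = ord0 by apply: val_inj; rewrite ord1.
      by rewrite [delta_mx _ _ _ _]mxE !eqxx mulr1.
    have /rowP/(_ i) := v0; rewrite !mxE => ->.
    by rewrite [_ == ord0]eq_sym /= mulr0.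
  have a0 : (v *m 'J Z w) 0 ord0 = 0.
    apply/eqP; apply: contraT => a0; have /negP := tr w Ow; case.
    rewrite -[delta_mx _ _](scalerK a0) -vE; apply: scalemx_sub; exact: submxMl.
  by apply: (row_free_inj (rf w Ow)); rewrite mul0mx vE a0 scale0r.
pose s := Z w0 0 ord0.
have cs (y : 'rV[R]_n.+1) : {for y, continuous (fun y : 'rV[R]_n.+1 => y 0 ord0 * s : R^o)}.
  apply: (@continuousM _ _ (fun y : 'rV[R]_n.+1 => y 0 ord0 : R^o) (cst s)).
    exact: coord_continuous.
  exact: cst_continuous.
have cZ w : O w -> {for w, continuous (fun w => Z w 0 ord0 * s : R^o)}.
  move=> Ow; apply: (@continuous_comp _ _ _ Z (fun y : 'rV[R]_n.+1 => y 0 ord0 * s : R^o)).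
    exact/differentiable_continuous/dZ.
  exact: cs.
(* The first coordinate never vanishes on the composition; [O1] keeps the points where it has the
   same sign as at [w0]. *)
pose O1 := [set w | O w /\ 0 < Z w 0 ord0 * s].
have O1o : open O1.
  rewrite openE => w [Ow pw]; apply: filterI; first exact: open_nbhs_nbhs.
  by have := cZ w Ow; move=> /cvgr_gt; apply.
have Vo : open (f @` O1).
  rewrite openE => _ [w [Ow pw] <-].
  apply: (open_mapping O1o) => //; first by move=> y [Oy _]; exact: df.
  by move=> y [Oy _]; exact: Ju.
have Z0 w : O w -> Z w 0 ord0 != 0.
  move=> /calZ; rewrite /calabi_composition /=; case: eqP => // ->.
  by rewrite expr0n /= mul0r => /esym/eqP; rewrite oner_eq0.
exists O1, ([set y : 'rV[R]_n.+1 | 0 < y 0 ord0 * s] `&` tl @^-1` (f @` O1)); split => //.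
- by split=> //; rewrite -expr2 exprn_even_gt0 //= Z0.
- by move=> w [].
- apply: openI.
    rewrite openE => y /= py; have := cs y; move=> /cvgr_gt; apply.
    exact: py.
  apply: open_comp => // y _; exact/differentiable_continuous/dtl.
apply/seteqP; split=> [_ [w [Ow pw] <-]|y [ySt [py [w [Ow pw] fw]]]].
  split; [exact: calZ | split=> //; by exists w].
exists w => //; apply/esym/calabi_composition_fiber => //; first exact: calZ.
have : 0 < (y 0 ord0 * s) * (Z w 0 ord0 * s) by exact: mulr_gt0.
rewrite [X in 0 < X](_ : _ = y 0 ord0 * Z w 0 ord0 * s ^+ 2); last by ring.
by rewrite pmulr_lgt0 // exprn_even_gt0 //= Z0.
Qed.

End CalabiImage.

(** * Change of parametrization *)

Section Reparametrization.
Variables (R : realType).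

Lemma derive_near (V W : normedModType R) (U : set V) (f g : V -> W) u v : open U -> U u ->
  (forall y, U y -> f y = g y) -> 'D_v f u = 'D_v g u.
Proof.
move=> Uo Uu fg; apply: near_eq_derive; near=> y; apply: fg; near: y.
exact: (open_nbhs_nbhs (conj Uo Uu)).
Unshelve. all: by end_near.
Qed.

Lemma derive_entry (V : normedModType R) k (f : V -> 'rV[R]_k) u v j : differentiable f u ->
  'D_v (fun y => f y 0 j : R^o) u = ('D_v f u) 0 j.
Proof. by move=> df; rewrite derive_mx ?mxE //; exact: diff_derivable. Qed.

Lemma differentiable_entry (V : normedModType R) k (f : V -> 'rV[R]_k) u j :
  differentiable f u -> differentiable (fun y => f y 0 j : R^o) u.
Proof.
move=> df; apply: (@differentiable_comp _ _ _ _ f (fun M : 'rV[R]_k => M 0 j : R^o)) => //.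
exact: differentiable_coord.
Qed.

Variables (n k : nat).
Implicit Types (psi : 'rV[R]_n -> 'rV[R]_n).

Lemma jacobian_comp p m (psi : 'rV[R]_p -> 'rV[R]_n) (X : 'rV[R]_n -> 'rV[R]_m) w :
  differentiable psi w -> differentiable X (psi w) ->
  'J (X \o psi) w = 'J psi w *m 'J X (psi w).
Proof.
move=> dp dX; apply/row_matrixP => i; rewrite row_mul.
have dXp : differentiable (X \o psi) w by exact: differentiable_comp.
apply: (etrans (row_jacobian i dXp)); rewrite (row_jacobian i dp) -(deriveEjacobian _ dX).
by rewrite deriveE // diff_comp //= (deriveE _ dX) (deriveE _ dp).
Qed.

Lemma second_derive_comp (W C : set 'rV[R]_n) psi (X : 'rV[R]_n -> 'rV[R]_k) v v' w :
  open W -> open C -> (forall y, W y -> C (psi y)) -> smooth_on W psi -> smooth_on C X -> W w ->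
  'D_v (fun y => 'D_v' (X \o psi) y) w =
    \sum_i ('D_v (fun y => 'D_v' psi y) w) 0 i *: 'D_(delta_mx 0 i) X (psi w) +
    \sum_i \sum_l (('D_v' psi w) 0 i * ('D_v psi w) 0 l) *:
      'D_(delta_mx 0 l) (fun y => 'D_(delta_mx 0 i) X y) (psi w).
Proof.
move=> Wo Co WC sp sX Ww.
have dp y : W y -> differentiable psi y by exact: smooth_differentiable.
have dX y : W y -> differentiable X (psi y) by move=> Wy; apply: (smooth_differentiable sX); exact: WC.
have ddp : differentiable (fun y => 'D_v' psi y) w.
  exact: (smooth_differentiable (smooth_derive v' sp)).
have ddX i : differentiable (fun y => 'D_(delta_mx 0 i) X y) (psi w).
  by apply: (smooth_differentiable (smooth_derive _ sX)); exact: WC.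
pose g i (y : 'rV[R]_n) := 'D_(delta_mx 0 i) X (psi y).
have dg i : differentiable (g i) w.
  exact: (@differentiable_comp _ _ _ _ psi (fun y => 'D_(delta_mx 0 i) X y) w (dp w Ww) (ddX i)).
have Yv : forall y, W y -> 'D_v' (X \o psi) y = \sum_i ('D_v' psi y) 0 i *: g i y.
  by move=> y Wy; rewrite (derive_comp v' (dp y Wy) (dX y Wy)).
apply/rowP => c; rewrite -derive_entry; last first.
  exact: (smooth_differentiable (smooth_derive v' (smooth_comp_mx Wo Co WC sX sp))).
have Yvc y : W y -> ('D_v' (X \o psi) y) 0 c = (\sum_i ('D_v' psi y) 0 i *: g i y) 0 c.
  by move=> Wy; rewrite Yv.
rewrite (derive_near v Wo Ww Yvc).
pose a i : 'rV[R]_n -> R^o := fun y => ('D_v' psi y) 0 i.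
pose b i : 'rV[R]_n -> R^o := fun y => (g i y) 0 c.
have -> : (fun y => (\sum_i ('D_v' psi y) 0 i *: g i y) 0 c : R^o) = \sum_i (a i * b i).
  by apply/funext => y; rewrite fct_sumE summxE; apply: eq_bigr => i _; rewrite mxE.
have Da i : is_derive w v (a i) (('D_v (fun y => 'D_v' psi y) w) 0 i).
  apply: DeriveDef; last exact: derive_entry.
  exact/diff_derivable/differentiable_entry.
have Db i : is_derive w v (b i) (\sum_l ('D_v psi w) 0 l *
    ('D_(delta_mx 0 l) (fun y => 'D_(delta_mx 0 i) X y) (psi w)) 0 c).
  apply: DeriveDef; first exact/diff_derivable/differentiable_entry.
  rewrite derive_entry //.
  rewrite (@derive_comp _ _ _ _ psi (fun y => 'D_(delta_mx 0 i) X y) w v (dp w Ww) (ddX i)).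
  by rewrite summxE; apply: eq_bigr => l _; rewrite mxE.
rewrite (@derive_val _ _ _ _ _ _ _ (is_derive_sum (fun i => is_deriveM (Da i) (Db i)))).
rewrite mxE !summxE -big_split /=; apply: eq_bigr => i _.
rewrite mx_scaleE summxE [LHS]addrC; congr (_ + _).
  by rewrite -[LHS]/(b i w * _) mulrC.
rewrite -[LHS]/(a i w * _) mulr_sumr; apply: eq_bigr => l _.
by rewrite mx_scaleE mulrA.
Qed.

End Reparametrization.

Lemma bform_delta (R : realType) n (G : 'M[R]_n) i j :
  bform G (delta_mx 0 i) (delta_mx 0 j) = G i j.
Proof. by rewrite /bform -rowE trmx_delta -colE !mxE. Qed.

Lemma bform_sum (R : realType) n (G : 'M[R]_n) (v w : 'rV[R]_n) :
  bform G v w = \sum_i \sum_l (w 0 i * v 0 l) * G l i.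
Proof.
rewrite /bform mxE; apply: eq_bigr => i _; rewrite mxE [w^T _ _]mxE mulr_suml.
by apply: eq_bigr => l _; ring.
Qed.

Section TransferAffineNormal.
Variables (R : realType) (n : nat) (W C : set 'rV[R]_n) (psi : 'rV[R]_n -> 'rV[R]_n).
Variables (X Xi : 'rV[R]_n -> 'rV[R]_n.+1) (h : 'rV[R]_n -> 'M[R]_n).
Hypothesis Wo : open W.
Hypothesis Co : open C.
Hypothesis WC : forall y, W y -> C (psi y).
Hypothesis psi_smooth : smooth_on W psi.
Hypothesis X_smooth : smooth_on C X.
Hypothesis Xi_smooth : smooth_on C Xi.
Hypothesis psi_unit : forall w, W w -> 'J psi w \in unitmx.

Let dp w : W w -> differentiable psi w.
Proof. exact: smooth_differentiable. Qed.
Let dX w : W w -> differentiable X (psi w).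
Proof. by move=> Ww; apply: (smooth_differentiable X_smooth); exact: WC. Qed.
Let dXi w : W w -> differentiable Xi (psi w).
Proof. by move=> Ww; apply: (smooth_differentiable Xi_smooth); exact: WC. Qed.

Lemma transfer_jacobian w : W w -> ('J (X \o psi) w :=: 'J X (psi w))%MS.
Proof.
move=> Ww; rewrite jacobian_comp; [|exact: dp|exact: dX].
by apply: eqmxMfull; rewrite row_full_unit psi_unit.
Qed.

(** In the second-order chain rule the second derivatives of [psi] only multiply tangent vectors,
    and the remaining terms are the original Gauss formula on the transformed arguments. *)
Lemma transfer_gauss w v v' :
  (forall u v v', C u ->
     ('D_v (fun y => 'D_v' X y) u - bform (h u) v v' *: Xi u <= 'J X u)%MS) ->
  W w -> ('D_v (fun y => 'D_v' (X \o psi) y) w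
    - bform ('J psi w *m h (psi w) *m ('J psi w)^T) v v' *: Xi (psi w) <= 'J (X \o psi) w)%MS.
Proof.
move=> gaussX Ww; rewrite transfer_jacobian //.
rewrite (second_derive_comp v v' Wo Co WC psi_smooth X_smooth Ww).
have -> : bform ('J psi w *m h (psi w) *m ('J psi w)^T) v v' =
    bform (h (psi w)) ('D_v psi w) ('D_v' psi w).
  by rewrite !(deriveEjacobian _ (dp Ww)) /bform trmx_mul !mulmxA.
rewrite bform_sum -addrA addmx_sub //.
  apply: summx_sub => i _; apply: scalemx_sub.
  by rewrite (deriveEjacobian _ (dX Ww)) submxMl.
rewrite scaler_suml -sumrB; apply: summx_sub => i _.
rewrite scaler_suml -sumrB; apply: summx_sub => l _.
rewrite -[X in (_ - X <= _)%MS]scalerA -scalerBr; apply: scalemx_sub.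
by rewrite -bform_delta; apply: gaussX; exact: WC.
Qed.

Lemma transfer_shape w v : (forall u v, C u -> ('D_v Xi u <= 'J X u)%MS) -> W w ->
  ('D_v (Xi \o psi) w <= 'J (X \o psi) w)%MS.
Proof.
move=> sh Ww; rewrite transfer_jacobian // (derive_comp v (dp Ww) (dXi Ww)).
by apply: summx_sub => i _; apply: scalemx_sub; apply: sh; exact: WC.
Qed.

(** Both sides acquire the factor [|\det ('J psi w)|]. *)
Lemma transfer_volume w : W w ->
  `|\det (col_mx (Xi (psi w)) ('J X (psi w)) : 'M[R]_n.+1)| = Num.sqrt `|\det (h (psi w))| ->
  `|\det (col_mx (Xi (psi w)) ('J (X \o psi) w) : 'M[R]_n.+1)|
    = Num.sqrt `|\det ('J psi w *m h (psi w) *m ('J psi w)^T)|.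
Proof.
move=> Ww vol; rewrite jacobian_comp; [|exact: dp|exact: dX].
pose E : 'M[R]_(1 + n) := col_mx (Xi (psi w)) ('J X (psi w)).
have dE : \det (col_mx (Xi (psi w)) ('J psi w *m 'J X (psi w)) : 'M[R]_(1 + n)) =
    \det ('J psi w) * \det E.
  rewrite -[X in X * _]mul1r -(det1 R 1) -(det_ublock 1%:M 0) -det_mulmx.
  by rewrite mul_block_col !mul0mx mul1mx addr0 add0r.
transitivity `|\det ('J psi w) * \det E|; first by rewrite -dE.
rewrite normrM [X in _ * X]vol !det_mulmx det_tr.
rewrite mulrAC -expr2 normrM sqrtrM // normrX sqrtr_sqr normr_id.
by [].
Qed.

End TransferAffineNormal.

(** * Charts *)

Section Charts.
Variables (R : realType).

Lemma chart_image_open n (M : charted_space R n) (i : cidx M) (D : set M) :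
  open (cimg i) -> (forall p, cdom i p -> cinv i (cmap i p) = p) ->
  (forall u, cimg i u -> {for u, continuous (cinv i)}) ->
  open D -> D `<=` cdom i -> open (cmap i @` D).
Proof.
move=> Io cK cc Do Di; rewrite openE => _ [q Dq <-].
have iq : cimg i (cmap i q) by exists q => //; exact: Di.
have nD : nbhs (cmap i q) (cinv i @^-1` D).
  have nq : nbhs (cinv i (cmap i q)) D.
    by rewrite cK; [exact: open_nbhs_nbhs | exact: Di].
  exact: (cc _ iq) nq.
have nI : nbhs (cmap i q) (cimg i) by exact: open_nbhs_nbhs.
apply: filterS (filterI nI nD) => y [[q' Dq' <-]]; rewrite /= cK // => Dq''.
by exists q'.
Qed.

Section Product.
Variables (m : nat) (N : charted_space R m).
Hypothesis Nm : smooth_manifold N.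
Let P := product_space (real_line R) N.
Variable j : cidx P.

Lemma product_cdom_open : open (cdom j).
Proof.
have [_ _ _ charts _] := Nm; have [op _ _ _ _] := charts j.2.
rewrite openE => q [_ /= jq]; exists (setT, cdom j.2) => //=.
by split; [exact: filterT | exact: open_nbhs_nbhs].
Qed.

Lemma product_cimgE : cimg j = [set u | cimg j.2 (rsubmx u)].
Proof.
apply/seteqP; split=> u /=.
  by move=> [q [_ jq] <-] /=; rewrite row_mxKr; exists q.2.
move=> [q jq qu]; exists ((lsubmx u) 0 0, q) => //=.
rewrite qu -[RHS]hsubmxK; congr row_mx.
by apply/matrixP => a b; rewrite !ord1 mxE.
Qed.

Lemma product_cimg_open : open (cimg j).
Proof.
have [_ _ _ charts _] := Nm; have [_ op _ _ _] := charts j.2.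
rewrite product_cimgE; apply: (@open_comp _ _ rsubmx) => // u _.
exact/differentiable_continuous/differentiable_rsubmx.
Qed.

Lemma product_cmapK q : cdom j q -> cinv j (cmap j q) = q.
Proof.
have [_ _ _ charts _] := Nm; have [_ _ cK _ _] := charts j.2.
move=> [_ /= jq]; case: q jq => a b jb.
by rewrite /= row_mxKl row_mxKr cK // mxE.
Qed.

Lemma product_cinv_continuous u : cimg j u -> {for u, continuous (cinv j)}.
Proof.
have [_ _ _ charts _] := Nm; have [_ _ _ _ cc] := charts j.2.
rewrite product_cimgE => /= ju.
have c1 : {for u, continuous (fun y : 'rV[R]_(1 + m) => lsubmx y 0 0 : R)}.
  apply: (@continuous_comp _ _ _ lsubmx (fun y : 'rV[R]_1 => y 0 0)).
    exact/differentiable_continuous/differentiable_lsubmx.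
  exact: coord_continuous.
have c2 : {for u, continuous (fun y : 'rV[R]_(1 + m) => cinv j.2 (rsubmx y))}.
  apply: (@continuous_comp _ _ _ rsubmx (cinv j.2)).
    exact/differentiable_continuous/differentiable_rsubmx.
  exact: cc.
exact: (cvg_pair c1 c2).
Qed.

End Product.

Lemma ball_convex n (w u v : 'rV[R]_n) (r t : R) : ball w r u -> ball w r v -> 0 <= t <= 1 ->
  ball w r (u + t *: (v - u)).
Proof.
rewrite -!ball_normE /= => ur vr /andP[t0 t1].
have -> : w - (u + t *: (v - u)) = (1 - t) *: (w - u) + t *: (w - v).
  by apply/rowP => j; rewrite !mxE; ring.
apply: le_lt_trans (ler_normD _ _) _; rewrite !normrZ !ger0_norm ?subr_ge0 //.
have [->|tn0] := eqVneq t 0; first by rewrite subr0 mul1r mul0r addr0.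
have tp : 0 < t by rewrite lt_neqAle eq_sym tn0.
rewrite -[ltRHS](_ : (1 - t) * r + t * r = r); last by ring.
apply: ler_ltD; last by rewrite ltr_pM2l.
by rewrite ler_wpM2l ?subr_ge0 // ltW.
Qed.

Definition ball_domain n (w : 'rV[R]_n) (r : R) (r0 : 0 < r) : domain R n :=
  @Domain R n (ball w r) w (ball_open w r) (ballxx w r0) (fun u v t => @ball_convex n w u v r t).

Lemma ball_rsubmx m1 m2 (w u : 'rV[R]_(m1 + m2)) (r : R) :
  ball w r u -> ball (rsubmx w) r (rsubmx u).
Proof. by move=> [r0 b]; split=> // i j; rewrite !mxE; exact: b. Qed.

Lemma ball_row_mx m1 m2 (w : 'rV[R]_(m1 + m2)) u (r : R) : 0 < r ->
  ball (rsubmx w) r u -> ball w r (row_mx (lsubmx w) u).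
Proof.
move=> r0 [_ b]; split=> // i j; case: (split_ordP j) => k ->; last first.
  by rewrite row_mxEr; have := b i k; rewrite mxE.
by rewrite row_mxEl mxE; exact: ballxx.
Qed.

End Charts.

Lemma congruence_cancel (R : comNzRingType) n (A B G : 'M[R]_n) : A *m B = 1%:M ->
  A *m (B *m G *m B^T) *m A^T = G.
Proof.
move=> AB; rewrite !mulmxA AB mul1mx -mulmxA -trmx_mul AB trmx1 mulmx1.
by [].
Qed.

Lemma affine_image_jacobian (R : realType) n k l (Y : 'rV[R]_n -> 'rV[R]_k) (A : 'M[R]_(k, l)) b w :
  differentiable Y w -> differentiable (fun y => Y y *m A + b) w /\
  'J (fun y => Y y *m A + b) w = 'J Y w *m A.
Proof.
move=> dY; pose L : 'rV[R]_k -> 'rV[R]_l := mulmxr A.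
have dL y : differentiable L y by exact: differentiable_mulmxr.
have dLY : differentiable (L \o Y) w by exact: differentiable_comp.
have dZ : differentiable ((L \o Y) + cst b) w by apply: differentiableD.
split; first exact: dZ.
rewrite -[X in 'J X w]/((L \o Y) + cst b); apply/row_matrixP => i.
apply: (etrans (row_jacobian i dZ)).
rewrite deriveD; [|exact: diff_derivable|exact: derivable_cst].
rewrite derive_cst addr0 -(row_jacobian i dLY) jacobian_comp // !row_mul; congr (_ *m _).
apply/row_matrixP => a; apply: (etrans (row_jacobian a (dL (Y w)))).
have Lc : continuous L by move=> y; exact/differentiable_continuous/dL.
rewrite deriveE //; apply: (etrans (congr1 (fun f => f (delta_mx 0 a)) (diff_lin (Y w) Lc))).
by rewrite /= -rowE.
Qed.

Lemma hypersphere_locally_calabi (R : realType) (m : nat) (M : charted_space R m.+1)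
    (x xi : M -> 'rV[R]_m.+2) (h : metric M) (I : set R) (N : charted_space R m)
    (g : metric N) (c : R) (p : M) :
  (1 < m)%N -> smooth_manifold M -> immersed_hypersurface x -> affine_normal x xi h ->
  affine_hypersphere x xi -> smooth_manifold N -> riemannian_metric g ->
  constant_sectional_curvature g c -> c != 0 ->
  locally_isometric_to_interval_product h I g ->
  c < 0 /\ exists (U : set M) (A : 'M[R]_m.+2) (b : 'rV[R]_m.+2) (O : set 'rV[R]_m.+2),
    [/\ open U /\ U p, A \in unitmx, open O
      & (fun q => x q *m A + b) @` U = calabi_composition R m.+1 `&` O].
Proof.
move=> m1 Mm [xs xrf] [xis an] sph Nm [gs gp _] gc c0 iso.
have [U [V [F [G [[Uo Up] [Vo _] [UF VG sF sG] pull]]]]] := iso p.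
pose P := product_space (real_line R) N.
have [_ _ Mcov Mch _] := Mm; have [i ip] := Mcov p.
have [_ _ Ncov _ _] := Nm; have [jN jNp] := Ncov (F p).2.
pose j : cidx P := (tt, jN).
have jp : cdom j (F p) by split.
have [io Iio iK icont icc] := Mch i.
(* The part of the product on which the local isometry [G] can be read in the two charts; [psi]
   below is this reading and [phi] that of its inverse [F]. *)
pose D : set P := cdom j `&` V `&` G @^-1` cdom i.
have Do : open D.
  rewrite openE => q [[jq Vq] iq]; apply: filterI; first apply: filterI.
  - by apply: open_nbhs_nbhs; split => //; exact: product_cdom_open.
  - exact: open_nbhs_nbhs.
  by apply: (sG.1 q Vq); exact: open_nbhs_nbhs.
pose W : set 'rV[R]_(1 + m) := cmap j @` D.
have Wo : open W.
  apply: (@chart_image_open _ _ P j) => //.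
  - exact: product_cimg_open.
  - by move=> q; exact: product_cmapK.
  - by move=> u; exact: product_cinv_continuous.
  by move=> q [[]].
pose psi : 'rV[R]_m.+1 -> 'rV[R]_m.+1 := in_charts j i G.
have psi_s : smooth_on (W : set 'rV[R]_m.+1) psi by exact: sG.2.
have Wq w : W w -> D (cinv j w) /\ cmap j (cinv j w) = w.
  by move=> [q Dq <-]; rewrite product_cmapK //; case: Dq => [[]].
have psiE w : psi w = cmap i (G (cinv j w)) by [].
have WC w : W w -> cimg i (psi w).
  by move=> /Wq [[_ iG] _]; exists (G (cinv j w)).
have cpsi w : W w -> cinv i (psi w) = G (cinv j w).
  by move=> /Wq [[_ iG] _]; rewrite psiE iK.
pose phi : 'rV[R]_m.+1 -> 'rV[R]_m.+1 := in_charts i j F.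
have FG w : W w -> U (G (cinv j w)) /\ F (G (cinv j w)) = cinv j w.
  by move=> /Wq [[[_ Vw] _] _]; exact: VG.
have phi_d w : W w -> differentiable phi (psi w).
  move=> Ww; apply: (smooth_differentiable (sF.2 i j)).
  have [[[jw _] iw] _] := Wq w Ww; have [Uw Fw] := FG w Ww.
  by exists (G (cinv j w)) => //; split; [split | rewrite /= Fw].
have phi_psi w : W w -> phi (psi w) = w.
  move=> Ww; have [_ Fw] := FG w Ww; have [_ cw] := Wq w Ww.
  by rewrite /phi /in_charts /= cpsi // Fw.
have psi_d w : W w -> differentiable psi w by exact: smooth_differentiable.
have JJ w : W w -> 'J psi w *m 'J phi (psi w) = 1%:M.
  move=> Ww; rewrite -jacobian_comp; [|exact: psi_d|exact: phi_d].
  apply/row_matrixP => a; rewrite row_jacobian; last first.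
    by apply: differentiable_comp; [exact: psi_d | exact: phi_d].
  rewrite (derive_near _ Wo Ww (g := id)); last exact: phi_psi.
  by rewrite derive_id rowE mulmx1.
have psi_u (w : 'rV[R]_m.+1) : W w -> 'J psi w \in unitmx.
  move=> Ww.
  have JJw := JJ w Ww.
  exact: (mulmx1_unit JJw).1.
(* The isometry condition is stated for [F]; as the Jacobians of [psi] and [phi] are inverse to each
   other, it can be solved for the metric pulled back by [psi]. *)
have metricE (w : 'rV[R]_(1 + m)) : W w -> 'J psi w *m h i (psi w) *m ('J psi w)^T =
    (block_mx 1 0 0 (g jN (rsubmx w)) : 'M[R]_(1 + m)).
  move=> Ww; have [[[jw _] iw] cw] := Wq w Ww; have [Uw Fw] := FG w Ww.
  have jF : cdom j (F (G (cinv j w))) by rewrite Fw.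
  have hE : h i (psi w) =
      'J phi (psi w) *m product_metric (@euclidean_metric R) g j w *m ('J phi (psi w))^T.
    by have := pull i j (G (cinv j w)) Uw iw jF; cbv zeta; rewrite Fw cw.
  rewrite hE; exact: (congruence_cancel _ (JJ w Ww)).
pose X := x \o cinv i; pose Xi := xi \o cinv i.
pose Y : 'rV[R]_m.+1 -> 'rV[R]_m.+2 := X \o psi.
pose Z : 'rV[R]_m.+1 -> 'rV[R]_m.+2 := Xi \o psi.
have Y_s : smooth_on (W : set 'rV[R]_m.+1) Y by exact: (smooth_comp_mx Wo Iio WC).
have Z_s : smooth_on (W : set 'rV[R]_m.+1) Z by exact: (smooth_comp_mx Wo Iio WC).
have JY w : W w -> ('J Y w :=: 'J X (psi w))%MS.
  by move=> Ww; apply: (transfer_jacobian WC psi_s (xs i) psi_u Ww).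
have Y_rf w : W w -> row_free ('J Y w).
  by move=> Ww; rewrite /row_free JY //; apply: xrf; exact: WC.
have Z_tr w : W w -> ~~ (Z w <= 'J Y w)%MS.
  by move=> Ww; rewrite JY //; have [] := an i _ (WC w Ww).
have Z_tg w v : W w -> ('D_v Z w <= 'J Y w)%MS.
  move=> Ww; apply: (transfer_shape WC psi_s (xs i) (xis i) psi_u) => // u v' iu.
  by have [_ _ _ + _] := an i u iu; exact.
have Ww0 : W (cmap j (F p)).
  by exists (F p) => //; have [Vp Gp] := UF p Up; split; [split | rewrite /= Gp].
set w0 := cmap j (F p) in Ww0.
(* Balls of the maximum norm are products, so this ball is a convex domain that projects to the ball
   [O'] of the same radius in the second factor. *)
have [r /= r0 rW] := (nbhs_ballP _ _).1 (open_nbhs_nbhs (conj Wo Ww0)).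
pose O : domain R (1 + m) := ball_domain w0 r0.
pose O' : domain R m := ball_domain (rsubmx w0) r0.
have OW w : O w -> W w by exact: rW.
have OO' w : O w -> O' (rsubmx w) by exact: ball_rsubmx.
have O'N u : O' u -> cimg jN u.
  move=> Ou; have : W (row_mx (lsubmx w0) u) by apply: rW; exact: ball_row_mx.
  by move=> [q [[[_ jq] _] _] qE]; exists q.2 => //; rewrite -[u](row_mxKr (lsubmx w0)) -qE row_mxKr.
have Y_sO := smooth_subset OW Y_s; have Z_sO := smooth_subset OW Z_s.
have [H HE] : exists H, forall w v, O w -> 'D_v Z w = - H *: 'D_v Y w.
  have trO w (Ow : O w) := Z_tr w (OW w Ow).
  have tgO w v (Ow : O w) := Z_tg w v (OW w Ow).
  have rfO w (Ow : O w) := Y_rf w (OW w Ow).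
  case: sph => [[ctr ctrE]|par].
    by apply: (proper_shape Y_sO Z_sO trO tgO isT rfO) => w _; exact: ctrE.
  by apply: (improper_shape Y_sO Z_sO trO tgO) => w w' _ _; exact: par.
have [cneg [A [b [Au AO]]]] : c < 0 /\
  exists (A : 'M[R]_m.+2) (b : 'rV[R]_m.+2), A \in unitmx /\
    forall w, O w -> calabi_composition R m.+1 (Y w *m A + b) /\
      ~~ ((delta_mx 0 ord0 : 'rV[R]_m.+2) *m invmx A <= 'J Y w)%MS.
  apply: (local_calabi_composition OO' m1 (g := g jN) _ _ c0 _ Y_sO Z_sO _ _ HE).
  - by apply: smooth_subset (gs jN); exact: O'N.
  - by move=> u /O'N; exact: gp.
  - by move=> u v v' /O'N; exact: gc.
  - move=> w v v' /OW Ww; rewrite -metricE //.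
    have gX u a a' (iu : cimg i u) :
      ('D_a (fun y => 'D_a' X y) u - bform (h i u) a a' *: Xi u <= 'J X u)%MS.
      by have [_ _ + _ _] := an i u iu; exact.
    exact: (transfer_gauss Wo Iio WC psi_s (xs i) psi_u v v' gX Ww).
  move=> w /OW Ww; rewrite -metricE //.
  apply: (transfer_volume WC psi_s (xs i) Ww).
  by have [] := an i _ (WC w Ww).
split=> //.
pose T w := Y w *m A + b.
have TJ w : O w -> differentiable T w /\ 'J T w = 'J Y w *m A.
  move=> Ow; apply: affine_image_jacobian; exact: (smooth_differentiable Y_sO).
have Oo : open (O : set 'rV[R]_m.+1) := @dset_open _ _ O.
have [| | | |O1 [Ot [open1 O1w O1O Oto O1E]]] :=
    @calabi_image R m.+1 isT O T Oo _ _ _ _ w0 (dset_pt O).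
- by move=> w /TJ [].
- move=> w Ow; have [_ ->] := TJ w Ow.
  by rewrite /row_free mxrankMfree ?row_free_unit //; apply: Y_rf; exact: OW.
- move=> w Ow; have [_ ->] := TJ w Ow; have [_] := AO w Ow; apply: contra.
  by move=> /submxP [s sE]; apply/submxP; exists s; rewrite sE mulmxA mulmxK.
- by move=> w Ow; have [] := AO w Ow.
(* The region [O1] of product coordinates carried back to [M], where it is an open neighbourhood of
   [p]. *)
pose U' := [set q | [/\ U q, cdom i q, cdom j (F q) & O1 (phi (cmap i q))]].
have phiE q : cdom i q -> phi (cmap i q) = cmap j (F q).
  by move=> iq; rewrite /phi /in_charts /= iK.
exists U', A, b, Ot; split=> //.
  split; last by split=> //; rewrite phiE.
  rewrite openE => q [Uq iq jq Oq].
  have nU : nbhs q U by exact: open_nbhs_nbhs.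
  have ni : nbhs q (cdom i) by exact: open_nbhs_nbhs.
  have nF : nbhs q (F @^-1` cdom j).
    apply: (sF.1 q Uq); apply: open_nbhs_nbhs; split=> //; exact: product_cdom_open.
  have nO : nbhs q (fun y => O1 (phi (cmap i y))).
    have cphi : {for cmap i q, continuous phi}.
      by apply: (sF.2 i j 0%N); exists q.
    apply: (continuous_comp (icont q iq) cphi); exact: open_nbhs_nbhs.
  by apply: filterS (filterI (filterI nU ni) (filterI nF nO)) => y [[? ?] [? ?]].
rewrite -O1E; apply/seteqP; split=> [_ [q [Uq iq jq Oq] <-]|_ [w Ow <-]].
  exists (phi (cmap i q)) => //; rewrite /T /Y /X /= phiE //.
  have Wq' : W (cmap j (F q)).
    by apply: OW; apply: O1O; rewrite -phiE.
  rewrite cpsi // product_cmapK //.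
  by have [_ ->] := UF q Uq.
have Ww : W w by apply: OW; exact: O1O.
have [[[jw _] iw] cw] := Wq w Ww; have [Uw Fw] := FG w Ww.
exists (G (cinv j w)); last by rewrite /T /Y /X /= cpsi.
by split=> //; rewrite ?Fw // phiE // Fw cw.
Qed.

Theorem theorem1p2 (R : realType) (n : nat) (M : charted_space R n)
    (x xi : M -> 'rV[R]_n.+1) (h : metric M)
    (I : set R) (N : charted_space R n.-1) (g : metric N) (c : R) :
  (3 <= n)%N ->
  smooth_manifold M ->
  [set: M] !=set0 ->
  immersed_hypersurface x ->
  affine_normal x xi h ->
  positive_definite h ->
  affine_hypersphere x xi ->
  is_interval I ->
  smooth_manifold N ->
  riemannian_metric g ->
  constant_sectional_curvature g c ->
  c != 0 ->
  locally_isometric_to_interval_product h I g ->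
  c < 0 /\ locally_affinely_equivalent x (calabi_composition R n).
Proof.
case: n M x xi h N g => [|m] // M x xi h N g n3 Mm [p0 _] imm nor _ sph _ Nm gm gc c0 iso.
have local p := @hypersphere_locally_calabi R m M x xi h I N g c p n3 Mm imm nor sph Nm gm gc c0 iso.
by split=> [|p]; [case: (local p0) | case: (local p)].
Qed.
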